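(* Consider the multi-component Curie–Weiss Ising model described in the context, with $\mathbf K$ positive definite and $\beta=\beta_{cr}$. Then there exist constants $C_1,C_2>0$ (independent of $n$) such that the mixing time of the Glauber dynamics satisfies \[ C_1n^{3/2}\le t_{mix}^{(n)}\le C_2n^{3/2}. \]
   Context: Fix an integer $m\ge 1$, proportions $p_1,\dots,p_m>0$ with $\sum_i p_i=1$, and a symmetric matrix $\mathbf K=(k_{ij})_{1\le i,j\le m}$ with all $k_{ij}>0$. The parameter $n$ ranges over positive integers with $np_i\in\mathbb N$ for all $i$. The vertex set $V=\{1,\dots,n\}$ is partitioned into blocks $G_1,\dots,G_m$ with $|G_i|=np_i$; for $v\in G_i,w\in G_j$ put $K(v,w)=k_{ij}/n$. The state space is $\Omega=\{-1,+1\}^V$ and, for inverse temperature $\beta\ge0$, the Gibbs measure is $\mu_n(\sigma)\propto\exp\big(\beta\sum_{\{v,w\},v\ne w}K(v,w)\sigma(v)\sigma(w)\big)$. The Glauber dynamics $(\sigma_t)_{t\ge0}$ picks at each step a vertex $v$ uniformly from $V$ and sets its spin to $\pm1$ with probability $r_\pm(S^v)=\frac{1\pm\tanh(\beta S^v)}{2}$, $S^v=\sum_{w\ne v}K(v,w)\sigma(w)$, other spins unchanged. Let $d_n(t)=\max_{\sigma}\|\mathbb P_\sigma(\sigma_t\in\cdot)-\mu_n\|_{TV}$ and $t_{mix}^{(n)}=\min\{t: d_n(t)\le 1/4\}$. Let $\mathbf B=(p_ik_{ij})_{i,j}$ and let $\mathbf a>0$ be the left Perron eigenvector of $\mathbf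 B$ normalized by $\|\mathbf a\|_1=1$; define $\beta_{cr}:=\big(\sum_{i,j}a_ip_ik_{ij}\big)^{-1}$. *)

(* Defs.v *)
From HB Require Import structures.
From mathcomp Require Import all_boot all_order all_algebra.
From mathcomp Require Import all_classical all_reals all_analysis.
Set Implicit Arguments. Unset Strict Implicit. Unset Printing Implicit Defensive.
Import Order.TTheory GRing.Theory Num.Theory.
Local Open Scope ring_scope.

Definition state (n : nat) := {ffun 'I_n -> bool}.

Definition spin {R : realType} (b : bool) : R := if b then 1 else -1.

Definition tanhR {R : realType} (x : R) : R :=
  (expR x - expR (- x)) / (expR x + expR (- x)).

(* interaction K(v,w) = k_{ij}/n for v in G_i, w in G_j; blk v = block of v *)
Definition Kint {R : realType} {m n : nat} (k : 'M[R]_m) (blk : 'I_n -> 'I_m)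
  (v w : 'I_n) : R := k (blk v) (blk w) / n%:R.

Definition locfield {R : realType} {m n : nat} (k : 'M[R]_m) (blk : 'I_n -> 'I_m)
  (s : state n) (v : 'I_n) : R :=
  \sum_(w : 'I_n | w != v) Kint k blk v w * spin (s w).

Definition rate {R : realType} (beta : R) (b : bool) (S : R) : R :=
  (1 + spin b * tanhR (beta * S)) / 2.

Definition glauber {R : realType} {m n : nat} (k : 'M[R]_m) (blk : 'I_n -> 'I_m)
  (beta : R) (s t : state n) : R :=
  n%:R^-1 * \sum_(v : 'I_n)
     (if [forall w : 'I_n, (w != v) ==> (t w == s w)]
      then rate beta (t v) (locfield k blk s v) else 0).

Fixpoint law {R : realType} {m n : nat} (k : 'M[R]_m) (blk : 'I_n -> 'I_m)
  (beta : R) (t : nat) (s : state n) : state n -> R :=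
  match t with
  | 0 => fun u => if u == s then 1 else 0
  | t'.+1 => fun u => \sum_(x : state n) law k blk beta t' s x * glauber k blk beta x u
  end.

Definition gibbs_weight {R : realType} {m n : nat} (k : 'M[R]_m) (blk : 'I_n -> 'I_m)
  (beta : R) (s : state n) : R :=
  expR (beta * \sum_(v : 'I_n) \sum_(w : 'I_n | (v < w)%N)
                 Kint k blk v w * spin (s v) * spin (s w)).

Definition gibbs {R : realType} {m n : nat} (k : 'M[R]_m) (blk : 'I_n -> 'I_m)
  (beta : R) (s : state n) : R :=
  gibbs_weight k blk beta s / \sum_(u : state n) gibbs_weight k blk beta u.

Definition tv {R : realType} {T : finType} (mu nu : T -> R) : R :=
  2^-1 * \sum_(x : T) `|mu x - nu x|.

(* d_n(t) = max_sigma || P_sigma(sigma_t in .) - mu_n ||_TV  (TV >= 0) *)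
Definition dist_mix {R : realType} {m n : nat} (k : 'M[R]_m) (blk : 'I_n -> 'I_m)
  (beta : R) (t : nat) : R :=
  \big[Num.max/0]_(s : state n) tv (law k blk beta t s) (gibbs k blk beta).

(* t_mix = min { t : d(t) <= 1/4 } (set to 0 if that set were empty) *)
Definition tmix {R : realType} {m n : nat} (k : 'M[R]_m) (blk : 'I_n -> 'I_m)
  (beta : R) : nat :=
  match pselect (exists t, dist_mix k blk beta t <= 4^-1) with
  | left h => ex_minn h
  | right _ => 0%N
  end.

Definition posdef {R : realType} {m : nat} (K : 'M[R]_m) : Prop :=
  K^T = K /\ forall x : 'cV[R]_m, x != 0 -> 0 < (x^T *m K *m x) ord0 ord0.

Definition left_perron_vector {R : realType} {m : nat} (B : 'M[R]_m) (a : 'I_m -> R)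
  : Prop :=
  (forall i, 0 < a i) /\ \sum_i a i = 1 /\
  exists lam : R, forall j, \sum_i a i * B i j = lam * a j.

(* Main.v *)
(** Write [M_i] for the block magnetizations, [h = K M] for the fields, [Q = M^T K M] for the
energy and [X = sum_i a_i M_i]; a Perron (Schur test) argument gives [beta P <= K^-1], with equality
only in the critical direction, so that [E(dQ) <= - c Q^2 / n + C / n^2] and [X] has cubic drift.

Upper bound.  The recursion for [E Q] comes down from infinity, whence [E Q = O(n^{-1/2})] at time
[n^{3/2}].  Two independent copies with such energies are then run until their magnetizations are
at distance [O(n^{-1/2})]: with [V = D^2 + B (Delta^T K Delta)], where [D] is the difference of the
two [X]'s and [B] is small, the concave function [V^{1/4}] decreases on average by at least
[c n^{-2} V^{-3/4}], the noise in the direction [D] beating the contracted orthogonal ones.  Once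
transpositions within the blocks, whose effect on the law decays like [(1 - c/n)^t], have made the
two states agree as much as possible, [O(n^{1/2})] disagreements remain, and under the vertexwise
maximal coupling their weighted number [H] is a critical branching process, for which [sqrt H]
decreases on average by [c / (n sqrt H)].

Lower bound.  Stationarity applied to a smoothed [|X|] shows that [|X|] is at least of order
[n^{-1/4}] under the Gibbs measure with probability [3/4], while from a state of minimal energy
[E Q] grows by at most [C / n^2] per step, so that [X^2] is still much smaller than [n^{-1/2}]
at time [c n^{3/2}]. *)
Require Import Defs.
From HB Require Import structures.
From mathcomp Require Import all_boot all_order all_fingroup all_algebra.
From mathcomp Require Import all_classical all_reals all_analysis.
From mathcomp Require Import ring lra.
Set Implicit Arguments.
Unset Strict Implicit.
Unset Printing Implicit Defensive.
Import Order.TTheory GRing.Theory Num.Theory.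
Local Open Scope ring_scope.

(** At criticality the linearized drift vanishes along the critical direction, so no metric
    contracts and two copies can be brought together there only by noise. This dictates the concave
    powers. Without drift [|D|] is merely neutral on average, and since [V] is close to [D^2] its
    exponent has to lie strictly below 1/2. The weighted number of disagreements is likewise only
    neutral, hence its square root. The drift estimate for a pair holds only while both energies are
    below a constant. Elsewhere [V^{1/4}] may grow, and a penalty in the squares of the two
    energies, with weight of order [n^{1/4}], pays for this. No process, coupling measure or
    stopping time is constructed. Everything is expressed through the averaging operator [step] on
    functions: total variation becomes the dual bound [close], a coupling becomes a one-step
    inequality for differences [g x - g y], and running a coupling until it hits a set becomes an
    induction on time with a bound affine in the Lyapunov function. *)

(** * Elementary estimates for the hyperbolic tangent *)

Section tanh.
Variable R : realType.
Implicit Types x y : R.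

Lemma tanhR0 : tanhR 0 = 0 :> R.
Proof. by rewrite /tanhR oppr0 subrr mul0r. Qed.

Lemma tanhRN x : tanhR (- x) = - tanhR x.
Proof.
rewrite /tanhR opprK [expR (- x) + _]addrC -mulNr; congr (_ / _); ring.
Qed.

Lemma tanhR_sqr_lt1 x : tanhR x ^+ 2 < 1.
Proof.
have Ep := expR_gt0 x; have En := expR_gt0 (- x).
rewrite /tanhR expr_div_n ltr_pdivrMr ?mul1r; last by rewrite exprn_gt0 // addr_gt0.
rewrite -subr_gt0.
have -> : (expR x + expR (- x)) ^+ 2 - (expR x - expR (- x)) ^+ 2
   = 4 * (expR x * expR (- x)) by ring.
by rewrite mulr_gt0 // mulr_gt0.
Qed.

Lemma is_derive_tanhR x : is_derive x 1 (@tanhR R) (1 - tanhR x ^+ 2).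
Proof.
have S0 z : expR z + expR (- z) != 0 :> R by rewrite gt_eqF // addr_gt0 ?expR_gt0.
have dN : is_derive x 1 (fun z : R => expR (- z)) (- expR (- x)).
  by apply: is_derive_eq; rewrite mulrN1.
have dV := @is_deriveV R (fun z : R => expR z + expR (- z)) x _ 1 (S0 x)
     (is_deriveD (is_derive_expR x) dN).
have H := is_deriveM (is_deriveB (is_derive_expR x) dN) dV.
apply: (is_derive_eq H).
rewrite /tanhR /GRing.scale /=; move: (S0 x).
set u := expR x; set v := expR (- x) => uv.
have -> : (expR - (fun z : R => expR (- z))) x = u - v by []; by field.
Qed.

Lemma tanhR_MVT x y : y < x -> exists xi,
  [/\ y < xi, xi < x & tanhR x - tanhR y = (1 - tanhR xi ^+ 2) * (x - y)].
Proof.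
move=> yx; have [|||xi] := @MVT R (@tanhR R) (fun z => 1 - tanhR z ^+ 2) y x.
- by [].
- by move=> z _; exact: is_derive_tanhR.
- by apply: derivable_within_continuous => z _; have [] := is_derive_tanhR z.
- by rewrite in_itv /= => /andP[? ?] ->; exists xi.
Qed.

Lemma tanhR_nondecr_lip x y : y <= x -> 0 <= tanhR x - tanhR y <= x - y.
Proof.
rewrite le_eqVlt => /predU1P[->|yx]; first by rewrite !subrr lexx.
have [xi [_ _ ->]] := tanhR_MVT yx.
have := tanhR_sqr_lt1 xi; have := sqr_ge0 (tanhR xi); move: yx.
by move=> *; apply/andP; split; nra.
Qed.

Lemma tanhR_lip x y : `|tanhR x - tanhR y| <= `|x - y|.
Proof.
wlog yx : x y / y <= x => [wl|].
  by case: (leP y x) => [|/ltW] /wl // H; rewrite distrC (distrC x).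
have /andP[? ?] := tanhR_nondecr_lip yx.
by rewrite !ger0_norm // subr_ge0.
Qed.

Lemma tanhR_sqr_le x : tanhR x ^+ 2 <= x ^+ 2.
Proof.
have := tanhR_lip x 0; rewrite tanhR0 !subr0.
by rewrite -ler_sqr ?nnegrE ?normr_ge0 // !real_normK ?num_real.
Qed.

Lemma tanhR_ge0 x : 0 <= x -> 0 <= tanhR x.
Proof. by move/tanhR_nondecr_lip; rewrite tanhR0 !subr0 => /andP[]. Qed.

Lemma tanhR_lt1 x : tanhR x < 1.
Proof. by have := tanhR_sqr_lt1 x; have := sqr_ge0 (tanhR x); nra. Qed.

Lemma tanhR_norm_le x u : `|x| <= u -> `|tanhR x| <= tanhR u.
Proof.
rewrite !ler_norml => /andP[h1 h2].
have /andP[+ _] := tanhR_nondecr_lip h1; have /andP[+ _] := tanhR_nondecr_lip h2.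
by rewrite tanhRN => *; apply/andP; split; lra.
Qed.

(** The mean value point lies between [x] and [y], so its square is at most the sum of theirs. Later
    [theta] measures the failure of linearity, which is small when both fields are. *)
Lemma tanhR_slope x y : exists theta, [/\ 0 <= theta, theta <= x ^+ 2 + y ^+ 2 &
  (x - y) - (tanhR x - tanhR y) = theta * (x - y)].
Proof.
have between u v t : v < t -> t < u -> t ^+ 2 <= u ^+ 2 + v ^+ 2 :> R.
  move=> h1 h2; have [t0|t0] := leP 0 t.
  - have := sqr_ge0 v; have : t ^+ 2 <= u ^+ 2 by nra.
    lra.
  - have := sqr_ge0 u; have : t ^+ 2 <= v ^+ 2 by nra.
    lra.
have [xy|yx|->] := ltgtP x y; last first.
- by exists 0; rewrite !subrr mul0r lexx addr_ge0 ?sqr_ge0.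
- have [xi [h1 h2 e]] := tanhR_MVT yx.
  exists (tanhR xi ^+ 2); rewrite sqr_ge0 e; split=> //; last by ring.
  exact: le_trans (tanhR_sqr_le _) (between _ _ _ h1 h2).
- have [xi [h1 h2 e]] := tanhR_MVT xy.
  exists (tanhR xi ^+ 2); rewrite sqr_ge0; split=> //.
    by rewrite [X in _ <= X]addrC; exact: le_trans (tanhR_sqr_le _) (between _ _ _ h1 h2).
  by rewrite -[tanhR x - _]opprB e; ring.
Qed.

Lemma sub_tanhR_cubic x : `|x - tanhR x| <= `|x| ^+ 3.
Proof.
have [th [t0 t1]] := tanhR_slope x 0; rewrite tanhR0 !subr0 => ->.
rewrite normrM ger0_norm // exprSr ler_wpM2r //.
by apply: le_trans t1 _; rewrite expr0n addr0 real_normK ?num_real.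
Qed.

(** This quartic loss is the only damping left once the linear terms cancel at criticality. *)
Lemma tanhR_quartic (X0 : R) : 0 < X0 -> exists2 c, 0 < c &
  forall x, `|x| <= X0 -> c * x ^+ 4 <= x * (x - tanhR x).
Proof.
move=> X0_gt0; set q := 1 - tanhR X0 ^+ 2.
have q0 : 0 < q by rewrite subr_gt0 tanhR_sqr_lt1.
have lin y : 0 <= y -> y <= X0 -> q * y <= tanhR y.
  rewrite le_eqVlt => /predU1P[<-|y0 yX]; first by rewrite mulr0 tanhR0.
  have [xi [h1 h2]] := tanhR_MVT y0; rewrite tanhR0 !subr0 => ->.
  apply: ler_wpM2r; first exact: ltW.
  have /andP[H _] := tanhR_nondecr_lip (le_trans (ltW h2) yX).
  have := tanhR_ge0 (ltW h1); rewrite /q; nra.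
(* The mean value theorem on [[x/2, x]] keeps the intermediate point away from zero, where
   [tanhR xi >= q x / 2]; here [q] bounds the derivative below on [[0, X0]]. The constant is
   [(q/2)^2] times the relative length [1/2] of the interval. *)
have pos x : 0 < x -> x <= X0 -> q ^+ 2 / 8 * x ^+ 3 <= x - tanhR x.
  move=> x0 xX; have hx : x / 2 < x by lra.
  have [xi [h1 h2 e]] := tanhR_MVT hx.
  have hx0 : 0 <= x / 2 by lra.
  have /andP[_] := tanhR_nondecr_lip hx0; rewrite tanhR0 !subr0 => b2.
  have l1 : q * (x / 2) <= tanhR (x / 2) by apply: lin; lra.
  have /andP[l2 _] := tanhR_nondecr_lip (ltW h1).
  have l3 : q * (x / 2) <= tanhR xi by lra.
  have l4 : (q * (x / 2)) ^+ 2 <= tanhR xi ^+ 2.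
    apply: lerXn2r; rewrite ?nnegrE //; first by rewrite mulr_ge0 // ltW.
    by apply: tanhR_ge0; lra.
  have l5 : (q * (x / 2)) ^+ 2 * (x / 2) <= tanhR xi ^+ 2 * (x / 2) by apply: ler_wpM2r.
  have -> : q ^+ 2 / 8 * x ^+ 3 = (q * (x / 2)) ^+ 2 * (x / 2) by field.
  by move: e l5; lra.
exists (q ^+ 2 / 8); first by rewrite divr_gt0 ?exprn_gt0.
move=> x; rewrite ler_norml => /andP[xl xu]; have [x0|x0|->] := ltgtP x 0; last first.
- by rewrite tanhR0 mul0r expr0n mulr0.
- have H := pos _ x0 xu; rewrite exprS mulrCA ler_wpM2l // ltW //.
- have nx0 : 0 < - x by lra.
  have nxX : - x <= X0 by lra.
  have := ler_wpM2l (ltW nx0) (pos _ nx0 nxX).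
  rewrite tanhRN.
  have -> : - x * (q ^+ 2 / 8 * (- x) ^+ 3) = q ^+ 2 / 8 * x ^+ 4 by ring.
  by have -> : - x * (- x - - tanhR x) = x * (x - tanhR x) by ring.
Qed.

End tanh.

(** * Quadratic forms and the Perron direction *)

(** A harmonic constant instead of a minimum, so that an empty index type needs no separate case. *)
Lemma finite_pos_lb (R : realType) (I : finType) (f : I -> R) : (forall i, 0 < f i) ->
  exists2 c, 0 < c & forall i, c <= f i.
Proof.
move=> f0; have S0 : 0 <= \sum_i (f i)^-1 by apply: sumr_ge0 => i _; rewrite invr_ge0 ltW.
have S1 : 0 < 1 + \sum_i (f i)^-1 by rewrite ltr_pwDl.
exists (1 + \sum_i (f i)^-1)^-1; first by rewrite invr_gt0.
move=> i; rewrite -[f i]invrK lef_pV2 ?posrE ?invr_gt0 //.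
rewrite (bigD1 i) //= addrCA lerDl addr_ge0 //.
by apply: sumr_ge0 => j _; rewrite invr_ge0 ltW.
Qed.

Lemma ler_sum_term (R : realType) (I : finType) (f : I -> R) (i : I) :
  (forall i, 0 <= f i) -> f i <= \sum_j f j.
Proof. by move=> f0; rewrite (bigD1 i) //= lerDl sumr_ge0. Qed.

Section QuadraticForm.
Variables (R : realType) (m : nat).
Implicit Types (x y z : 'I_m -> R) (k : 'M[R]_m).

Definition kform k x y : R := \sum_i \sum_j k i j * x i * y j.

Definition kfield k x (i : 'I_m) : R := \sum_j k i j * x j.

Lemma kformE k x y : kform k x y = \sum_i x i * kfield k y i.
Proof.
apply: eq_bigr => i _; rewrite /kfield mulr_sumr; apply: eq_bigr => j _; ring.
Qed.

Lemma kformDl k x y z : kform k (fun i => x i + y i) z = kform k x z + kform k y z.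
Proof.
rewrite /kform -big_split; apply: eq_bigr => i _ /=.
rewrite -big_split; apply: eq_bigr => j _ /=; ring.
Qed.

Lemma kformZl k c x z : kform k (fun i => c * x i) z = c * kform k x z.
Proof.
rewrite /kform mulr_sumr; apply: eq_bigr => i _ /=.
rewrite mulr_sumr; apply: eq_bigr => j _ /=; ring.
Qed.

Lemma kform_sumr k (J : finType) (w : J -> R) (f : J -> 'I_m -> R) x :
  kform k x (fun i => \sum_j w j * f j i) = \sum_j w j * kform k x (f j).
Proof.
rewrite kformE.
under eq_bigr => i _.
  rewrite /kfield mulr_sumr.
  under eq_bigr => l _ do rewrite !mulr_sumr.
  rewrite exchange_big; over.
rewrite exchange_big; apply: eq_bigr => j _.
rewrite kformE mulr_sumr; apply: eq_bigr => i _.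
by rewrite /kfield !mulr_sumr; apply: eq_bigr => l _; ring.
Qed.

Lemma kfieldD k x y i : kfield k (fun i => x i + y i) i = kfield k x i + kfield k y i.
Proof. by rewrite /kfield -big_split; apply: eq_bigr => j _ /=; ring. Qed.

Lemma kfieldB k x y i : kfield k (fun i => x i - y i) i = kfield k x i - kfield k y i.
Proof. by rewrite /kfield -sumrB; apply: eq_bigr => j _ /=; ring. Qed.

Lemma kfieldZ k c x i : kfield k (fun i => c * x i) i = c * kfield k x i.
Proof. by rewrite /kfield mulr_sumr; apply: eq_bigr => j _ /=; ring. Qed.

Lemma kform_le_entries k x c : (forall i j, 0 < k i j) -> 0 <= c ->
  (forall i, `|x i| <= c) -> kform k x x <= (\sum_i \sum_j k i j) * c ^+ 2.
Proof.
move=> k0 c0 xc; rewrite /kform mulr_suml; apply: ler_sum => i _.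
rewrite mulr_suml; apply: ler_sum => j _; rewrite -mulrA.
apply: ler_wpM2l; first exact: ltW.
rewrite expr2; apply: le_trans (ler_norm _) _; rewrite normrM.
by apply: ler_pM.
Qed.

End QuadraticForm.

Section Symmetric.
Variables (R : realType) (m : nat) (k : 'M[R]_m).
Hypothesis ksym : forall i j, k i j = k j i.
Implicit Types (x y z : 'I_m -> R).

Lemma kformC x y : kform k x y = kform k y x.
Proof.
rewrite /kform exchange_big; apply: eq_bigr => i _; apply: eq_bigr => j _.
by rewrite ksym; ring.
Qed.

Lemma kformDr x y z : kform k x (fun i => y i + z i) = kform k x y + kform k x z.
Proof. by rewrite kformC kformDl kformC (kformC z). Qed.

Lemma kformZr c x z : kform k x (fun i => c * z i) = c * kform k x z.
Proof. by rewrite kformC kformZl kformC. Qed.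

Lemma kform_sqrD x y : kform k (fun i => x i + y i) (fun i => x i + y i) =
  kform k x x + 2 * kform k x y + kform k y y.
Proof. by rewrite kformDl !kformDr (kformC y x); ring. Qed.

End Symmetric.

Section PosDef.
Variables (R : realType) (m : nat) (k : 'M[R]_m).
Hypothesis kpd : posdef k.
Implicit Types (x y z : 'I_m -> R).

Lemma kform_mx x y :
  kform k x y = ((\col_i x i)^T *m k *m (\col_i y i)) ord0 ord0.
Proof.
rewrite /kform -mulmxA mxE; apply: eq_bigr => i _.
rewrite !mxE mulr_sumr; apply: eq_bigr => j _; rewrite !mxE; ring.
Qed.

Lemma posdef_sym i j : k i j = k j i.
Proof. by case: kpd => <- _; rewrite mxE; case: kpd => -> _. Qed.

Lemma kform_ge0 x : 0 <= kform k x x.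
Proof.
rewrite kform_mx; have [->|x0] := eqVneq (\col_i x i) 0.
  by rewrite mulmx0 mxE.
by case: kpd => _ /(_ _ x0) /ltW.
Qed.

Lemma kform_CS x y : kform k x y ^+ 2 <= kform k x x * kform k y y.
Proof.
have H s t : 0 <= s ^+ 2 * kform k x x + 2 * (s * t) * kform k x y + t ^+ 2 * kform k y y.
  have := kform_ge0 (fun i => s * x i + t * y i).
  by rewrite (kform_sqrD posdef_sym) !(kformZl, kformZr posdef_sym); congr (_ <= _); ring.
have X0 := kform_ge0 x; have Y0 := kform_ge0 y.
have [Y|Y] := ltP 0 (kform k y y).
  have := H (kform k y y) (- kform k x y).
  have -> : kform k y y ^+ 2 * kform k x x + 2 * (kform k y y * - kform k x y) * kform k x y +
     (- kform k x y) ^+ 2 * kform k y y = kform k y y * (kform k x x * kform k y y - kform k x y ^+ 2) by ring.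
  by rewrite pmulr_rge0 // subr_ge0.
have {}Y : kform k y y = 0 by apply/eqP; rewrite eq_le Y Y0.
(* When [kform k y y] vanishes, these coefficients reduce the non-negative form to
   [- (kform k x y)^2]. *)
rewrite Y mulr0; have := H (- kform k x y) (kform k x x / 2 + 1 / 2).
rewrite Y; set s := kform k x y; set u := kform k x x in X0 *.
by have := sqr_ge0 s; nra.
Qed.

Lemma kform_le2 x y : kform k (fun i => x i - y i) (fun i => x i - y i) <=
  2 * kform k x x + 2 * kform k y y.
Proof.
have := kform_ge0 (fun i => x i + y i).
have -> : (fun i => x i - y i) = (fun i => x i + (-1) * y i).
  by apply/funext => i; rewrite mulN1r.
by rewrite !(kform_sqrD posdef_sym) !(kformZl, kformZr posdef_sym); lra.
Qed.

(** No spectral theorem is needed: for [y = k^-1 x] the value [kform k x y] is [|x|^2] and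
    [kform k y y] is at most a multiple of [|x|^2], so Cauchy-Schwarz gives the claim after division
    by [|x|^2]. *)
Lemma kform_coercive : exists2 C, 0 < C & forall x, \sum_i x i ^+ 2 <= C * kform k x x.
Proof.
have ku : k \in unitmx.
  rewrite unitmxE unitfE; apply/negP => /det0P [v v0 vk].
  have [_ /(_ v^T)] := kpd; rewrite trmxK vk mul0mx mxE ltxx => H.
  by suff: false by []; apply: H; rewrite -(inj_eq trmx_inj) trmx0 trmxK.
pose L := invmx k.
pose C := 1 + \sum_i \sum_j `|L i j|.
have C0 : 0 < C by rewrite ltr_pwDl // sumr_ge0 // => i _; rewrite sumr_ge0.
exists C => // x.
pose X := \col_i x i; pose y i := (L *m X) i ord0.
have yX : \col_i y i = L *m X by apply/colP => i; rewrite mxE.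
have e1 : kform k x y = \sum_i x i ^+ 2.
  rewrite kform_mx yX -mulmxA mulKVmx // mxE; apply: eq_bigr => i _.
  by rewrite !mxE -expr2.
have e2 : kform k y y <= C * \sum_i x i ^+ 2.
  rewrite kform_mx yX -mulmxA mulKVmx // mxE.
  have -> : \sum_j (L *m X)^T ord0 j * X j ord0 = \sum_i \sum_j L i j * (x i * x j).
    apply: eq_bigr => i _; rewrite !mxE mulr_suml; apply: eq_bigr => j _.
    by rewrite !mxE; ring.
  apply: (@le_trans _ _ (\sum_i \sum_j `|L i j| * \sum_l x l ^+ 2)).
    apply: ler_sum => i _; apply: ler_sum => j _; apply: le_trans (ler_norm _) _.
    rewrite normrM ler_wpM2l // normrM.
    have s0 l : 0 <= x l ^+ 2 by apply: sqr_ge0.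
    have := ler_sum_term i s0; have := ler_sum_term j s0.
    rewrite -[x i ^+ 2]real_normK ?num_real // -[x j ^+ 2]real_normK ?num_real //.
    set u := `|x i|; set v := `|x j| => h1 h2; have := sqr_ge0 (u - v); nra.
  under eq_bigr => i _ do rewrite -mulr_suml.
  rewrite -mulr_suml /C mulrDl mul1r lerDr sumr_ge0 // => i _; exact: sqr_ge0.
have := kform_CS x y; rewrite e1.
have S0 : 0 <= \sum_i x i ^+ 2 by apply: sumr_ge0 => i _; exact: sqr_ge0.
have X0 := kform_ge0 x.
move: e2 S0 X0; set S := \sum_i x i ^+ 2; set u := kform k x x; set v := kform k y y.
move=> e2 S0 X0 H; have [S1|] := ltP 0 S; last first.
  by move=> S1; apply: le_trans S1 _; rewrite mulr_ge0 // ltW.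
have H2 : S * S <= S * (C * u) by apply: le_trans (_ : u * v <= _); [rewrite -expr2 // | nra].
by move: H2; rewrite ler_pM2l.
Qed.

End PosDef.

Section Perron.
Variables (R : realType) (m : nat) (p a : 'I_m -> R) (k : 'M[R]_m) (lam : R).
Hypotheses (p_gt0 : forall i, 0 < p i) (a_gt0 : forall i, 0 < a i).
Hypothesis kpd : posdef k.
Hypothesis eig : forall i, \sum_j k i j * p j * a j = lam * a i.
Implicit Types (r w x : 'I_m -> R).

Let A2 := \sum_i p i * a i ^+ 2.

(** The matrix [k] maps the vector [p_i a_i] to [lam a], and by symmetry it can be moved from [r] to
    that vector. *)
Lemma perron_field r : \sum_i p i * a i * kfield k r i = lam * \sum_i a i * r i.
Proof.
rewrite mulr_sumr.
under eq_bigr => i _ do rewrite mulr_sumr.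
rewrite exchange_big; apply: eq_bigr => j _ /=.
rewrite mulrA -eig mulr_suml; apply: eq_bigr => i _; rewrite (posdef_sym kpd i j); ring.
Qed.

(* Schur's test with the Perron weights, after removing a rank one part. *)
Lemma schur_perron eps w : 0 <= eps -> (forall i j, eps * (a i * a j) <= k i j) ->
  kform k (fun i => p i * w i) (fun i => p i * w i) <=
    (lam - eps * A2) * (\sum_i p i * w i ^+ 2) + eps * (\sum_i p i * a i * w i) ^+ 2.
Proof.
move=> eps0 epsk.
(* The ratio [a j / a i] is the weight in the inequality between [w i * w j] and the two squares; it
   makes the row sums of [g] an instance of the eigenvector equation. *)
pose g i j := (k i j - eps * (a i * a j)) * (p i * p j) * (w i ^+ 2 * a j / a i).
have gS : \sum_i \sum_j g i j = (lam - eps * A2) * (\sum_i p i * w i ^+ 2).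
  rewrite mulr_sumr; apply: eq_bigr => i _.
  have -> : \sum_j g i j = p i * w i ^+ 2 / a i *
     (\sum_j k i j * p j * a j - eps * a i * \sum_j p j * a j ^+ 2).
    rewrite mulr_sumr -sumrB mulr_sumr; apply: eq_bigr => j _; rewrite /g; ring.
  rewrite eig -/A2; have := lt0r_neq0 (a_gt0 i) => ai.
  by field.
have -> : eps * (\sum_i p i * a i * w i) ^+ 2 =
   \sum_i \sum_j eps * (a i * a j) * (p i * w i) * (p j * w j).
  rewrite expr2 mulr_suml mulr_sumr; apply: eq_bigr => i _.
  by rewrite !mulr_sumr; apply: eq_bigr => j _; ring.
have -> : (lam - eps * A2) * (\sum_i p i * w i ^+ 2) = \sum_i \sum_j (g i j + g j i) / 2.
  have -> : \sum_i \sum_j (g i j + g j i) / 2 =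
      (\sum_i \sum_j g i j + \sum_i \sum_j g j i) / 2.
    rewrite -big_split mulr_suml; apply: eq_bigr => i _ /=.
    by rewrite -big_split mulr_suml.
  by rewrite [X in _ = (_ + X) / 2]exchange_big gS /=; field.
rewrite -big_split; apply: ler_sum => i _; rewrite -big_split; apply: ler_sum => j _ /=.
rewrite -lerBlDr.
have -> : k i j * (p i * w i) * (p j * w j) - eps * (a i * a j) * (p i * w i) * (p j * w j)
  = (k i j - eps * (a i * a j)) * (p i * p j) * (w i * w j) by ring.
have -> : (g i j + g j i) / 2 = (k i j - eps * (a i * a j)) * (p i * p j) *
   ((w i ^+ 2 * a j / a i + w j ^+ 2 * a i / a j) / 2).
  by rewrite /g (posdef_sym kpd j i); ring.
apply: ler_wpM2l.
  by rewrite mulr_ge0 ?subr_ge0 // mulr_ge0 // ltW.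
rewrite -subr_ge0.
have -> : (w i ^+ 2 * a j / a i + w j ^+ 2 * a i / a j) / 2 - w i * w j =
    (w i * a j - w j * a i) ^+ 2 / (2 * (a i * a j)).
  by have := lt0r_neq0 (a_gt0 i); have := lt0r_neq0 (a_gt0 j) => aj ai; field; rewrite aj ai.
by rewrite divr_ge0 ?sqr_ge0 // mulr_ge0 // mulr_ge0 // ltW.
Qed.

Lemma perron_gap_ge0 eps (i0 : 'I_m) : (forall i j, eps * (a i * a j) <= k i j) ->
  0 <= lam - eps * A2.
Proof.
move=> epsk; rewrite -(pmulr_lge0 _ (a_gt0 i0)) mulrBl -eig subr_ge0 /A2 mulr_sumr mulr_suml.
apply: ler_sum => j _.
have -> : eps * (p j * a j ^+ 2) * a i0 = eps * (a i0 * a j) * (p j * a j) by ring.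
by rewrite -(mulrA (k i0 j)) ler_wpM2r ?epsk // mulr_ge0 // ltW.
Qed.

(** Schur's test is applied to the field [w = k r] itself. Cauchy-Schwarz gives
    [S^2 <= kform (p w) (p w) * kform r r], the test bounds the first factor by a multiple of [S],
    and one [S] cancels. The alternative serves two purposes: [eps = 0] gives the inequality for all
    vectors, and orthogonality to [a] removes the rank one term and leaves a spectral gap
    [eps * A2]. *)
Lemma perron_contraction eps r (i0 : 'I_m) : 0 <= eps ->
  (forall i j, eps * (a i * a j) <= k i j) ->
  eps = 0 \/ \sum_i a i * r i = 0 ->
  \sum_i p i * kfield k r i ^+ 2 <= (lam - eps * A2) * kform k r r.
Proof.
move=> eps0 epsk orth; set w := kfield k r; set S := \sum_i p i * w i ^+ 2.
have L0 := perron_gap_ge0 i0 epsk; set L := _ - _ in L0 *.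
have S0 : 0 <= S by apply: sumr_ge0 => i _; rewrite mulr_ge0 ?sqr_ge0 // ltW.
have r0 := kform_ge0 kpd r.
have e1 : kform k (fun i => p i * w i) r = S.
  by rewrite kformE; apply: eq_bigr => i _; rewrite -/w; ring.
have e2 : kform k (fun i => p i * w i) (fun i => p i * w i) <= L * S.
  apply: le_trans (schur_perron _ eps0 epsk) _; rewrite -/S -/L gerDl.
  case: orth => [->|orth]; first by rewrite mul0r.
  by rewrite perron_field orth mulr0 expr0n mulr0.
have := kform_CS kpd (fun i => p i * w i) r; rewrite e1.
move: e2 S0 r0; set u := kform k r r; set v := kform k _ _ => e2 S0 r0 H.
have [S1|] := ltP 0 S; last first.
  by move=> S1; apply: le_trans S1 _; rewrite mulr_ge0.
have H2 : S * S <= S * (L * u).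
  by rewrite -expr2; apply: le_trans H _; rewrite mulrA (mulrC S); apply: ler_wpM2r.
by move: H2; rewrite ler_pM2l.
Qed.

(** The vector [x] is split into a multiple of [p_i a_i] and a rest [r] with [sum_i a_i r_i = 0].
    Since [k] sends the first part to a multiple of [a], the parts are orthogonal for [k], and by
    [perron_field] their fields are orthogonal for the weights [p]. Here [rr] and [rho] are the
    energy and the field of [r]. *)
Lemma perron_decomposition eps x (i0 : 'I_m) : 0 <= eps ->
  (forall i j, eps * (a i * a j) <= k i j) ->
  exists rr (rho : 'I_m -> R), [/\ 0 <= rr,
   kform k x x = lam / A2 * (\sum_i a i * x i) ^+ 2 + rr,
   forall i, kfield k x i = lam / A2 * (\sum_i a i * x i) * a i + rho i,
   \sum_i p i * rho i ^+ 2 <= (lam - eps * A2) * rr &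
   \sum_i p i * kfield k x i ^+ 2 =
     lam ^+ 2 / A2 * (\sum_i a i * x i) ^+ 2 + \sum_i p i * rho i ^+ 2].
Proof.
move=> eps0 epsk; set D := \sum_i a i * x i.
have A2_gt0 : 0 < A2.
  rewrite /A2 (bigD1 i0) //= ltr_pwDl ?mulr_gt0 ?exprn_gt0 //.
  by apply: sumr_ge0 => i _; rewrite mulr_ge0 ?sqr_ge0 // ltW.
have A2_neq0 := lt0r_neq0 A2_gt0.
pose c := D / A2; pose v i := c * (p i * a i); pose r i := x i - v i.
have vF i : kfield k v i = lam * c * a i.
  rewrite /v kfieldZ [RHS]mulrAC -eig mulrC; congr (_ * _).
  by apply: eq_bigr => j _; rewrite mulrA.
have orth : \sum_i a i * r i = 0.
  rewrite /r /v; under eq_bigr => i _ do rewrite mulrBr.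
  rewrite sumrB -/D; have -> : \sum_i a i * (c * (p i * a i)) = c * A2.
    by rewrite mulr_sumr; apply: eq_bigr => i _; ring.
  by rewrite /c divfK // subrr.
exists (kform k r r), (kfield k r).
have xE : x = (fun i => v i + r i) by apply/funext => i; rewrite /r addrC subrK.
have fx i : kfield k x i = lam / A2 * D * a i + kfield k r i.
  by rewrite {1}xE kfieldD vF /c; field.
have rv : kform k r v = 0.
  rewrite kformE; under eq_bigr => i _ do rewrite vF mulrCA (mulrC (r i)).
  by rewrite -mulr_sumr orth mulr0.
have vv : kform k v v = lam / A2 * D ^+ 2.
  rewrite kformE; under eq_bigr => i _ do rewrite vF.
  have -> : \sum_i v i * (lam * c * a i) = lam * c ^+ 2 * A2.
    by rewrite mulr_sumr; apply: eq_bigr => i _; rewrite /v; ring.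
  by rewrite /c; field.
split=> //; first exact: kform_ge0.
- by rewrite xE (kform_sqrD (posdef_sym kpd)) (kformC (posdef_sym kpd) v r) rv vv; ring.
- by apply: perron_contraction => //; right.
- under eq_bigr => i _ do rewrite fx.
  have := perron_field r; rewrite orth mulr0 => pf.
  have E c0 : \sum_i p i * (c0 * a i + kfield k r i) ^+ 2 =
    c0 ^+ 2 * A2 + (2 * c0 * \sum_i p i * a i * kfield k r i
     + \sum_i p i * kfield k r i ^+ 2).
    rewrite /A2 !mulr_sumr -!big_split; apply: eq_bigr => i _ /=; ring.
  by rewrite E pf; field.
Qed.

End Perron.

(** * The Glauber chain as an averaging operator *)

Lemma spin_norm (R : realType) (b : bool) : `|spin b| = 1 :> R.
Proof. by case: b; rewrite /spin ?normrN normr1. Qed.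

Section Rate.
Variable R : realType.
Implicit Types (beta S : R) (b : bool).

Lemma rateE beta b S : rate beta b S =
  expR (spin b * (beta * S)) / (expR (beta * S) + expR (- (beta * S))).
Proof.
rewrite /rate /tanhR; set z := beta * S.
have E : expR z + expR (- z) != 0 by rewrite gt_eqF // addr_gt0 ?expR_gt0.
by case: b; rewrite /spin !(mulN1r, mul1r); field.
Qed.

Lemma rate_gt0 beta b S : 0 < rate beta b S.
Proof. by rewrite rateE divr_gt0 ?addr_gt0 ?expR_gt0. Qed.

Lemma rate_sum beta S : \sum_b rate beta b S = 1.
Proof. by rewrite big_bool /rate /spin /=; field. Qed.

Lemma rate_ge beta b S u : `|beta * S| <= u -> (1 - tanhR u) / 2 <= rate beta b S.
Proof.
move/tanhR_norm_le; rewrite ler_norml => /andP[h1 h2].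
by rewrite /rate; case: b; rewrite /spin; lra.
Qed.

End Rate.

Section Chain.
Variables (R : realType) (m n : nat) (k : 'M[R]_m) (blk : 'I_n -> 'I_m) (beta : R).
Implicit Types (x y s : state n) (v w : 'I_n) (b : bool) (f g : state n -> R).
Local Notation N := (n%:R : R).

Definition upd x v b : state n := [ffun w => if w == v then b else x w].

(** Updates are indexed by the vertex and its new spin and include those that leave the state
    unchanged, so that the index set does not depend on the state. *)
Definition wt x (i : 'I_n * bool) : R := N^-1 * rate beta i.2 (locfield k blk x i.1).

Definition step f x : R := \sum_i wt x i * f (upd x i.1 i.2).

Lemma glauberE f x : \sum_y glauber k blk beta x y * f y = step f x.
Proof.
rewrite /glauber /step.
have -> : \sum_i wt x i * f (upd x i.1 i.2) =
    \sum_v \sum_b N^-1 * rate beta b (locfield k blk x v) * f (upd x v b).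
  by rewrite pair_bigA.
under eq_bigr => y _ do rewrite -mulrA mulr_suml mulr_sumr.
rewrite exchange_big; apply: eq_bigr => v _ /=.
pose C y := [forall w, (w != v) ==> (y w == x w)].
rewrite (bigID C) /= [X in _ + X]big1 ?addr0; last first.
  by move=> y /negbTE; rewrite /C => ->; rewrite mul0r mulr0.
rewrite (partition_big (fun y : state n => y v) xpredT) //=; apply: eq_bigr => b _.
rewrite (big_pred1 (upd x v b)) => [|y /=].
  have Cu : C (upd x v b).
    by apply/forallP => w; apply/implyP => /negbTE wv; rewrite ffunE wv.
  by move: Cu; rewrite /C => ->; rewrite ffunE eqxx mulrA.
apply/andP/eqP => [[/forallP H /eqP yv]|->].
  apply/ffunP => w; rewrite ffunE; case: eqP => [->//|/eqP wv].
  by have /implyP /(_ wv) /eqP := H w.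
rewrite ffunE eqxx; split=> //.
by apply/forallP => w; apply/implyP => /negbTE wv; rewrite ffunE wv.
Qed.

(** Expectations under the forward law become iterates of the backward operator; the remaining
    analysis is carried out on these iterates. *)
Lemma lawE t f s : \sum_u law k blk beta t s u * f u = iter t step f s.
Proof.
elim: t f => [|t IH] f.
  rewrite /= (bigD1 s) //= eqxx mul1r big1 ?addr0 // => u /negbTE ->.
  by rewrite mul0r.
rewrite iterSr -IH /=.
under eq_bigr => u _ do rewrite mulr_suml.
rewrite exchange_big; apply: eq_bigr => x _.
rewrite -glauberE mulr_sumr; apply: eq_bigr => y _; by rewrite mulrA.
Qed.

Hypothesis n_gt0 : (0 < n)%N.

Let N_gt0 : 0 < N. Proof. by rewrite ltr0n. Qed.

Lemma wt_gt0 x i : 0 < wt x i.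
Proof. by rewrite mulr_gt0 ?invr_gt0 // rate_gt0. Qed.

Lemma wt_ge0 x i : 0 <= wt x i.
Proof. exact/ltW/wt_gt0. Qed.

Lemma wt_sumE x (f : 'I_n -> bool -> R) : \sum_i wt x i * f i.1 i.2 =
  N^-1 * \sum_v \sum_b rate beta b (locfield k blk x v) * f v b.
Proof.
rewrite -(pair_bigA _ (fun v b => wt x (v, b) * f v b)) /= mulr_sumr.
apply: eq_bigr => v _; rewrite mulr_sumr; apply: eq_bigr => b _.
by rewrite /wt -mulrA.
Qed.

Lemma wt_sum1 x : \sum_i wt x i = 1.
Proof.
under eq_bigr => i _ do rewrite -[wt x i]mulr1.
rewrite (wt_sumE x (fun _ _ => 1)).
under eq_bigr => v _ do under eq_bigr => b _ do rewrite mulr1.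
under eq_bigr => v _ do rewrite rate_sum.
by rewrite sumr_const card_ord mulVf // gt_eqF.
Qed.

Lemma wt_avg x c : \sum_i wt x i * c = c.
Proof. by rewrite -mulr_suml wt_sum1 mul1r. Qed.

Lemma wt_avg_le x (f : 'I_n * bool -> R) c : (forall i, f i <= c) -> \sum_i wt x i * f i <= c.
Proof.
move=> fc; rewrite -[leRHS](wt_avg x); apply: ler_sum => i _; apply: ler_wpM2l => //.
exact: wt_ge0.
Qed.

Lemma step_le f g x : (forall y, f y <= g y) -> step f x <= step g x.
Proof. by move=> fg; apply: ler_sum => i _; apply: ler_wpM2l => //; exact: wt_ge0. Qed.

Lemma step_cst c x : step (fun=> c) x = c.
Proof. by rewrite /step -mulr_suml wt_sum1 mul1r. Qed.

Lemma stepD f g x : step (fun y => f y + g y) x = step f x + step g x.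
Proof. by rewrite /step -big_split; apply: eq_bigr => i _ /=; ring. Qed.

Lemma stepZ c f x : step (fun y => c * f y) x = c * step f x.
Proof. by rewrite /step mulr_sumr; apply: eq_bigr => i _ /=; ring. Qed.

Lemma step_affine c d f x : step (fun y => c + d * f y) x = c + d * step f x.
Proof. by rewrite (stepD (fun=> c)) step_cst stepZ. Qed.

Lemma iter_step_le t f g x : (forall y, f y <= g y) -> iter t step f x <= iter t step g x.
Proof. by elim: t x => //= t IH x fg; apply: step_le => y; exact: IH. Qed.

Lemma iter_step_cst t c x : iter t step (fun=> c) x = c.
Proof. by elim: t x => //= t IH x; rewrite -[RHS](step_cst c x); congr step; apply/funext. Qed.

Lemma iter_step_affine t c d f x :
  iter t step (fun y => c + d * f y) x = c + d * iter t step f x.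
Proof.
elim: t x => //= t IH x; rewrite -step_affine; congr step; exact/funext.
Qed.

Lemma iter_step01 t f : (forall y, 0 <= f y <= 1) -> forall x, 0 <= iter t step f x <= 1.
Proof.
move=> f01 x; rewrite -{1}(iter_step_cst t 0 x) -(iter_step_cst t 1 x).
by rewrite !iter_step_le // => y; case/andP: (f01 y).
Qed.

(* Total variation distance of the laws at time [t], in its dual form. *)
Definition close t (delta : R) x y := forall f, (forall u, 0 <= f u <= 1) ->
  iter t step f x - iter t step f y <= delta.

(** The operator preserves functions with values in [[0, 1]], so the additional steps can be
    absorbed into the test function. *)
Lemma close_leq t t' d x y : (t <= t')%N -> close t d x y -> close t' d x y.
Proof.
move=> tt' H f f01; rewrite -(subnKC tt') !iterD; apply: H.
exact: iter_step01.
Qed.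

Lemma close_trans t d d' x y z : close t d x y -> close t d' y z -> close t (d + d') x z.
Proof. by move=> H1 H2 f f01; have := H1 f f01; have := H2 f f01; lra. Qed.

Lemma law_sum1 t s : \sum_u law k blk beta t s u = 1.
Proof.
under eq_bigr => u _ do rewrite -[law _ _ _ _ _ _]mulr1.
by rewrite (lawE _ (fun=> 1)) iter_step_cst.
Qed.

Hypothesis ksym : forall i j, k i j = k j i.

(** The interaction between vertices as a matrix with zero diagonal: [kform J] is twice the Gibbs
    exponent without [beta] and [kfield J] is the local field, so the calculus of [kform] applies to
    single spins. *)
Let J : 'M[R]_n := \matrix_(u, w) (if w == u then 0 else Kint k blk u w).

Let Jsym u w : J u w = J w u.
Proof. by rewrite !mxE eq_sym; case: eqP => // _; rewrite /Kint ksym. Qed.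

Let energyE x : \sum_(v : 'I_n) \sum_(w : 'I_n | (v < w)%N) Kint k blk v w * spin (x v) * spin (x w) =
  kform J (fun v => spin (x v)) (fun v => spin (x v)) / 2.
Proof.
pose F (v w : 'I_n) := J v w * spin (x v) * spin (x w).
have E1 : \sum_(v : 'I_n) \sum_(w : 'I_n | (v < w)%N) Kint k blk v w * spin (x v) * spin (x w) =
    \sum_(v : 'I_n) \sum_(w : 'I_n | (v < w)%N) F v w.
  apply: eq_bigr => v _; apply: eq_bigr => w vw; rewrite /F mxE.
  by rewrite -val_eqE /= gtn_eqF.
have E2 : \sum_(v : 'I_n) \sum_(w : 'I_n | (w < v)%N) F v w = \sum_(v : 'I_n) \sum_(w : 'I_n | (v < w)%N) F v w.
  rewrite (exchange_big_dep xpredT) //=; apply: eq_bigr => v _; apply: eq_bigr => w _.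
  by rewrite /F Jsym; ring.
have -> : kform J (fun v => spin (x v)) (fun v => spin (x v)) =
    \sum_(v : 'I_n) \sum_(w : 'I_n | (v < w)%N) F v w + \sum_(v : 'I_n) \sum_(w : 'I_n | (w < v)%N) F v w.
  rewrite -big_split; apply: eq_bigr => v _ /=.
  rewrite (bigID (fun w : 'I_n => (v < w)%N)) /=; congr (_ + _).
  rewrite (bigID (fun w : 'I_n => w == v)) /= big1 ?add0r.
    apply: eq_bigl => w; rewrite -leqNgt -val_eqE /=; by rewrite [RHS]ltn_neqAle andbC.
  by move=> w /andP[_ /eqP ->]; rewrite mxE eqxx !mul0r.
by rewrite E1 E2; field.
Qed.

Let locfieldJ x v : kfield J (fun w => spin (x w)) v = locfield k blk x v.
Proof.
rewrite /kfield (bigD1 v) //= mxE eqxx mul0r add0r.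
by apply: eq_bigr => w /negbTE wv; rewrite mxE wv.
Qed.

Lemma detailed_balance x y :
  gibbs_weight k blk beta x * glauber k blk beta x y =
  gibbs_weight k blk beta y * glauber k blk beta y x.
Proof.
rewrite /glauber !(mulrCA _ N^-1); congr (_ * _); rewrite !mulr_sumr; apply: eq_bigr => v _.
have -> : [forall w, (w != v) ==> (y w == x w)] = [forall w, (w != v) ==> (x w == y w)].
  by apply: eq_forallb => w; rewrite [x w == _]eq_sym.
case: forallP => [xy|_]; last by rewrite !mulr0.
have SE : locfield k blk x v = locfield k blk y v.
  by apply: eq_bigr => w wv; have /implyP /(_ wv) /eqP -> := xy w.
rewrite /gibbs_weight !energyE.
(* The two states differ by a vector supported at [v]. The zero diagonal kills its quadratic term,
   so the exponent changes by the spin difference times the common local field. *)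
pose d u : R := if u == v then spin (y v) - spin (x v) else 0.
have yE : (fun u => spin (y u)) = (fun u => spin (x u) + d u) :> ('I_n -> R).
  apply/funext => u; rewrite /d; case: eqP => [->|/eqP uv]; first by rewrite addrC subrK.
  by have /implyP /(_ uv) /eqP -> := xy u; rewrite addr0.
have dE z : kform J d z = (spin (y v) - spin (x v)) * kfield J z v.
  rewrite kformE (bigD1 v) //= big1 ?addr0 /d ?eqxx // => u /negbTE ->.
  by rewrite mul0r.
have ddE : kform J d d = 0.
  rewrite dE /kfield big1 ?mulr0 // => u _; rewrite /d mxE; case: eqP => _; first by rewrite mul0r.
  by rewrite mulr0.
rewrite yE (kform_sqrD Jsym) (kformC Jsym _ d) ddE dE locfieldJ SE.
rewrite !rateE; set S := locfield k blk y v; set e := kform J _ _.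
rewrite !mulrA -!expRD; congr (expR _ / _); by field.
Qed.

Lemma gibbs_weight_sum_gt0 : 0 < \sum_u gibbs_weight k blk beta u.
Proof.
rewrite (bigD1 [ffun=> true]) //= ltr_pwDl ?expR_gt0 //.
by apply: sumr_ge0 => u _; exact/ltW/expR_gt0.
Qed.

Lemma gibbs_ge0 s : 0 <= gibbs k blk beta s.
Proof. by rewrite divr_ge0 ?ltW ?expR_gt0 // gibbs_weight_sum_gt0. Qed.

Lemma gibbs_sum1 : \sum_s gibbs k blk beta s = 1.
Proof. by rewrite -mulr_suml mulfV // gt_eqF // gibbs_weight_sum_gt0. Qed.

Lemma gibbs_step f :
  \sum_s gibbs k blk beta s * step f s = \sum_s gibbs k blk beta s * f s.
Proof.
under eq_bigr => s _ do rewrite -glauberE mulr_sumr.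
rewrite exchange_big; apply: eq_bigr => y _ /=.
have E s : gibbs k blk beta s * (glauber k blk beta s y * f y) =
   gibbs k blk beta y * f y * (glauber k blk beta y s * 1).
  by rewrite /gibbs mulr1; have := detailed_balance s y; set q := _^-1 => H;
    transitivity (q * f y * (gibbs_weight k blk beta s * glauber k blk beta s y)); [ring | rewrite H; ring].
under eq_bigr => s _ do rewrite E.
by rewrite -mulr_sumr glauberE (step_cst 1) mulr1.
Qed.

Lemma gibbs_iter t f :
  \sum_s gibbs k blk beta s * iter t step f s = \sum_s gibbs k blk beta s * f s.
Proof. by elim: t f => //= t IH f; rewrite gibbs_step IH. Qed.

(** The distance is attained at the indicator [f] of the states where the law exceeds the Gibbs
    measure. By stationarity the Gibbs mean of [f] is that of its iterate, so the distance is a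
    Gibbs average over [y] of differences bounded by [close]. *)
Lemma dist_mix_le t d : 0 <= d -> (forall x y, close t d x y) -> dist_mix k blk beta t <= d.
Proof.
move=> d0 H; rewrite /dist_mix; apply/bigmax_leP; split=> // s _.
pose e u := law k blk beta t s u - gibbs k blk beta u.
pose f u : R := if 0 < e u then 1 else 0.
have E : tv (law k blk beta t s) (gibbs k blk beta) = \sum_u e u * f u.
  have -> : \sum_u e u * f u = \sum_u (2^-1 * `|e u| + 2^-1 * e u).
    apply: eq_bigr => u _; rewrite /f; case: ltP => h.
      by rewrite gtr0_norm //; field.
    by rewrite ler0_norm //; field.
  rewrite big_split -!mulr_sumr /= [X in _ + _ * X]sumrB law_sum1 gibbs_sum1 subrr mulr0 addr0.
  by [].
have f01 u : 0 <= f u <= 1 by rewrite /f; case: ifP => _; rewrite ?lexx ler01.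
have -> : tv (law k blk beta t s) (gibbs k blk beta) =
    \sum_y gibbs k blk beta y * (iter t step f s - iter t step f y).
  rewrite E; under eq_bigr => u _ do rewrite mulrBl.
  rewrite sumrB lawE; under [RHS]eq_bigr => u _ do rewrite mulrBr.
  by rewrite sumrB gibbs_iter -mulr_suml gibbs_sum1 mul1r.
rewrite -[d]mul1r -gibbs_sum1 mulr_suml; apply: ler_sum => y _.
by apply: ler_wpM2l; [exact: gibbs_ge0 | exact: H].
Qed.

(** Both measures have mass one, so [f] may be replaced by [f - 1/2], whose absolute value is at
    most the factor [1/2] in [tv]. *)
Lemma dist_mix_ge t f s : (forall u, 0 <= f u <= 1) ->
  \sum_u gibbs k blk beta u * f u - iter t step f s <= dist_mix k blk beta t.
Proof.
move=> f01; apply: (@le_trans _ _ (tv (law k blk beta t s) (gibbs k blk beta))); last first.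
  exact: (le_bigmax_cond _ (fun s => tv (law k blk beta t s) (gibbs k blk beta))).
have -> : \sum_u gibbs k blk beta u * f u - iter t step f s =
   \sum_u (gibbs k blk beta u - law k blk beta t s u) * (f u - 2^-1).
  rewrite -lawE -sumrB.
  have -> : \sum_u (gibbs k blk beta u - law k blk beta t s u) * (f u - 2^-1) =
     \sum_u (gibbs k blk beta u * f u - law k blk beta t s u * f u) -
      (\sum_u gibbs k blk beta u - \sum_u law k blk beta t s u) * 2^-1.
    by rewrite -sumrB mulr_suml -sumrB; apply: eq_bigr => u _; ring.
  by rewrite gibbs_sum1 law_sum1 subrr mul0r subr0.
rewrite /tv mulr_sumr; apply: ler_sum => u _.
apply: le_trans (ler_norm _) _; rewrite normrM distrC mulrC ler_wpM2r //.
by have := f01 u; rewrite ler_norml; lra.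
Qed.

End Chain.

(** * Block magnetizations and their drift *)

Section Magnetization.
Variables (R : realType) (m n : nat) (p : 'I_m -> R) (k : 'M[R]_m) (blk : 'I_n -> 'I_m).
Variable beta : R.
Hypotheses (n_gt0 : (0 < n)%N) (beta_ge0 : 0 <= beta) (k_gt0 : forall i j, 0 < k i j).
Hypothesis p_ge0 : forall i, 0 <= p i.
Hypothesis blk_size : forall i, (#|[set v | blk v == i]|)%:R = n%:R * p i.
Implicit Types (x y : state n) (v w : 'I_n) (c : 'I_n * bool).
Local Notation N := (n%:R : R).
Local Notation cK := (\sum_i \sum_j k i j).

Let N_gt0 : 0 < N. Proof. by rewrite ltr0n. Qed.

(** Normalized by [n] and not by the size of the block: the fields are then [k] applied to the
    magnetizations, up to self-interaction. *)
Definition magn x (i : 'I_m) : R := N^-1 * \sum_(v | blk v == i) spin (x v).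

Definition incr x c (i : 'I_m) : R :=
  if blk c.1 == i then (spin c.2 - spin (x c.1)) / N else 0.

Lemma magn_upd x c : magn (upd x c.1 c.2) = fun i => magn x i + incr x c i.
Proof.
case: c => v b; apply/funext => i; rewrite /magn /incr /=; have [bv|bv] := eqVneq (blk v) i.
  rewrite (bigD1 v) /= ?bv // [in RHS](bigD1 v) /= ?bv // ffunE eqxx.
  under eq_bigr => w /andP[_ /negbTE wv] do rewrite ffunE wv.
  by field; rewrite gt_eqF.
rewrite addr0; congr (_ * _); apply: eq_bigr => w bw; rewrite ffunE; case: eqP => // wv.
by move: bv; rewrite -wv bw.
Qed.

Lemma incr_le x c i : `|incr x c i| <= 2 / N.
Proof.
rewrite /incr; case: ifP => _; last by rewrite normr0 divr_ge0 // ltW.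
rewrite normrM normfV (gtr0_norm N_gt0) ler_wpM2r ?invr_ge0 ?(ltW N_gt0) //.
by apply: le_trans (ler_normB _ _) _; rewrite !spin_norm.
Qed.

Lemma blk_card i : \sum_(v | blk v == i) (1 : R) = N * p i.
Proof. by rewrite sumr_const -blk_size; congr (_%:R); apply: eq_card => v; rewrite !inE. Qed.

Lemma magn_le x i : `|magn x i| <= p i.
Proof.
rewrite /magn normrM normfV (gtr0_norm N_gt0) mulrC ler_pdivrMr // mulrC -blk_card.
apply: le_trans (ler_norm_sum _ _ _) _.
by apply: ler_sum => v _; rewrite spin_norm.
Qed.

Lemma entry_le i j : k i j <= cK.
Proof.
have h l : 0 <= \sum_j k l j by apply: sumr_ge0 => ? _; exact: ltW.
apply: le_trans (ler_sum_term i h); apply: (ler_sum_term (f := fun j => k i j)) => l.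
exact: ltW.
Qed.

Lemma cK_ge0 : 0 <= cK.
Proof. by apply: sumr_ge0 => i _; apply: sumr_ge0 => j _; exact: ltW. Qed.

Lemma kfield_magn x i : kfield k (magn x) i = \sum_w k i (blk w) / N * spin (x w).
Proof.
rewrite [RHS](partition_big blk xpredT) //=; apply: eq_bigr => j _.
rewrite /magn mulrA mulr_sumr; apply: eq_bigr => w /eqP ->; by [].
Qed.

Lemma locfield_magn x v : locfield k blk x v =
  kfield k (magn x) (blk v) - k (blk v) (blk v) * spin (x v) / N.
Proof.
rewrite kfield_magn (bigD1 v) //= /locfield /Kint.
by rewrite [X in _ = X + _ - _]mulrAC addrAC subrr add0r.
Qed.

Lemma locfield_le x v : `|locfield k blk x v| <= cK.
Proof.
apply: (@le_trans _ _ (\sum_(w : 'I_n) cK / N)); last first.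
  by rewrite sumr_const card_ord -[_ *+ n]mulr_natr divfK // gt_eqF.
apply: le_trans (ler_norm_sum _ _ _) _.
rewrite [leRHS](bigD1 v) //= -[leLHS]add0r lerD ?divr_ge0 ?cK_ge0 ?(ltW N_gt0) //.
apply: ler_sum => w _; rewrite normrM spin_norm mulr1 ger0_norm.
  by rewrite ler_wpM2r ?invr_ge0 ?entry_le ?(ltW N_gt0).
by rewrite divr_ge0 // ltW.
Qed.

Lemma kfield_magn_le x i : `|kfield k (magn x) i| <= cK.
Proof.
rewrite kfield_magn; apply: (@le_trans _ _ (\sum_(w : 'I_n) cK / N)); last first.
  by rewrite sumr_const card_ord -[_ *+ n]mulr_natr divfK // gt_eqF.
apply: le_trans (ler_norm_sum _ _ _) _.
apply: ler_sum => w _; rewrite normrM spin_norm mulr1 ger0_norm.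
  by rewrite ler_wpM2r ?invr_ge0 ?entry_le ?(ltW N_gt0).
by rewrite divr_ge0 // ltW.
Qed.

Lemma rate_locfield_ge x v b :
  (1 - tanhR (beta * cK)) / 2 <= rate beta b (locfield k blk x v).
Proof.
by apply: rate_ge; rewrite normrM ger0_norm // ler_wpM2l // locfield_le.
Qed.

Lemma mean_incr x i : \sum_c wt k blk beta x c * incr x c i =
  N^-1 * (- magn x i + N^-1 * \sum_(v | blk v == i) tanhR (beta * locfield k blk x v)).
Proof.
rewrite (wt_sumE k blk beta x (fun v b => incr x (v, b) i)); congr (_ * _).
rewrite (bigID (fun v => blk v == i)) /= [X in _ + X]big1 ?addr0; last first.
  by move=> v /negbTE bv; rewrite big1 // => b _; rewrite /incr /= bv mulr0.
rewrite /magn -mulrN -mulrDr -sumrN -big_split mulr_sumr; apply: eq_bigr => v /= bv.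
rewrite big_bool /incr /= bv /rate /spin; field; by rewrite gt_eqF.
Qed.

(** The error is the self-interaction of order [1/n] by which the local field differs from the mean
    field, carried through the Lipschitz bound for [tanhR]. *)
Lemma drift_magn x : exists err : 'I_m -> R,
  (forall i, `|err i| <= beta * cK * p i / N) /\
  (forall i, \sum_c wt k blk beta x c * incr x c i =
    N^-1 * (- magn x i + p i * tanhR (beta * kfield k (magn x) i) + err i)).
Proof.
exists (fun i => N^-1 * \sum_(v | blk v == i)
  (tanhR (beta * locfield k blk x v) - tanhR (beta * kfield k (magn x) i))); split=> i.
  rewrite normrM normfV (gtr0_norm N_gt0) mulrC ler_pdivrMr //.
  have -> : beta * cK * p i / N * N = \sum_(v | blk v == i) beta * cK / N.
    by rewrite -[beta * cK / N]mulr1 -mulr_sumr blk_card; field; rewrite gt_eqF.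
  apply: le_trans (ler_norm_sum _ _ _) _; apply: ler_sum => v /eqP bv.
  apply: le_trans (tanhR_lip _ _) _; rewrite locfield_magn bv -mulrBr normrM ger0_norm //.
  rewrite -(mulrA beta) ler_wpM2l // addrAC subrr add0r normrN !normrM normfV spin_norm mulr1.
  by rewrite !gtr0_norm // ler_wpM2r ?invr_ge0 ?entry_le ?(ltW N_gt0).
rewrite mean_incr; congr (_ * _); rewrite -addrA; congr (_ + _).
rewrite sumrB.
have -> : \sum_(v | blk v == i) tanhR (beta * kfield k (magn x) i) =
    N * p i * tanhR (beta * kfield k (magn x) i).
  by rewrite -blk_card mulr_suml; apply: eq_bigr => v _; rewrite mul1r.
by field; rewrite gt_eqF.
Qed.

End Magnetization.

(** * Decay of the energy *)

(** The field [cm_eig] is the left eigenvector equation of [p_i k_ij], transposed by the symmetry of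
    [k]; criticality says that the eigenvalue is [beta^-1]. *)
Record critical_model (R : realType) (m : nat) (p a : 'I_m -> R) (k : 'M[R]_m) (beta : R) :
  Prop := CriticalModel {
    cm_p : forall i, 0 < p i;
    cm_p1 : \sum_i p i = 1;
    cm_k : forall i j, 0 < k i j;
    cm_pd : posdef k;
    cm_a : forall i, 0 < a i;
    cm_a1 : \sum_i a i = 1;
    cm_beta : 0 < beta;
    cm_eig : forall i, \sum_j k i j * p j * a j = beta^-1 * a i }.

Definition blocks (R : realType) (m n : nat) (p : 'I_m -> R) (blk : 'I_n -> 'I_m) :=
  forall i, (#|[set v | blk v == i]|)%:R = n%:R * p i.

Definition energy (R : realType) (m n : nat) (k : 'M[R]_m) (blk : 'I_n -> 'I_m)
  (x : state n) : R := kform k (magn R blk x) (magn R blk x).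

Definition field4 (R : realType) (m n : nat) (p : 'I_m -> R) (k : 'M[R]_m)
  (blk : 'I_n -> 'I_m) (x : state n) : R := \sum_i p i * kfield k (magn R blk x) i ^+ 4.

Section Energy.
Variables (R : realType) (m : nat) (p a : 'I_m -> R) (k : 'M[R]_m) (beta : R).
Hypothesis cm : critical_model p a k beta.

Let p_gt0 := cm_p cm.
Let k_gt0 := cm_k cm.
Let kpd := cm_pd cm.
Let ksym := posdef_sym kpd.
Let a_gt0 := cm_a cm.
Let beta_gt0 := cm_beta cm.
Let eig := cm_eig cm.
Local Notation cK := (\sum_i \sum_j k i j).

Lemma cm_inhab : exists i0 : 'I_m, true.
Proof.
case: (pickP (fun i : 'I_m => true)) => [i _|e]; first by exists i.
by have := cm_p1 cm; rewrite big_pred0 // => /eqP; rewrite eq_sym oner_eq0.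
Qed.

Lemma p_le1 i : p i <= 1.
Proof. by rewrite -(cm_p1 cm); apply: ler_sum_term => j; exact: ltW. Qed.

Lemma a_le1 i : a i <= 1.
Proof. by rewrite -(cm_a1 cm); apply: ler_sum_term => j; exact: ltW. Qed.

Lemma cK_gt0 : 0 < cK.
Proof.
have [i0 _] := cm_inhab; apply: lt_le_trans (k_gt0 i0 i0) _; exact: entry_le.
Qed.

Lemma eps0_le i j : 0 * (a i * a j) <= k i j.
Proof. by rewrite mul0r ltW. Qed.

(** The contraction with [eps = 0]: the linearized drift never increases the energy, whatever the
    direction. *)
Lemma field_sqr_le r : beta * (\sum_i p i * kfield k r i ^+ 2) <= kform k r r.
Proof.
have [i0 _] := cm_inhab.
have := perron_contraction (r := r) p_gt0 a_gt0 kpd eig i0 (lexx 0) eps0_le (or_introl erefl).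
by rewrite mul0r subr0 mulrC ler_pdivlMr // mulrC.
Qed.

Section Size.
Variables (n : nat) (blk : 'I_n -> 'I_m).
Hypotheses (n_gt0 : (0 < n)%N) (bp : blocks p blk).
Local Notation N := (n%:R : R).
Local Notation M := (magn R blk).
Local Notation Q := (energy k blk).
Implicit Types x y : state n.

Let N_gt0 : 0 < N. Proof. by rewrite ltr0n. Qed.
Let p_ge0 i : 0 <= p i. Proof. exact: ltW. Qed.

Lemma magn_le1 x i : `|M x i| <= 1.
Proof. exact: le_trans (magn_le n_gt0 bp x i) (p_le1 i). Qed.

Lemma energy_ge0 x : 0 <= Q x.
Proof. exact: kform_ge0. Qed.

Lemma energy_le x : Q x <= cK.
Proof.
have := kform_le_entries k_gt0 ler01 (magn_le1 x); by rewrite expr1n mulr1.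
Qed.

Lemma field_le x i : `|kfield k (M x) i| <= cK.
Proof. exact: kfield_magn_le. Qed.

Lemma energy_upd x c : Q (upd x c.1 c.2) =
  Q x + 2 * kform k (M x) (incr R blk x c) + kform k (incr R blk x c) (incr R blk x c).
Proof. by rewrite /energy magn_upd // (kform_sqrD ksym). Qed.

Lemma kform_incr_le x c : kform k (incr R blk x c) (incr R blk x c) <= 4 * cK / N ^+ 2.
Proof.
have h : 0 <= 2 / N by rewrite divr_ge0 // ltW.
apply: le_trans (kform_le_entries k_gt0 h (incr_le R blk n_gt0 x c)) _.
by rewrite le_eqVlt; apply/orP; left; apply/eqP; field; rewrite gt_eqF.
Qed.

Lemma step_energy x : step k blk beta Q x =
  Q x + 2 * kform k (M x) (fun i => \sum_c wt k blk beta x c * incr R blk x c i)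
   + \sum_c wt k blk beta x c * kform k (incr R blk x c) (incr R blk x c).
Proof.
rewrite kform_sumr mulr_sumr -[X in _ = X + _ + _](wt_avg k blk beta n_gt0 x) -!big_split.
by apply: eq_bigr => c _ /=; rewrite energy_upd; ring.
Qed.

End Size.

(** The quadratic terms [- M h + beta p h^2] sum to at most zero by [field_sqr_le], which leaves the
    quartic defect of [tanhR]. In [C], the first term comes from the self-interaction error and the
    second from the energy of a single increment. *)
Lemma step_energy_le : exists c C, [/\ 0 < c, 0 < C &
  forall (n : nat) (blk : 'I_n -> 'I_m), (0 < n)%N -> blocks p blk -> forall x,
  step k blk beta (energy k blk) x <=
    energy k blk x - c / n%:R * field4 p k blk x + C / n%:R ^+ 2].
Proof.
have bK : 0 < beta * cK by rewrite mulr_gt0 // cK_gt0.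
have [c0 c0_gt0 Hc0] := tanhR_quartic bK.
exists (2 * c0 * beta ^+ 3), (2 * (beta * cK ^+ 2) + 4 * cK); split.
- by rewrite !mulr_gt0 // exprn_gt0.
- by rewrite addr_gt0 // !mulr_gt0 ?exprn_gt0 // cK_gt0.
move=> n blk n_gt0 bp x.
have N_gt0 : 0 < n%:R :> R by rewrite ltr0n.
have N_neq0 := lt0r_neq0 N_gt0.
rewrite step_energy //; set M := magn R blk x; set h := kfield k M.
have [err [He Hd]] := drift_magn n_gt0 (ltW beta_gt0) k_gt0 bp x.
have -> : kform k M (fun i => \sum_c wt k blk beta x c * incr R blk x c i) =
  n%:R^-1 * \sum_i h i * (- M i + p i * tanhR (beta * h i) + err i).
  rewrite (kformC ksym) kformE mulr_sumr; apply: eq_bigr => i _.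
  by rewrite Hd -/h -/M; ring.
have S2 : \sum_c wt k blk beta x c * kform k (incr R blk x c) (incr R blk x c) <= 4 * cK / n%:R ^+ 2.
  by apply: wt_avg_le => // c; exact: kform_incr_le.
have S1 : \sum_i h i * (- M i + p i * tanhR (beta * h i) + err i) <=
   - (c0 * beta ^+ 3 * field4 p k blk x) + beta * cK ^+ 2 / n%:R.
  apply: (@le_trans _ _ (\sum_i (beta * (p i * h i ^+ 2) - M i * h i
     - c0 * beta ^+ 3 * (p i * h i ^+ 4) + beta * cK ^+ 2 / n%:R * p i))).
    apply: ler_sum => i _.
    have e1 : h i * err i <= beta * cK ^+ 2 / n%:R * p i.
      apply: le_trans (ler_norm _) _; rewrite normrM.
      apply: (@le_trans _ _ (cK * (beta * cK * p i / n%:R))); last first.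
        by rewrite le_eqVlt; apply/orP; left; apply/eqP; ring.
      apply: ler_pM => //; exact: field_le.
    have e2 : c0 * beta ^+ 3 * h i ^+ 4 <= h i * (beta * h i - tanhR (beta * h i)).
      have hb : `|beta * h i| <= beta * cK.
        by rewrite normrM gtr0_norm // ler_pM2l //; exact: field_le.
      rewrite -(ler_pM2l beta_gt0); move: (Hc0 _ hb).
      by congr (_ <= _); ring.
    have := ler_wpM2l (ltW (p_gt0 i)) e2.
    by move: e1; lra.
  rewrite big_split /= sumrB sumrB -!mulr_sumr (cm_p1 cm) mulr1 -/(field4 _ _ _ _).
  have := field_sqr_le M; rewrite kformE -/h.
  by rewrite /field4 -/M -/h; lra.
have := ler_wpM2l (ltW (_ : 0 < 2 / n%:R)) S1; rewrite divr_gt0 // => /(_ isT).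
have -> : 2 / n%:R * (- (c0 * beta ^+ 3 * field4 p k blk x) + beta * cK ^+ 2 / n%:R) =
  - (2 * c0 * beta ^+ 3 / n%:R * field4 p k blk x) + 2 * (beta * cK ^+ 2) / n%:R ^+ 2 by field.
rewrite [_ / n%:R ^+ 2 in X in _ -> X]mulrDl.
by move: S2; rewrite -/M -/h; lra.
Qed.

(** Since [Q = M h] and coercivity bounds [|M|^2] by the energy, Young's inequality bounds [Q] by a
    multiple of [|h|^2]. Then [(sum p h^2)^2 <= sum p h^4], because the variance of [h^2] under the
    weights [p] is non-negative. *)
Lemma energy_field4 : exists2 c, 0 < c & forall (n : nat) (blk : 'I_n -> 'I_m) x,
  c * energy k blk x ^+ 2 <= field4 p k blk x.
Proof.
have [C C_gt0 HC] := kform_coercive kpd.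
have [q q_gt0 Hq] := finite_pos_lb p_gt0.
exists ((q / C) ^+ 2); first by rewrite exprn_gt0 // divr_gt0.
move=> n blk x; set M := magn R blk x; set h := kfield k M.
have Qh : energy k blk x = \sum_i M i * h i by rewrite /energy kformE.
have S1 : energy k blk x <= C * \sum_i h i ^+ 2.
  have : energy k blk x <= \sum_i (M i ^+ 2 / (2 * C) + C / 2 * h i ^+ 2).
    rewrite Qh; apply: ler_sum => i _; rewrite -subr_ge0.
    have -> : M i ^+ 2 / (2 * C) + C / 2 * h i ^+ 2 - M i * h i = (M i - C * h i) ^+ 2 / (2 * C).
      by field; rewrite gt_eqF.
    by rewrite divr_ge0 ?sqr_ge0 // mulr_ge0 // ltW.
  rewrite big_split /= -mulr_sumr -mulr_suml; have := HC M; rewrite -/(energy k blk x).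
  set E := energy _ _ _; set A := \sum_i M i ^+ 2; set B := \sum_i h i ^+ 2 => h1 h2.
  have : A / (2 * C) <= E / 2 by rewrite ler_pdivrMr ?mulr_gt0 // (_ : E / 2 * (2 * C) = C * E) //; field.
  by lra.
have S2 : q * \sum_i h i ^+ 2 <= \sum_i p i * h i ^+ 2.
  by rewrite mulr_sumr; apply: ler_sum => i _; rewrite ler_wpM2r ?sqr_ge0.
have S3 : (\sum_i p i * h i ^+ 2) ^+ 2 <= field4 p k blk x.
  rewrite /field4 -/M -/h; set s := \sum_i _.
  have : 0 <= \sum_i p i * (h i ^+ 2 - s) ^+ 2.
    by apply: sumr_ge0 => i _; rewrite mulr_ge0 ?sqr_ge0 // ltW.
  have -> c : \sum_i p i * (h i ^+ 2 - c) ^+ 2 =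
      \sum_i p i * h i ^+ 4 + (- (2 * c) * (\sum_i p i * h i ^+ 2) + c ^+ 2 * \sum_i p i).
    by rewrite !mulr_sumr -!big_split; apply: eq_bigr => i _ /=; ring.
  by rewrite (cm_p1 cm) -/s; lra.
apply: le_trans S3; rewrite -exprMn; apply: lerXn2r; rewrite ?nnegrE.
- apply: mulr_ge0; first by rewrite divr_ge0 // ltW.
  exact: kform_ge0.
- by apply: sumr_ge0 => i _; rewrite mulr_ge0 ?sqr_ge0 // ltW.
apply: le_trans S2; rewrite -mulrA ler_wpM2l ?(ltW q_gt0) //.
by rewrite mulrC ler_pdivrMr // mulrC.
Qed.

End Energy.

Section EnergyDecay.
Variables (R : realType) (m : nat) (p a : 'I_m -> R) (k : 'M[R]_m) (beta : R).
Hypothesis cm : critical_model p a k beta.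

Local Notation cK := (\sum_i \sum_j k i j).
Local Ltac only_section := clear - R m p a k beta cm.

(** Up to constants [n / t] solves [Q' = - Q^2 / n] from infinity. The restriction on [t] keeps this
    above the level [n^{-1/2}], where the noise [C / n^2] takes over. *)
Lemma iter_energy_decay : exists2 A, 0 < A &
  forall (n : nat) (blk : 'I_n -> 'I_m), (0 < n)%N -> blocks p blk -> forall t x,
  (t.+1 ^ 2 <= n ^ 3)%N ->
  iter t (step k blk beta) (energy k blk) x <= A * n%:R / t.+1%:R.
Proof.
have [c1 [C [c1_gt0 C_gt0 HE]]] := step_energy_le cm.
have [c2 c2_gt0 HF] := energy_field4 cm.
have K_gt0 := cK_gt0 cm.
(* The second bound gives [c * cK <= 1/4] and hence [cK * (2 c A + 1) <= A], which settles the early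
   times. *)
pose c := Num.min (c1 * c2) (4 * cK)^-1.
have c_gt0 : 0 < c by rewrite lt_min mulr_gt0 //= invr_gt0 mulr_gt0.
have c_le : c <= c1 * c2 by rewrite ge_min lexx.
have cK_le : c * cK <= 4^-1.
  have : c <= (4 * cK)^-1 by rewrite ge_min lexx orbT.
  by rewrite -(ler_pM2r K_gt0) invfM mulfVK ?gt_eqF.
pose A := 2 / c + C + 2 * cK.
have cA : c * A = 2 + c * C + 2 * (c * cK) by rewrite /A; field; rewrite gt_eqF.
have c2' : 0 < 2 / c by rewrite divr_gt0.
have A_gt0 : 0 < A by rewrite /A; move: c2' C_gt0 K_gt0; only_section; lra.
exists A => // n blk n_gt0 bp t x.
have N_gt0 : 0 < n%:R :> R by rewrite ltr0n.
have N_ge1 : 1 <= n%:R :> R by rewrite ler1n.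
have N_neq0 := lt0r_neq0 N_gt0.
set Q := energy k blk.
elim: t => [|t IH] Ht.
  rewrite /= divr1; apply: le_trans (energy_le cm n_gt0 bp x) _.
  apply: (@le_trans _ _ A); first by rewrite /A; move: c2' C_gt0 K_gt0; only_section; lra.
  by rewrite -{1}[A]mulr1 ler_pM2l.
have {}IH : iter t (step k blk beta) Q x <= A * n%:R / t.+1%:R.
  by apply: IH; apply: leq_trans Ht; rewrite leq_exp2r.
have [T TE] : exists T : R, T = t.+1%:R by exists t.+1%:R.
rewrite -TE in IH; have T_ge1 : 1 <= T by rewrite TE ler1n.
have T_gt0 : 0 < T by apply: lt_le_trans T_ge1.
have T_neq0 := lt0r_neq0 T_gt0.
have T2E : t.+2%:R = T + 1 :> R by rewrite TE natr1.
rewrite T2E; have T1_gt0 : 0 < T + 1 by move: T_gt0; only_section; lra.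
(* At early times the trivial bound on the energy is enough; later the slope [1 - 2 c A / T] of the
   affine bound below is non-negative. *)
have [Tsmall|Tbig] := ltP T (2 * (c * A)).
  apply: (@le_trans _ _ cK).
    rewrite -[leRHS](iter_step_cst k blk beta n_gt0 t.+1 _ x).
    by apply: iter_step_le => // y; exact: (energy_le cm n_gt0 bp).
  rewrite ler_pdivlMr //.
  have h1 : cK * (T + 1) <= cK * (2 * (c * A) + 1) by rewrite ler_pM2l //; move: Tsmall; only_section; lra.
  have h2 : cK * (2 * (c * A) + 1) <= A.
    have : c * cK * (2 * A) <= 4^-1 * (2 * A) by apply: ler_wpM2r => //; move: A_gt0; only_section; lra.
    have : 2 * cK <= A by rewrite /A; move: c2' C_gt0; only_section; lra.
    have -> : cK * (2 * (c * A) + 1) = c * cK * (2 * A) + cK by ring.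
    by only_section; lra.
  have h3 : A <= A * n%:R by rewrite -{1}[A]mulr1 ler_pM2l.
  by move: h1 h2 h3; only_section; lra.
pose B := A * n%:R / T.
have B_gt0 : 0 < B by rewrite divr_gt0 // mulr_gt0.
(* The square is replaced by its tangent at the current bound [B]; the result is affine in [Q] and
   passes through the average. *)
have key y : step k blk beta Q y <= (c * B ^+ 2 / n%:R + C / n%:R ^+ 2) + (1 - 2 * c * B / n%:R) * Q y.
  apply: le_trans (HE n blk n_gt0 bp y) _; rewrite -/Q.
  have h1 : c * Q y ^+ 2 <= c1 * field4 p k blk y.
    apply: (@le_trans _ _ (c1 * c2 * Q y ^+ 2)); first by rewrite ler_wpM2r ?sqr_ge0.
    by rewrite -mulrA ler_pM2l //; exact: HF.
  have h2 : c * (2 * B * Q y - B ^+ 2) <= c1 * field4 p k blk y.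
    apply: le_trans h1; rewrite ler_pM2l // -subr_ge0.
    by have -> : Q y ^+ 2 - (2 * B * Q y - B ^+ 2) = (Q y - B) ^+ 2; [ring | exact: sqr_ge0].
  have : c * (2 * B * Q y - B ^+ 2) / n%:R <= c1 * field4 p k blk y / n%:R.
    by rewrite ler_pM2r ?invr_gt0.
  have -> : c * (2 * B * Q y - B ^+ 2) / n%:R = 2 * c * B / n%:R * Q y - c * B ^+ 2 / n%:R by field.
  have -> : c1 * field4 p k blk y / n%:R = c1 / n%:R * field4 p k blk y by field.
  by only_section; lra.
rewrite iterSr.
apply: le_trans (iter_step_le (g := fun y => (c * B ^+ 2 / n%:R + C / n%:R ^+ 2) +
  (1 - 2 * c * B / n%:R) * Q y) k blk beta n_gt0 t x key) _.
rewrite iter_step_affine //.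
have fac : 0 <= 1 - 2 * c * B / n%:R.
  have -> : 2 * c * B / n%:R = 2 * (c * A) / T by rewrite /B; field; rewrite ?T_neq0 ?N_neq0.
  by rewrite subr_ge0 ler_pdivrMr // mul1r.
have := ler_wpM2l fac IH; rewrite -/B => IH'.
have T2 : T ^+ 2 <= n%:R ^+ 3.
  by rewrite TE -!natrX ler_nat; apply: leq_trans Ht; rewrite leq_exp2r.
have goal2 : B - A * n%:R / (T + 1) <= c * B ^+ 2 / n%:R - C / n%:R ^+ 2.
  have -> : B - A * n%:R / (T + 1) = A * n%:R / (T * (T + 1)).
    by rewrite /B; field; rewrite ?T_neq0 ?N_neq0 ?gt_eqF.
  have -> : c * B ^+ 2 / n%:R = c * A * (A * n%:R / T ^+ 2).
    by rewrite /B; field; rewrite ?T_neq0 ?N_neq0.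
  have h1 : A * n%:R / (T * (T + 1)) <= A * n%:R / T ^+ 2.
    rewrite ler_pM2l ?mulr_gt0 // lef_pV2 ?posrE ?exprn_gt0 ?mulr_gt0 //.
    by rewrite expr2 ler_pM2l //; only_section; lra.
  have h2 : C / n%:R ^+ 2 <= C * n%:R / T ^+ 2.
    rewrite ler_pdivlMr ?exprn_gt0 // mulrAC ler_pdivrMr ?exprn_gt0 //.
    by rewrite -mulrA ler_pM2l // -exprS.
  have h3 : A * n%:R / T ^+ 2 + C * n%:R / T ^+ 2 <= c * A * (A * n%:R / T ^+ 2).
    have q0 : 0 < n%:R / T ^+ 2 by rewrite divr_gt0 // exprn_gt0.
    rewrite -!(mulrA _ n%:R) -mulrDl (mulrA (c * A)) ler_pM2r //.
    have : C <= A by rewrite /A; move: c2' K_gt0; only_section; lra.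
    have : 2 <= c * A by rewrite cA; have := mulr_gt0 c_gt0 C_gt0; have := mulr_gt0 c_gt0 K_gt0; only_section; lra.
    by move: A_gt0; only_section; nra.
  by move: h1 h2 h3; only_section; lra.
have -> : c * B ^+ 2 / n%:R = 2 * (c * B ^+ 2 / n%:R) - c * B ^+ 2 / n%:R by ring.
move: IH' goal2.
have -> : (1 - 2 * c * B / n%:R) * B = B - 2 * (c * B ^+ 2 / n%:R) by field.
by only_section; lra.
Qed.

End EnergyDecay.

(** * Couplings run until they enter a set *)

Section Hitting.
Variables (R : realType) (m n : nat) (k : 'M[R]_m) (blk : 'I_n -> 'I_m) (beta : R).
Hypothesis n_gt0 : (0 < n)%N.
Implicit Types (x y : state n) (f g : state n -> R).

(* [F] is a Lyapunov function of a coupling that only has to be run until it enters [G]: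
   off [G] the coupled expectation of [F] is at most [(1 + b) F - d]. *)
Lemma hitting_close (F : state n -> state n -> R) (G : state n -> state n -> Prop) T0 T delta b d :
  0 <= delta -> 0 < b -> 0 < d -> (forall x y, 0 <= F x y) ->
  (forall x y, G x y -> close k blk beta T0 delta x y) ->
  (forall x y, ~ G x y -> forall g c alpha, 0 <= alpha ->
    (forall x' y', g x' - g y' <= c + alpha * F x' y') ->
    step k blk beta g x - step k blk beta g y <= c + alpha * ((1 + b) * F x y - d)) ->
  1 <= b * T%:R ->
  forall x y, close k blk beta (T0 + T) (delta + 2 * (b / d) * F x y) x y.
Proof.
move=> delta0 b0 d0 F0 HG HF bT.
have b1 t : 0 < (1 + b) ^+ t by rewrite exprn_gt0 //; lra.
have P2 : 2 <= (1 + b) ^+ T.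
  have bern t : 1 + b * t%:R <= (1 + b) ^+ t.
    elim: t => [|t IH]; first by rewrite mulr0 addr0 expr0.
    rewrite exprS -natr1; have : 0 <= t%:R :> R by [].
    have h : 0 <= 1 + b by lra.
    by have := ler_wpM2l h IH; nra.
  by apply: le_trans (bern T); lra.
pose e := ((1 + b) ^+ T - 1)^-1.
have e0 : 0 < e by rewrite invr_gt0; lra.
have eT : e * ((1 + b) ^+ T - 1) = 1 by rewrite mulVf // gt_eqF //; lra.
(* At [t = 0] the constant 1 is the trivial bound. One step off [G] multiplies the coefficient of
   [F] by [1 + b] and removes [e * b * (1 + b)^t] from the constant; [e] is normalized so that the 1
   is used up exactly at [t = T]. *)
have claim t x y f : (t <= T)%N -> (forall u, 0 <= f u <= 1) ->
  iter (T0 + t) (step k blk beta) f x - iter (T0 + t) (step k blk beta) f y <=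
  (delta + 1 - e * ((1 + b) ^+ t - 1)) + e * (1 + b) ^+ t * (b / d) * F x y.
  move=> + f01; elim: t x y => [|t IH] x y tT.
    have := iter_step01 k blk beta n_gt0 (T0 + 0) f01 x.
    have := iter_step01 k blk beta n_gt0 (T0 + 0) f01 y.
    rewrite expr0 subrr mulr0 mulr1; have : 0 <= e * (b / d) * F x y.
      by rewrite mulr_ge0 // mulr_ge0 ?divr_ge0 // ltW.
    by lra.
  have [Gxy|nG] := pselect (G x y).
    have cl := close_leq n_gt0 (leq_addr t.+1 T0) (HG x y Gxy).
    apply: le_trans (cl _ f01) _.
    have h1 : e * ((1 + b) ^+ t.+1 - 1) <= 1.
      apply: (@le_trans _ _ (e * ((1 + b) ^+ T - 1))); last by rewrite eT.
      by rewrite ler_pM2l // lerD2r ler_eXn2l //; lra.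
    have : 0 <= e * (1 + b) ^+ t.+1 * (b / d) * F x y.
      have := b1 t.+1; set q := _ ^+ _ => q0.
      by rewrite mulr_ge0 // ltW // mulrA divr_gt0 // !mulr_gt0.
    by lra.
  rewrite addnS !iterS.
  have al0 : 0 <= e * (1 + b) ^+ t * (b / d).
    have := b1 t; set q := _ ^+ _ => q0.
    by rewrite ltW // mulrA divr_gt0 // !mulr_gt0.
  apply: le_trans (HF x y nG _ _ _ al0 (fun x' y' => IH x' y' (ltnW tT))) _.
  by rewrite exprS le_eqVlt; apply/orP; left; apply/eqP; field; rewrite gt_eqF.
move=> x y f f01; apply: le_trans (claim T x y f (leqnn T) f01) _.
rewrite eT addrK lerD2l; apply: ler_wpM2r => //; apply: ler_wpM2r.
  by rewrite divr_ge0 // ltW.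
by move: eT e0; set q := (1 + b) ^+ T in P2 *; nra.
Qed.

End Hitting.

(** * Transpositions within a block *)

Section Swap.
Variables (R : realType) (m n : nat) (k : 'M[R]_m) (blk : 'I_n -> 'I_m) (beta : R).
Hypotheses (n_gt0 : (0 < n)%N) (beta_ge0 : 0 <= beta) (k_gt0 : forall i j, 0 < k i j).
Implicit Types (x y z : state n) (u v w : 'I_n) (f g : state n -> R).
Local Notation N := (n%:R : R).
Local Notation r0 := ((1 - tanhR (beta * (\sum_i \sum_j k i j))) / 2).

Definition swap v w x : state n := [ffun u => x (tperm v w u)].

Lemma swapK v w : involutive (swap v w).
Proof. by move=> x; apply/ffunP => u; rewrite !ffunE tpermK. Qed.

Section SameBlock.
Variables v w : 'I_n.
Hypothesis vw : blk v = blk w.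

Lemma blk_tperm u : blk (tperm v w u) = blk u.
Proof. by case: tpermP => [->|->|]. Qed.

Lemma magn_swap x : magn R blk (swap v w x) = magn R blk x.
Proof.
apply/funext => i; rewrite /magn; congr (_ * _).
rewrite (reindex_inj (@perm_inj _ (tperm v w))) /=.
by apply: eq_big => u; rewrite blk_tperm // ffunE tpermK.
Qed.

Lemma step_swap f x : step k blk beta f (swap v w x) = step k blk beta (f \o swap v w) x.
Proof.
pose h (c : 'I_n * bool) := (tperm v w c.1, c.2).
have hK : involutive h by case=> u b; rewrite /h /= tpermK.
rewrite /step (reindex_inj (inv_inj hK)) /=; apply: eq_bigr => -[u b] _ /=.
congr (_ * f _).
  by rewrite /wt /= !locfield_magn magn_swap blk_tperm ffunE tpermK.
by apply/ffunP => z; rewrite !ffunE (can2_eq (tpermK v w) (tpermK v w)).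
Qed.

(** The second copy uses the update of the first one relabelled by the transposition, so it remains
    the transposed state. Once the spins at [v] and [w] agree, the two copies coincide. *)
Lemma close_swap t x : close k blk beta t ((1 - r0 / N) ^+ t) x (swap v w x).
Proof.
have N_gt0 : 0 < N by rewrite ltr0n.
have r0_gt0 : 0 < r0 by rewrite divr_gt0 // subr_gt0 tanhR_lt1.
have r0_le1 : r0 <= 1.
  have h : 0 <= beta * \sum_i \sum_j k i j by rewrite mulr_ge0 // cK_ge0.
  by have := tanhR_ge0 h; lra.
have q0 : 0 <= 1 - r0 / N.
  by rewrite subr_ge0 ler_pdivrMr // mul1r; apply: le_trans r0_le1 _; rewrite ler1n.
move=> f f01; elim: t x => [|t IH] x.
  by have := f01 x; have := f01 (swap v w x); rewrite /= expr0; lra.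
have [xvw|xvw] := eqVneq (x v) (x w).
  have -> : swap v w x = x.
    by apply/ffunP => u; rewrite ffunE; case: tpermP => [->|->|].
  by rewrite subrr exprn_ge0.
rewrite !iterS step_swap.
set D := fun y => iter t (step k blk beta) f y - iter t (step k blk beta) f (swap v w y).
have -> : step k blk beta (iter t (step k blk beta) f) x -
    step k blk beta (iter t (step k blk beta) f \o swap v w) x =
    \sum_c wt k blk beta x c * D (upd x c.1 c.2).
  by rewrite /step -sumrB; apply: eq_bigr => c _; rewrite /D /=; ring.
(* The update that gives [v] the spin of [w] makes the state invariant under the transposition; its
   weight is at least [r0 / N]. *)
rewrite (bigD1 (v, x w)) //=.
have -> : D (upd x v (x w)) = 0.
  rewrite /D; have -> : swap v w (upd x v (x w)) = upd x v (x w); last by rewrite subrr.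
  apply/ffunP => u; rewrite !ffunE; case: tpermP => [->|->|_ _] //.
  - by rewrite eqxx; case: eqP.
  - by rewrite eqxx; case: eqP.
rewrite mulr0 add0r.
apply: (@le_trans _ _ (\sum_(c | c != (v, x w)) wt k blk beta x c * (1 - r0 / N) ^+ t)).
  by apply: ler_sum => c _; apply: ler_wpM2l; [exact: wt_ge0 | exact: IH].
rewrite -mulr_suml exprS ler_wpM2r ?exprn_ge0 //.
have := wt_sum1 k blk beta n_gt0 x; rewrite (bigD1 (v, x w)) //=.
have : r0 / N <= wt k blk beta x (v, x w).
  rewrite /wt /= mulrC ler_wpM2l ?invr_ge0 ?(ltW N_gt0) //.
  exact: rate_locfield_ge.
by lra.
Qed.

End SameBlock.
End Swap.

(** * Matching and the vertexwise coupling *)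

Section Matching.
Variables (R : realType) (m n : nat) (k : 'M[R]_m) (blk : 'I_n -> 'I_m) (beta : R).
Hypothesis n_gt0 : (0 < n)%N.
Implicit Types (x y z : state n) (u v w : 'I_n).

(** Within a block all disagreements have the same sign, so their number is determined by the
    difference of the magnetizations. *)
Definition aligned x y := forall v w, blk v = blk w ->
  ~~ [&& x v, ~~ y v, ~~ x w & y w].

Lemma close_refl t x : close k blk beta t 0 x x.
Proof. by move=> f _; rewrite subrr. Qed.

Lemma close_weaken t d d' x y : d <= d' -> close k blk beta t d x y -> close k blk beta t d' x y.
Proof. by move=> dd' H f f01; apply: le_trans dd'; exact: H. Qed.

(** Transposing in [y] two opposite disagreements of one block repairs both and keeps the
    magnetizations. Every such move costs [e] and lowers the number of disagreements, so there are
    at most [n] of them. *)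
Lemma close_matching t e : 0 <= e ->
  (forall v w z, blk v = blk w -> close k blk beta t e z (swap v w z)) ->
  forall x y, exists y', [/\ magn R blk y' = magn R blk y, aligned x y',
    close k blk beta t (e * n%:R) y' y & close k blk beta t (e * n%:R) y y'].
Proof.
move=> e0 He x y.
suff [y' [h1 h2 h3 h4]] : exists y', let h := #|[set v | x v != y v]| in
    [/\ magn R blk y' = magn R blk y, aligned x y',
      close k blk beta t (e * h%:R) y' y & close k blk beta t (e * h%:R) y y'].
  have hn : e * #|[set v | x v != y v]|%:R <= e * n%:R.
    by rewrite ler_wpM2l // ler_nat -[leqRHS]card_ord max_card.
  by exists y'; split=> //; apply: close_weaken hn _.
have [h] := ubnP #|[set v | x v != y v]|.
elim: h y => // h IH y /ltnSE hy.
have [al|] := pselect (aligned x y).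
  by exists y; split=> //; apply: (close_weaken (d := 0)) (close_refl _ _); rewrite mulr_ge0.
move/existsNP => [v /existsNP [w /not_implyP [vw /negP/negPn /and4P [xv yv xw yw]]]].
have hlt : (#|[set u | x u != swap v w y u]| < #|[set u | x u != y u]|)%N.
  apply: proper_card; apply/properP; split.
    apply/fintype.subsetP => u; rewrite !inE ffunE; case: tpermP => [->|->|//].
    - by rewrite xv yw.
    - by rewrite (negbTE xw) (negbTE yv).
  by exists v; rewrite !inE ?ffunE ?tpermL xv ?(negbTE yv) ?yw.
have [y' [h1 h2 h3 h4]] := IH _ (leq_trans hlt hy).
exists y'; split=> //; first by rewrite h1 magn_swap.
- apply: (close_weaken (d := e * #|[set u | x u != swap v w y u]|%:R + e)).
    by rewrite -[X in _ + X]mulr1 -mulrDr ler_wpM2l // natr1 ler_nat.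
  by apply: close_trans h3 _; rewrite -[X in close _ _ _ _ _ _ X](swapK v w y); exact: He.
- apply: (close_weaken (d := e + e * #|[set u | x u != swap v w y u]|%:R)).
    by rewrite addrC -[X in _ + X]mulr1 -mulrDr ler_wpM2l // natr1 ler_nat.
  by apply: close_trans h4; exact: He.
Qed.

Lemma aligned_disagreements x y i : aligned x y ->
  \sum_(v | blk v == i) (x v != y v)%:R <= n%:R / 2 * `|magn R blk x i - magn R blk y i|.
Proof.
move=> al; have N_gt0 : 0 < n%:R :> R by rewrite ltr0n.
have -> : magn R blk x i - magn R blk y i =
    n%:R^-1 * \sum_(v | blk v == i) (spin (x v) - spin (y v)).
  by rewrite /magn -mulrBr sumrB.
rewrite normrM normfV (gtr0_norm N_gt0).
have -> : n%:R / 2 * (n%:R^-1 * `|\sum_(v | blk v == i) (spin (x v) - spin (y v))|) =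
    2^-1 * `|\sum_(v | blk v == i) (spin (x v) - spin (y v))| :> R.
  by field; rewrite gt_eqF.
have [ex|nex] := pselect (exists v, [&& blk v == i, x v & ~~ y v]).
  have [v /and3P [/eqP bv xv yv]] := ex.
  apply: le_trans (ler_wpM2l _ (ler_norm _)); last by rewrite invr_ge0.
  rewrite mulr_sumr; apply: ler_sum => w /eqP bw.
  have := al v w; rewrite bv bw xv yv => /(_ erefl) /=.
  by case: (x w); case: (y w); rewrite //= /spin; lra.
apply: (@le_trans _ _ (2^-1 * - \sum_(v | blk v == i) (spin (x v) - spin (y v)))).
  rewrite -sumrN mulr_sumr; apply: ler_sum => w bw.
  have : ~~ (x w && ~~ y w) by apply/negP => h; apply: nex; exists w; rewrite bw.
  by case: (x w); case: (y w); rewrite //= /spin; lra.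
by apply: ler_wpM2l; rewrite ?invr_ge0 // -normrN ler_norm.
Qed.

End Matching.

Section SiteCoupling.
Variable R : realType.

(** The maximal coupling of two spins in dual form: they are equal with probability [1 - |q - q'|]
    and opposite otherwise. *)
Lemma site_coupling (q q' : R) (gx gy : bool -> R) c0 c1 :
  0 <= q <= 1 -> 0 <= q' <= 1 -> (forall b, gx b - gy b <= c0) ->
  (forall b, gx b - gy (~~ b) <= c1) ->
  (q * gx true + (1 - q) * gx false) - (q' * gy true + (1 - q') * gy false) <=
  (1 - `|q - q'|) * c0 + `|q - q'| * c1.
Proof.
move=> /andP[q0 q1] /andP[q'0 q'1] h0 h1.
have [t0 f0 t1 f1] := And4 (h0 true) (h0 false) (h1 true) (h1 false).
have [qq|qq] := leP q' q.
  rewrite ger0_norm ?subr_ge0 //.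
  have p1 := ler_wpM2l q'0 t0.
  have p2 : (1 - q) * (gx false - gy false) <= (1 - q) * c0 by rewrite ler_wpM2l // subr_ge0.
  have p3 : (q - q') * (gx true - gy false) <= (q - q') * c1 by rewrite ler_wpM2l // subr_ge0.
  by lra.
rewrite ltr0_norm ?subr_lt0 //.
have p1 := ler_wpM2l q0 t0.
have p2 : (1 - q') * (gx false - gy false) <= (1 - q') * c0 by rewrite ler_wpM2l // subr_ge0.
have p3 : (q' - q) * (gx false - gy true) <= (q' - q) * c1 by rewrite ler_wpM2l // subr_ge0 ltW.
by lra.
Qed.

Lemma sqrt_tangent (S u : R) : 0 < S -> 0 <= u -> Num.sqrt u <= S + (u - S ^+ 2) / (2 * S).
Proof.
move=> S0 u0; rewrite -{2}(sqr_sqrtr u0); set t := Num.sqrt u.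
rewrite -subr_ge0; have -> : S + (t ^+ 2 - S ^+ 2) / (2 * S) - t = (S - t) ^+ 2 / (2 * S).
  by field; rewrite gt_eqF.
by rewrite divr_ge0 ?sqr_ge0 // mulr_ge0 // ltW.
Qed.

(** For downward jumps the second order Taylor polynomial is an upper bound, the third derivative of
    the root being positive. Its quadratic term is the whole gain in [hamming_step]. *)
Lemma sqrt_tangent2 (S u : R) : 0 < S -> 0 <= u -> u <= S ^+ 2 ->
  Num.sqrt u <= S + (u - S ^+ 2) / (2 * S) - (u - S ^+ 2) ^+ 2 / (8 * S ^+ 3).
Proof.
move=> S0 u0 uS; have tS : Num.sqrt u <= S by rewrite -(ger0_norm (ltW S0)) -sqrtr_sqr ler_wsqrtr.
have t0 : 0 <= Num.sqrt u by exact: sqrtr_ge0.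
rewrite -{2 3}(sqr_sqrtr u0); move: tS t0; set t := Num.sqrt u => tS t0.
rewrite -subr_ge0.
have -> : S + (t ^+ 2 - S ^+ 2) / (2 * S) - (t ^+ 2 - S ^+ 2) ^+ 2 / (8 * S ^+ 3) - t =
   (S - t) ^+ 2 * ((S - t) * (3 * S + t)) / (8 * S ^+ 3).
  by field; rewrite gt_eqF.
rewrite divr_ge0 // ?mulr_ge0 ?sqr_ge0 ?exprn_ge0 ?subr_ge0 ?addr_ge0 ?mulr_ge0 //; exact: ltW.
Qed.

End SiteCoupling.

Section HammingCoupling.
Variables (R : realType) (m : nat) (p a : 'I_m -> R) (k : 'M[R]_m) (beta : R).
Hypothesis cm : critical_model p a k beta.

Let k_gt0 := cm_k cm.
Let a_gt0 := cm_a cm.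
Let beta_gt0 := cm_beta cm.
Local Notation cK := (\sum_i \sum_j k i j).
Local Notation r0 := ((1 - tanhR (beta * cK)) / 2).

(** With Perron weights the expected weight of the new disagreements caused by an old one is at most
    its own weight. *)
Definition hamming (n : nat) (blk : 'I_n -> 'I_m) (x y : state n) : R :=
  \sum_v a (blk v) * (x v != y v)%:R.

Section Size.
Variables (n : nat) (blk : 'I_n -> 'I_m).
Hypotheses (n_gt0 : (0 < n)%N) (bp : blocks p blk).
Local Notation N := (n%:R : R).
Local Notation W := (hamming blk).
Implicit Types (x y : state n) (v w : 'I_n).

Let N_gt0 : 0 < N. Proof. by rewrite ltr0n. Qed.

Local Ltac only_section :=
  clear - R m p a k beta cm k_gt0 a_gt0 beta_gt0 n blk n_gt0 bp N_gt0.

Lemma hamming_gt0 x y : x <> y -> 0 < W x y.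
Proof.
move=> xy; have [v xv] : exists v, x v != y v.
  have [/existsP //|/existsPn h] := boolP [exists v, x v != y v].
  by case: xy; apply/ffunP => v; apply/eqP; have := h v; rewrite negbK.
rewrite /hamming (bigD1 v) //= xv mulr1 ltr_pwDl // sumr_ge0 // => w _.
by rewrite mulr_ge0 // ltW.
Qed.

Lemma hamming_upd x y v b b' : W (upd x v b) (upd y v b') =
  W x y - a (blk v) * (x v != y v)%:R + a (blk v) * (b != b')%:R.
Proof.
rewrite /hamming (bigD1 v) //= [in RHS](bigD1 v) //= !ffunE eqxx.
under eq_bigr => w /negbTE wv do rewrite !ffunE wv.
by ring.
Qed.

Lemma sum_blk (f : 'I_m -> R) : \sum_v f (blk v) = \sum_i N * p i * f i.
Proof.
rewrite (partition_big blk xpredT) //=; apply: eq_bigr => i _.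
rewrite -(blk_card bp) mulr_suml; apply: eq_bigr => v /eqP ->; by rewrite mul1r.
Qed.

(** After the Lipschitz bound the sums are exchanged; the total influence of [w], weighted by [a],
    is [n / beta] times [a (blk w)] by the eigenvector equation, and the factors cancel. *)
Lemma hamming_contraction x y :
  \sum_v a (blk v) * `|rate beta true (locfield k blk x v) - rate beta true (locfield k blk y v)|
    <= W x y.
Proof.
apply: (@le_trans _ _ (\sum_v \sum_w a (blk v) * (beta * k (blk v) (blk w) / N * (x w != y w)%:R))).
  apply: ler_sum => v _; rewrite -mulr_sumr; apply: ler_wpM2l; first exact/ltW.
  have -> : rate beta true (locfield k blk x v) - rate beta true (locfield k blk y v) =
    (tanhR (beta * locfield k blk x v) - tanhR (beta * locfield k blk y v)) / 2.
    by rewrite /rate /spin; field.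
  rewrite normrM normfV ler_pdivrMr ?normr_gt0 // [`|2|]ger0_norm //.
  apply: le_trans (tanhR_lip _ _) _; rewrite -mulrBr normrM gtr0_norm //.
  rewrite /locfield -sumrB mulr_suml; apply: (@le_trans _ _ (beta * \sum_(w | w != v)
     `|Kint k blk v w * spin (x w) - Kint k blk v w * spin (y w)|)).
    by rewrite ler_pM2l // ler_norm_sum.
  rewrite [leRHS](bigD1 v) //= -[leLHS]add0r; apply: lerD.
    by rewrite !mulr_ge0 ?invr_ge0 //; exact: ltW.
  rewrite mulr_sumr; apply: ler_sum => w _; rewrite -mulrBr normrM.
  rewrite ger0_norm; last by rewrite divr_ge0 // ltW.
  have -> : `|spin (x w) - spin (y w)| = 2 * (x w != y w)%:R :> R.
    by case: (x w); case: (y w); rewrite /spin /= ?subrr ?normr0 ?mulr0 ?mulr1 //;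
       [rewrite ger0_norm; lra | rewrite ler0_norm; lra].
  by rewrite /Kint le_eqVlt; apply/orP; left; apply/eqP; ring.
rewrite exchange_big /= /hamming le_eqVlt; apply/orP; left; apply/eqP; apply: eq_bigr => w _.
transitivity (beta / N * (x w != y w)%:R * \sum_v a (blk v) * k (blk v) (blk w)).
  by rewrite mulr_sumr; apply: eq_bigr => v _; ring.
rewrite (sum_blk (fun i => a i * k i (blk w))).
have -> : \sum_i N * p i * (a i * k i (blk w)) = N * (beta^-1 * a (blk w)).
  rewrite -(cm_eig cm) mulr_sumr; apply: eq_bigr => i _.
  by rewrite (posdef_sym (cm_pd cm) i); ring.
by field; rewrite !gt_eqF.
Qed.

Lemma rate_bounds x v : r0 <= rate beta true (locfield k blk x v) <= 1 - r0.
Proof.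
have := rate_sum beta (locfield k blk x v); rewrite big_bool /=.
have h b := rate_locfield_ge blk n_gt0 (ltW beta_gt0) k_gt0 x v b.
by have := h true; have := h false; lra.
Qed.

Lemma step_pairE (g : state n -> R) x y : step k blk beta g x - step k blk beta g y =
  N^-1 * \sum_v ((rate beta true (locfield k blk x v) * g (upd x v true) +
                  (1 - rate beta true (locfield k blk x v)) * g (upd x v false)) -
                 (rate beta true (locfield k blk y v) * g (upd y v true) +
                  (1 - rate beta true (locfield k blk y v)) * g (upd y v false))).
Proof.
rewrite sumrB mulrBr; congr (_ - _).
all: rewrite /step (wt_sumE k blk beta _ (fun v b => g (upd _ v b))); congr (_ * _).
all: apply: eq_bigr => v _; rewrite big_bool /=; congr (_ + _ * _).
all: have := rate_sum beta (locfield k blk _ v).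
- by move=> /(_ x); rewrite big_bool /=; lra.
- by move=> /(_ y); rewrite big_bool /=; lra.
Qed.

(** The first order term is non-positive by [hamming_contraction]. A disagreement chosen for update
    heals with probability at least [r0], and the curvature of the root at these downward jumps
    gives [r0 q W / (8 S^3)], that is [r0 q / (8 S)], before division by [n]. *)
Lemma hamming_step q x y : x <> y -> 0 <= q -> (forall i, q <= a i) ->
  forall (g : state n -> R) c alpha, 0 <= alpha ->
  (forall x' y', g x' - g y' <= c + alpha * Num.sqrt (W x' y')) ->
  step k blk beta g x - step k blk beta g y <=
    c + alpha * (Num.sqrt (W x y) - r0 * q / 8 / (N * Num.sqrt (W x y))).
Proof.
move=> xy q0 qa g c alpha alpha0 Hg.
have W0 := hamming_gt0 xy; set S := Num.sqrt (W x y).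
have S0 : 0 < S by rewrite sqrtr_gt0.
have S2 : S ^+ 2 = W x y by rewrite sqr_sqrtr // ltW.
pose d v := `|rate beta true (locfield k blk x v) - rate beta true (locfield k blk y v)|.
pose dis v : R := (x v != y v)%:R.
have site v : (rate beta true (locfield k blk x v) * g (upd x v true) +
                  (1 - rate beta true (locfield k blk x v)) * g (upd x v false)) -
                 (rate beta true (locfield k blk y v) * g (upd y v true) +
                  (1 - rate beta true (locfield k blk y v)) * g (upd y v false)) <=
   c + alpha * (S + (a (blk v) * d v - a (blk v) * dis v) / (2 * S) -
       r0 * q / (8 * S ^+ 3) * (a (blk v) * dis v)).
  have r0_gt0 : 0 < r0 by rewrite divr_gt0 // subr_gt0 tanhR_lt1.
  have /andP[x0 x1] := rate_bounds x v; have /andP[y0 y1] := rate_bounds y v.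
  have d0 : 0 <= d v by exact: normr_ge0.
  have d1 : d v <= 1 - r0 by rewrite /d ler_norml; move: r0_gt0 x0 x1 y0 y1; only_section; lra.
  pose s0 := Num.sqrt (W x y - a (blk v) * dis v).
  pose s1 := Num.sqrt (W x y - a (blk v) * dis v + a (blk v)).
  apply: (@le_trans _ _ ((1 - d v) * (c + alpha * s0) + d v * (c + alpha * s1))).
    apply: (@site_coupling _ _ _ (fun b => g (upd x v b)) (fun b => g (upd y v b))); rewrite ?r0_gt0.
    - by move: r0_gt0 x0 x1; only_section => *; apply/andP; split; lra.
    - by move: r0_gt0 y0 y1; only_section => *; apply/andP; split; lra.
    - by move=> b; apply: le_trans (Hg _ _) _; rewrite hamming_upd eqxx mulr0 addr0.
    - by move=> b; apply: le_trans (Hg _ _) _; rewrite hamming_upd; case: b; rewrite /= mulr1.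
  have -> : (1 - d v) * (c + alpha * s0) + d v * (c + alpha * s1) =
     c + alpha * ((1 - d v) * s0 + d v * s1) by ring.
  rewrite lerD2l; apply: ler_wpM2l => //.
  have av := a_gt0 (blk v); rewrite /s0 /s1 /dis; case: eqP => xyv /=.
    rewrite !mulr0 !subr0 -/S.
    have := sqrt_tangent S0 (ltW (addr_gt0 W0 av)); rewrite S2 (addrC (W x y)) addrK => h.
    have := ler_wpM2l d0 h; rewrite (addrC _ (W x y)).
    have -> : a (blk v) * d v / (2 * S) = d v * (a (blk v) / (2 * S)) by ring.
    by only_section; lra.
  rewrite !mulr1 subrK -/S.
  have aW : a (blk v) <= W x y.
    have := ler_sum_term (f := fun v => a (blk v) * (x v != y v)%:R) v.
    rewrite /= (_ : x v != y v); last exact/eqP.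
    by rewrite mulr1; apply=> w; rewrite mulr_ge0 // ltW.
  have u0 : 0 <= W x y - a (blk v) by rewrite subr_ge0.
  have uS : W x y - a (blk v) <= S ^+ 2 by rewrite S2 gerBl ltW.
  have := sqrt_tangent2 S0 u0 uS; rewrite S2.
  have -> : W x y - a (blk v) - W x y = - a (blk v) by ring.
  rewrite sqrrN => h.
  have d1' : 0 <= 1 - d v by move: d1 r0_gt0; only_section; lra.
  have {}h := ler_wpM2l d1' h.
  have h2 : r0 * q * a (blk v) <= (1 - d v) * a (blk v) ^+ 2.
    rewrite expr2 mulrA ler_pM2r //; by apply: ler_pM; rewrite ?(ltW r0_gt0) //; move: d1 q0 (qa (blk v)); only_section; lra.
  have i3 : 0 <= (8 * S ^+ 3)^-1 by rewrite invr_ge0 mulr_ge0 // exprn_ge0 // ltW.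
  have {}h2 := ler_wpM2r i3 h2.
  move: h h2; set I3 := (8 * S ^+ 3)^-1; set I1 := (2 * S)^-1; set s := Num.sqrt _.
  by only_section; lra.
rewrite step_pairE.
apply: (@le_trans _ _ (N^-1 * \sum_v (c + alpha * (S + (a (blk v) * d v - a (blk v) * dis v) / (2 * S) -
       r0 * q / (8 * S ^+ 3) * (a (blk v) * dis v))))).
  rewrite ler_wpM2l ?invr_ge0 ?(ltW N_gt0) //; apply: ler_sum => v _; exact: site.
have -> : \sum_v (c + alpha * (S + (a (blk v) * d v - a (blk v) * dis v) / (2 * S) -
       r0 * q / (8 * S ^+ 3) * (a (blk v) * dis v))) = N * (c + alpha * S) +
    alpha / (2 * S) * (\sum_v a (blk v) * d v - W x y) - alpha * (r0 * q / (8 * S ^+ 3)) * W x y.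
  have e z : N * z = \sum_(v < n) z by rewrite sumr_const card_ord mulr_natl.
  rewrite /hamming -sumrB e !mulr_sumr -big_split -sumrB; apply: eq_bigr => v _ /=.
  by rewrite -/(dis v); ring.
have -> : c + alpha * (S - r0 * q / 8 / (N * S)) =
    N^-1 * (N * (c + alpha * S) - alpha * (r0 * q / (8 * S ^+ 3)) * W x y).
  by rewrite -S2; field; rewrite !gt_eqF.
rewrite ler_pM2l ?invr_gt0 // lerB // gerDl.
apply: mulr_ge0_le0; first by rewrite divr_ge0 // mulr_ge0 // ltW.
by rewrite subr_le0; exact: hamming_contraction.
Qed.

End Size.

Lemma close_hamming : exists2 c, 0 < c & forall (n : nat) (blk : 'I_n -> 'I_m),
  (0 < n)%N -> blocks p blk -> forall kappa T x y, 0 < kappa ->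
  n%:R * kappa ^+ 2 <= c * T%:R ->
  close k blk beta T (Num.sqrt (hamming blk x y) / kappa) x y.
Proof.
have [q q0 qa] := finite_pos_lb a_gt0.
have r0_gt0 : 0 < r0 by rewrite divr_gt0 // subr_gt0 tanhR_lt1.
pose c := r0 * q / 8; have c0 : 0 < c by rewrite divr_gt0 // mulr_gt0.
exists c => // n blk n_gt0 bp kappa T x y kap0 HT.
have N_gt0 : 0 < n%:R :> R by rewrite ltr0n.
(* The line [(1 + b) S - d] is the tangent at [kappa] of the concave function [S - c / (n S)]. *)
pose b := c / (n%:R * kappa ^+ 2); pose d := 2 * c / (n%:R * kappa).
have b0 : 0 < b by rewrite divr_gt0 // mulr_gt0 // exprn_gt0.
have d0 : 0 < d by apply: divr_gt0; exact: mulr_gt0.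
have bT : 1 <= b * T%:R.
  by rewrite mulrAC ler_pdivlMr ?mul1r // mulr_gt0 // exprn_gt0.
have -> : Num.sqrt (hamming blk x y) / kappa = 0 + 2 * (b / d) * Num.sqrt (hamming blk x y).
  by rewrite /b /d; field; rewrite !gt_eqF.
apply: (hitting_close n_gt0 (F := fun x y => Num.sqrt (hamming blk x y))
  (G := fun x y => x = y) (T0 := 0) (lexx 0) b0 d0 _ _ _ bT).
- by move=> *; exact: sqrtr_ge0.
- by move=> z _ <-; exact: close_refl.
move=> {HT}x {}y xy g c' alpha al0 Hg.
apply: le_trans (hamming_step n_gt0 bp xy (ltW q0) qa al0 Hg) _.
rewrite lerD2l; apply: ler_wpM2l => //.
have W0 := hamming_gt0 blk xy; set S := Num.sqrt _.
have S0 : 0 < S by rewrite sqrtr_gt0.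
rewrite -/c -subr_ge0.
have -> : (1 + b) * S - d - (S - c / (n%:R * S)) = c * (kappa - S) ^+ 2 / (n%:R * kappa ^+ 2 * S).
  by rewrite /b /d; field; rewrite !gt_eqF.
apply: divr_ge0; first exact: mulr_ge0 (ltW c0) (sqr_ge0 _).
by rewrite ltW // !mulr_gt0 ?exprn_gt0.
Qed.

End HammingCoupling.

(** * Two independent copies *)

Section PairDrift.
Variables (R : realType) (m : nat) (p a : 'I_m -> R) (k : 'M[R]_m) (beta : R).
Hypothesis cm : critical_model p a k beta.

Let p_gt0 := cm_p cm.
Let k_gt0 := cm_k cm.
Let kpd := cm_pd cm.
Let ksym := posdef_sym kpd.
Let a_gt0 := cm_a cm.
Let beta_gt0 := cm_beta cm.
Let eig := cm_eig cm.
Local Notation cK := (\sum_i \sum_j k i j).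
Local Notation r0 := ((1 - tanhR (beta * cK)) / 2).

Local Ltac only_section := clear - R m p a k beta cm p_gt0 k_gt0 kpd ksym a_gt0 beta_gt0 eig.

Definition pairwt (n : nat) (blk : 'I_n -> 'I_m) (x y : state n) (j : ('I_n * bool) * ('I_n * bool)) : R :=
  wt k blk beta x j.1 * wt k blk beta y j.2.

Definition zeta (n : nat) (blk : 'I_n -> 'I_m) (x y : state n) (j : ('I_n * bool) * ('I_n * bool))
  (i : 'I_m) : R := incr R blk x j.1 i - incr R blk y j.2 i.

Definition mdiff (n : nat) (blk : 'I_n -> 'I_m) (x y : state n) (i : 'I_m) : R :=
  magn R blk x i - magn R blk y i.

Definition adot (d : 'I_m -> R) : R := \sum_i a i * d i.

(* For small [B] this weights the critical direction [a] more than its complement. *)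
Definition vform (B : R) (d : 'I_m -> R) : R := adot d ^+ 2 + B * kform k d d.

Lemma adotD d e : adot (fun i => d i + e i) = adot d + adot e.
Proof. by rewrite /adot -big_split; apply: eq_bigr => i _ /=; ring. Qed.

Lemma adotB d e : adot (fun i => d i - e i) = adot d - adot e.
Proof. by rewrite /adot -sumrB; apply: eq_bigr => i _ /=; ring. Qed.

Lemma adot_sumr (J : finType) (w : J -> R) (f : J -> 'I_m -> R) :
  adot (fun i => \sum_j w j * f j i) = \sum_j w j * adot (f j).
Proof.
rewrite /adot; under eq_bigr => i _ do rewrite mulr_sumr.
rewrite exchange_big; apply: eq_bigr => j _.
by rewrite mulr_sumr; apply: eq_bigr => i _; ring.
Qed.

Lemma adot_le d c : (forall i, `|d i| <= c) -> `|adot d| <= c.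
Proof.
move=> dc; apply: le_trans (ler_norm_sum _ _ _) _.
rewrite -[leRHS]mul1r -(cm_a1 cm) mulr_suml; apply: ler_sum => i _.
by rewrite normrM gtr0_norm // ler_pM2l.
Qed.

Lemma vformD B d e : vform B (fun i => d i + e i) =
  vform B d + (2 * adot d * adot e + (2 * B * kform k d e + vform B e)).
Proof. by rewrite /vform adotD (kform_sqrD ksym); ring. Qed.

Lemma vform_ge0 B d : 0 <= B -> 0 <= vform B d.
Proof. by move=> B0; rewrite addr_ge0 ?sqr_ge0 // mulr_ge0 // kform_ge0. Qed.

Section Size.
Variables (n : nat) (blk : 'I_n -> 'I_m).
Hypotheses (n_gt0 : (0 < n)%N) (bp : blocks p blk).
Local Notation N := (n%:R : R).
Local Notation Q := (energy k blk).
Implicit Types (x y : state n).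

Let N_gt0 : 0 < N. Proof. by rewrite ltr0n. Qed.

Lemma pairwt_ge0 x y j : 0 <= pairwt blk x y j.
Proof. by rewrite mulr_ge0 // wt_ge0. Qed.

Lemma pairwt_fst x y (f : 'I_n * bool -> R) :
  \sum_j pairwt blk x y j * f j.1 = \sum_c wt k blk beta x c * f c.
Proof.
rewrite -(pair_bigA _ (fun c c' => pairwt blk x y (c, c') * f c)) /=.
apply: eq_bigr => c _; rewrite /pairwt /=.
under eq_bigr => c' _ do rewrite mulrAC mulrC.
by rewrite wt_avg.
Qed.

Lemma pairwt_snd x y (f : 'I_n * bool -> R) :
  \sum_j pairwt blk x y j * f j.2 = \sum_c wt k blk beta y c * f c.
Proof.
rewrite -(pair_bigA _ (fun c c' => pairwt blk x y (c, c') * f c')) /= exchange_big.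
apply: eq_bigr => c _; rewrite /pairwt /=.
under eq_bigr => c' _ do rewrite -mulrA.
by rewrite wt_avg.
Qed.

Lemma pairwt_avg x y c : \sum_j pairwt blk x y j * c = c.
Proof. by rewrite (pairwt_fst x y (fun=> c)) wt_avg. Qed.

Lemma pairwt_sum1 x y : \sum_j pairwt blk x y j = 1.
Proof. by rewrite -[RHS](pairwt_avg x y); apply: eq_bigr => j _; rewrite mulr1. Qed.

Lemma pairwt_avg_le x y f c : (forall j, f j <= c) -> \sum_j pairwt blk x y j * f j <= c.
Proof.
move=> fc; rewrite -[leRHS](pairwt_avg x y); apply: ler_sum => j _.
by apply: ler_wpM2l => //; exact: pairwt_ge0.
Qed.

Lemma mdiff_upd x y j : mdiff blk (upd x j.1.1 j.1.2) (upd y j.2.1 j.2.2) =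
  fun i => mdiff blk x y i + zeta blk x y j i.
Proof.
by apply/funext => i; rewrite /mdiff /zeta !(magn_upd R blk n_gt0); ring.
Qed.

Lemma zeta_le x y j i : `|zeta blk x y j i| <= 4 / N.
Proof.
apply: le_trans (ler_normB _ _) _.
have -> : 4 / N = 2 / N + 2 / N by field; rewrite gt_eqF.
by apply: lerD; exact: incr_le.
Qed.

Lemma adot_zeta_le x y j : `|adot (zeta blk x y j)| <= 4 / N.
Proof. exact/adot_le/zeta_le. Qed.

Lemma kform_zeta_le x y j : kform k (zeta blk x y j) (zeta blk x y j) <= 16 * cK / N ^+ 2.
Proof.
have h : 0 <= 4 / N by rewrite divr_ge0 // ltW.
apply: le_trans (kform_le_entries k_gt0 h (zeta_le x y j)) _.
by rewrite le_eqVlt; apply/orP; left; apply/eqP; field; rewrite gt_eqF.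
Qed.

Lemma kform_mdiff_le x y : kform k (mdiff blk x y) (mdiff blk x y) <= 2 * Q x + 2 * Q y.
Proof. exact: kform_le2. Qed.

Lemma kfield_mdiff x y i : kfield k (mdiff blk x y) i =
  kfield k (magn R blk x) i - kfield k (magn R blk y) i.
Proof. exact: kfieldB. Qed.

Lemma incr_adot x c : adot (incr R blk x c) = a (blk c.1) * ((spin c.2 - spin (x c.1)) / N).
Proof.
rewrite /adot (bigD1 (blk c.1)) //= big1 ?addr0 /incr ?eqxx //.
by move=> i; rewrite eq_sym => /negbTE ->; rewrite mulr0.
Qed.

Lemma wt_ge x c : r0 / N <= wt k blk beta x c.
Proof.
rewrite /wt mulrC ler_wpM2l ?invr_ge0 ?(ltW N_gt0) //.
by apply: rate_locfield_ge => //; exact: ltW.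
Qed.

Lemma adot_incr_sqr_ge q x : 0 <= q -> (forall i, q <= a i) ->
  4 * r0 * q ^+ 2 / N ^+ 2 <= \sum_c wt k blk beta x c * adot (incr R blk x c) ^+ 2.
Proof.
move=> q0 qa; rewrite -(pair_bigA _ (fun v b => wt k blk beta x (v, b) * adot (incr R blk x (v, b)) ^+ 2)) /=.
apply: (@le_trans _ _ (\sum_(v : 'I_n) 4 * r0 * q ^+ 2 / N ^+ 3)).
  rewrite sumr_const card_ord -[_ *+ n]mulr_natr le_eqVlt; apply/orP; left; apply/eqP.
  by field; rewrite gt_eqF.
apply: ler_sum => v _; rewrite big_bool /= !incr_adot /=.
have r0_gt0 : 0 < r0 by rewrite divr_gt0 // subr_gt0 tanhR_lt1.
have wge b : r0 / N <= wt k blk beta x (v, b) by exact: wt_ge.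
have main b : 4 * r0 * q ^+ 2 / N ^+ 3 <= wt k blk beta x (v, b) * (a (blk v) * (2 / N)) ^+ 2.
  have -> : 4 * r0 * q ^+ 2 / N ^+ 3 = (r0 / N) * (q * (2 / N)) ^+ 2 by field; rewrite gt_eqF.
  have h : 0 <= 2 / N by rewrite divr_ge0 // ltW.
  apply: ler_pM; [by rewrite divr_ge0 // ltW | exact: sqr_ge0 | exact: wge | ].
  apply: lerXn2r; rewrite ?nnegrE ?mulr_ge0 ?(ltW (a_gt0 _)) //.
  by rewrite ler_wpM2r.
rewrite /spin; case: (x v).
  rewrite subrr mul0r mulr0 expr0n mulr0 add0r.
  have -> : (a (blk v) * ((-1 - 1) / N)) ^+ 2 = (a (blk v) * (2 / N)) ^+ 2 by ring.
  exact: main.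
rewrite subrr mul0r mulr0 expr0n mulr0 addr0.
have -> : (a (blk v) * ((1 - -1) / N)) ^+ 2 = (a (blk v) * (2 / N)) ^+ 2 by ring.
exact: main.
Qed.

Lemma noflip_ge y : r0 <= \sum_c wt k blk beta y c * (c.2 == y c.1)%:R.
Proof.
rewrite -(pair_bigA _ (fun v b => wt k blk beta y (v, b) * (b == y v)%:R)) /=.
have -> : r0 = \sum_(v : 'I_n) r0 / N.
  by rewrite sumr_const card_ord -[_ *+ n]mulr_natr divfK // gt_eqF.
apply: ler_sum => v _; rewrite (bigD1 (y v)) //= eqxx mulr1 [X in _ <= _ + X]big1 ?addr0.
  exact: wt_ge.
by move=> b /negbTE ->; rewrite mulr0.
Qed.

(** Only the joint updates that leave [y] unchanged are counted; on these the increment of the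
    difference is that of [x] alone, and no correlations have to be computed. *)
Lemma pair_variance q x y : 0 <= q -> (forall i, q <= a i) ->
  4 * r0 ^+ 2 * q ^+ 2 / N ^+ 2 <= \sum_j pairwt blk x y j * adot (zeta blk x y j) ^+ 2.
Proof.
move=> q0 qa.
have r0_gt0 : 0 < r0 by rewrite divr_gt0 // subr_gt0 tanhR_lt1.
have -> : 4 * r0 ^+ 2 * q ^+ 2 / N ^+ 2 = (4 * r0 * q ^+ 2 / N ^+ 2) * r0 by ring.
apply: (@le_trans _ _ ((\sum_c wt k blk beta x c * adot (incr R blk x c) ^+ 2) *
     \sum_c wt k blk beta y c * (c.2 == y c.1)%:R)).
  apply: ler_pM; last first.
  - exact: noflip_ge.
  - exact: adot_incr_sqr_ge.
  - exact: ltW.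
  - have r1 : 0 <= 4 * r0 by exact: (mulr_ge0 _ (ltW r0_gt0)).
    exact: divr_ge0 (mulr_ge0 r1 (exprn_ge0 _ q0)) (exprn_ge0 _ (ltW N_gt0)).
rewrite mulr_suml; under eq_bigr => c _ do rewrite mulr_sumr.
rewrite pair_bigA /=; apply: ler_sum => -[[v b] [w b']] _ /=.
rewrite /pairwt /= mulrACA; apply: ler_wpM2l; first by rewrite mulr_ge0 // wt_ge0.
case: eqP => [->|_]; last by rewrite mulr0 sqr_ge0.
rewrite mulr1 /zeta adotB [adot (incr R blk y _)]incr_adot /=.
by rewrite subrr mul0r mulr0 subr0.
Qed.

End Size.

(** The linear drift leaves the critical part alone and contracts the orthogonal energy [rr] at the
    relative gap [gam]. Half of this contraction is spent on the non-linear part of [tanhR]. The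
    error is linear in [B], so that a small [B] puts it below the variance of the critical
    direction. *)
Lemma pair_drift : exists gam Ce c1, [/\ 0 < gam, 0 < Ce, 0 < c1 &
  forall B, 0 < B -> exists2 del, 0 < del &
  forall (n : nat) (blk : 'I_n -> 'I_m), (0 < n)%N -> blocks p blk -> forall x y,
  energy k blk x <= del -> energy k blk y <= del ->
  exists rr, [/\ 0 <= rr,
    vform B (mdiff blk x y) = (1 + B * c1) * adot (mdiff blk x y) ^+ 2 + B * rr &
    \sum_j pairwt blk x y j * (2 * adot (mdiff blk x y) * adot (zeta blk x y j)
        + 2 * B * kform k (mdiff blk x y) (zeta blk x y j)) <=
      - (B * gam * rr / n%:R) + Ce * B / n%:R ^+ 2]].
Proof.
have [i0 _] := cm_inhab cm.
pose A2 := \sum_i p i * a i ^+ 2; pose lam := beta^-1.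
have A2_gt0 : 0 < A2.
  rewrite /A2 (bigD1 i0) //= ltr_pwDl ?mulr_gt0 ?exprn_gt0 //.
  by apply: sumr_ge0 => i _; rewrite mulr_ge0 ?sqr_ge0 // ltW.
have lam_gt0 : 0 < lam by rewrite invr_gt0.
have [q q_gt0 Hq] := finite_pos_lb p_gt0.
have [eps eps_gt0 Heps] := finite_pos_lb (f := fun ij : 'I_m * 'I_m => k ij.1 ij.2) (fun ij => k_gt0 ij.1 ij.2).
have epsk i j : eps * (a i * a j) <= k i j.
  apply: le_trans (Heps (i, j)) => /=; rewrite -[leRHS]mulr1 ler_pM2l //.
  by rewrite mulr_ile1 ?(ltW (a_gt0 _)) ?(a_le1 cm).
have bl : beta * lam = 1 by rewrite mulfV // gt_eqF.
have [gam gamE] : exists gam, gam = beta * eps * A2 by exists (beta * eps * A2).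
have [c1 c1E] : exists c1, c1 = lam / A2 by exists (lam / A2).
have gam_gt0 : 0 < gam by rewrite gamE !mulr_gt0.
have c1_gt0 : 0 < c1 by rewrite c1E divr_gt0.
have K_gt0 := cK_gt0 cm.
pose Ce := 4 * beta * cK + 8 * beta * cK ^+ 2.
have Ce_gt0 : 0 < Ce by rewrite addr_gt0 // !mulr_gt0 // exprn_gt0.
exists gam, Ce, c1; split=> // B B_gt0.
(* [del] makes both [|D| <= B] and the slopes [theta] small against [B]. *)
pose del := Num.min (c1 * B ^+ 2 / 4) (c1 * B * gam * q / beta).
have del_gt0 : 0 < del.
  by rewrite lt_min; apply/andP; split; rewrite divr_gt0 // !mulr_gt0 // exprn_gt0.
exists del => // n blk n_gt0 bp x y Qx Qy.
have N_gt0 : 0 < n%:R :> R by rewrite ltr0n.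
set d := mdiff blk x y; set D := adot d.
have [rr [rho [rr0 HK Hfield Hrho Hsq]]] :=
  perron_decomposition p_gt0 a_gt0 kpd eig d i0 (ltW eps_gt0) epsk.
rewrite -/(adot d) -/D -/A2 -/lam -?c1E in HK Hfield Hrho Hsq.
exists rr; split=> //.
  by rewrite /vform -/d -/D HK; ring.
have Dle : `|D| <= B.
  rewrite -(ler_pXn2r (n := 2)) ?nnegrE ?(ltW B_gt0) // real_normK ?num_real //.
  have h1 := kform_mdiff_le blk x y; rewrite -/d HK in h1.
  have h2 : del <= c1 * B ^+ 2 / 4 by rewrite ge_min lexx.
  by rewrite -(ler_pM2l c1_gt0); move: h1 h2 Qx Qy rr0; only_section; lra.
have hsq z i : energy k blk z <= del -> (beta * kfield k (magn R blk z) i) ^+ 2 <= c1 * B * gam.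
  move=> Qz; have H := field_sqr_le cm (magn R blk z).
  have h2 : del <= c1 * B * gam * q / beta by rewrite ge_min lexx orbT.
  have h3 : q * kfield k (magn R blk z) i ^+ 2 <= \sum_i p i * kfield k (magn R blk z) i ^+ 2.
    apply: le_trans (ler_sum_term (f := fun i => p i * kfield k (magn R blk z) i ^+ 2) i _).
      by rewrite ler_wpM2r ?sqr_ge0.
    by move=> j; rewrite mulr_ge0 ?sqr_ge0 // ltW.
  have h4 : beta * (q * kfield k (magn R blk z) i ^+ 2) <= c1 * B * gam * q / beta.
    apply: le_trans (le_trans Qz h2); apply: le_trans H; by rewrite ler_pM2l.
  rewrite ler_pdivlMr // in h4; rewrite -(ler_pM2r q_gt0).
  by move: h4; congr (_ <= _); ring.
have [ex [Hex Hdx]] := drift_magn n_gt0 (ltW beta_gt0) k_gt0 bp x.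
have [ey [Hey Hdy]] := drift_magn n_gt0 (ltW beta_gt0) k_gt0 bp y.
pose hx i := kfield k (magn R blk x) i; pose hy i := kfield k (magn R blk y) i.
pose eta i := kfield k d i.
have etaE i : eta i = hx i - hy i by exact: kfield_mdiff.
pose mu i := \sum_j pairwt blk x y j * zeta blk x y j i.
have muE i : mu i = n%:R^-1 * (- d i + p i * (tanhR (beta * hx i) - tanhR (beta * hy i)) + (ex i - ey i)).
  rewrite /mu /zeta; under eq_bigr => j _ do rewrite mulrBr.
  rewrite sumrB (pairwt_fst blk n_gt0 x y (fun c => incr R blk x c i)).
  rewrite (pairwt_snd blk n_gt0 x y (fun c => incr R blk y c i)) Hdx Hdy -/(hx i) -/(hy i).
  by rewrite /d /mdiff; ring.
have -> : \sum_j pairwt blk x y j * (2 * D * adot (zeta blk x y j) + 2 * B * kform k d (zeta blk x y j))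
  = \sum_i (2 * D * a i + 2 * B * eta i) * mu i.
  under eq_bigr => j _ do rewrite mulrDr !(mulrCA (pairwt _ _ _ _)).
  rewrite big_split -!mulr_sumr -kform_sumr -adot_sumr /=.
  rewrite (kformC ksym) kformE /adot !mulr_sumr -big_split; apply: eq_bigr => i _ /=.
  by rewrite -/(mu i) -/(eta i); ring.
have term i : (D * a i + B * eta i) * (n%:R * mu i) <=
    (D * a i + B * eta i) * (- d i + beta * (p i * eta i)) + beta * B * gam / 2 * (p i * rho i ^+ 2)
    + (B + 2 * cK * B) * (2 * beta * cK / n%:R) * p i.
  rewrite muE mulVKf ?gt_eqF //.
  have [th [th0 th1]] := tanhR_slope (beta * hx i) (beta * hy i).
  rewrite -mulrBr -etaE => thE.
  have th2 : th <= 2 * (c1 * B * gam).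
    by apply: le_trans th1 _; have := hsq x i Qx; have := hsq y i Qy; rewrite /hx /hy; only_section; lra.
  have tauE : tanhR (beta * hx i) - tanhR (beta * hy i) = beta * eta i - th * (beta * eta i).
    by move: thE; only_section; lra.
  rewrite tauE.
  have e1 : (D * a i + B * eta i) * (ex i - ey i) <= (B + 2 * cK * B) * (2 * beta * cK / n%:R) * p i.
    apply: le_trans (ler_norm _) _; rewrite normrM -mulrA; apply: ler_pM => //.
      apply: le_trans (ler_normD _ _) _; rewrite !normrM (gtr0_norm (a_gt0 i)) (gtr0_norm B_gt0).
      apply: lerD.
        rewrite -[leRHS]mulr1; apply: ler_pM => //; [exact: ltW | exact: (a_le1 cm)].
      rewrite mulrC ler_pM2r // etaE; apply: le_trans (ler_normB _ _) _.
      have := field_le cm blk n_gt0 x i; have := field_le cm blk n_gt0 y i.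
      by rewrite -/(hx i) -/(hy i); only_section; lra.
    apply: le_trans (ler_normB _ _) _; have := Hex i; have := Hey i.
    have -> : 2 * beta * cK / n%:R * p i = 2 * (beta * cK * p i / n%:R) by ring.
    by only_section; lra.
  (* As [eta = c1 D a + rho], completing the square bounds [D a eta] below by [- rho^2 / (4 c1)];
     the critical part has the favourable sign. *)
  have e2 : - (th * (D * a i * eta i + B * eta i ^+ 2)) <= B * gam / 2 * rho i ^+ 2.
    have h1 : 0 <= D * a i * eta i + B * eta i ^+ 2 + rho i ^+ 2 / (4 * c1).
      have -> : D * a i * eta i + B * eta i ^+ 2 + rho i ^+ 2 / (4 * c1) =
          c1 * (D * a i + rho i / (2 * c1)) ^+ 2 + B * eta i ^+ 2.
        by rewrite {1}/eta Hfield -/D; field; rewrite gt_eqF.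
      by rewrite addr_ge0 // mulr_ge0 ?sqr_ge0 // ltW.
    have h2 := mulr_ge0 th0 h1.
    have h3 : th * (rho i ^+ 2 / (4 * c1)) <= 2 * (c1 * B * gam) * (rho i ^+ 2 / (4 * c1)).
      by rewrite ler_wpM2r // divr_ge0 ?sqr_ge0 // mulr_ge0 // ltW.
    have h4 : 2 * (c1 * B * gam) * (rho i ^+ 2 / (4 * c1)) = B * gam / 2 * rho i ^+ 2.
      by field; rewrite gt_eqF.
    by move: h2 h3 h4; only_section; lra.
  have pb : 0 <= beta * p i by rewrite mulr_ge0 // ltW.
  have := ler_wpM2l pb e2.
  by move: e1; only_section; lra.
have sumterm := ler_sum (P := xpredT) (index_enum _) (fun i _ => term i).
(* Every term in [D^2] cancels because [beta * lam = 1]. *)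
have mainE : \sum_i (D * a i + B * eta i) * (- d i + beta * (p i * eta i)) =
    - (B * rr) + B * beta * \sum_i p i * rho i ^+ 2.
  have -> z : \sum_i (z * a i + B * eta i) * (- d i + beta * (p i * eta i)) =
    - z * (\sum_i a i * d i) + (- B * (\sum_i d i * eta i) +
     (beta * z * (\sum_i p i * a i * eta i) + B * beta * (\sum_i p i * eta i ^+ 2))).
    by rewrite !mulr_sumr -!big_split; apply: eq_bigr => i _ /=; ring.
  rewrite (perron_field kpd eig) -/(adot d) -/D -kformE HK Hsq -/lam.
  have -> : lam ^+ 2 / A2 = lam * c1 by rewrite c1E; ring.
  have -> : beta * D * (lam * D) = beta * lam * D ^+ 2 by ring.
  have -> : B * beta * (lam * c1 * D ^+ 2 + \sum_i p i * rho i ^+ 2) =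
     beta * lam * (B * c1 * D ^+ 2) + B * beta * \sum_i p i * rho i ^+ 2 by ring.
  by rewrite bl; ring.
move: sumterm; rewrite !big_split /= mainE -!mulr_sumr (cm_p1 cm) mulr1 => sumterm.
have rho1 : beta * \sum_i p i * rho i ^+ 2 <= rr - gam * rr.
  have := Hrho; rewrite -(ler_pM2l beta_gt0).
  have -> : beta * ((lam - eps * A2) * rr) = beta * lam * rr - gam * rr by rewrite gamE; ring.
  by rewrite bl mul1r.
have g0 : 0 <= gam * rr by rewrite mulr_ge0 // ltW.
have -> : \sum_i (2 * D * a i + 2 * B * eta i) * mu i =
    2 / n%:R * \sum_i (D * a i + B * eta i) * (n%:R * mu i).
  by rewrite [RHS]mulr_sumr; apply: eq_bigr => i _; field; rewrite gt_eqF.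
have -> : - (B * gam * rr / n%:R) + Ce * B / n%:R ^+ 2 =
    2 / n%:R * (- (B * gam * rr) / 2 + (B + 2 * cK * B) * (2 * beta * cK / n%:R)).
  by rewrite /Ce; field; rewrite gt_eqF.
rewrite ler_pM2l ?divr_gt0 //; apply: le_trans sumterm _.
rewrite lerD2r.
have Bg : 0 <= B * gam / 2 by rewrite divr_ge0 // mulr_ge0 // ltW.
have h1 := ler_wpM2l (ltW B_gt0) rho1.
have h2 : B * gam / 2 * (beta * \sum_i p i * rho i ^+ 2) <= B * gam / 2 * rr.
  by rewrite ler_wpM2l //; move: rho1 g0; only_section; lra.
by move: h1 h2; only_section; lra.
Qed.

End PairDrift.

(** * Concavity of the fourth root *)

Section FourthRoot.
Variable R : realType.
Implicit Types v t r V d : R.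

Definition qrt v : R := Num.sqrt (Num.sqrt v).

Lemma qrt_ge0 v : 0 <= qrt v.
Proof. exact: sqrtr_ge0. Qed.

Lemma qrt_gt0 v : 0 < v -> 0 < qrt v.
Proof. by move=> v0; rewrite !sqrtr_gt0. Qed.

Lemma qrtK v : 0 <= v -> qrt v ^+ 4 = v.
Proof. by move=> v0; rewrite (exprM _ 2 2) !sqr_sqrtr // sqrtr_ge0. Qed.

Lemma qrt_le v t : 0 <= t -> 0 <= v -> v <= t ^+ 4 -> qrt v <= t.
Proof.
by move=> t0 v0 vt; rewrite -(ler_pXn2r (n := 4)) ?nnegrE ?qrt_ge0 // qrtK.
Qed.

Lemma qrt_tangent V d : 0 < V -> 0 <= V + d -> qrt (V + d) <= qrt V * (1 + d / (4 * V)).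
Proof.
move=> V0 Vd; have [r rE] : exists r, r = d / V by exists (d / V).
have dE : d = r * V by rewrite rE divfK // gt_eqF.
have r1 : -1 <= r by rewrite rE ler_pdivlMr //; lra.
have -> : d / (4 * V) = r / 4 by rewrite dE; field; rewrite gt_eqF.
apply: qrt_le => //; first by rewrite mulr_ge0 ?qrt_ge0 //; lra.
rewrite exprMn qrtK; last exact: ltW.
rewrite dE.
have -> : V + r * V = V * (1 + r) by ring.
rewrite ler_pM2l // -subr_ge0.
have -> : (1 + r / 4) ^+ 4 - (1 + r) = r ^+ 2 * (3 / 8 + r / 16 + (r / 16) ^+ 2) by field.
by rewrite mulr_ge0 ?sqr_ge0 //; have := sqr_ge0 (r / 16); lra.
Qed.

(* The Taylor coefficient of [r^2] is [-3/32]; any constant in [(1/16, 3/32)] will do. *)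
Lemma qrt_quadratic V d : 0 < V -> `|d| <= V / 20 ->
  qrt (V + d) <= qrt V * (1 + (d / (4 * V) - (d / V) ^+ 2 / 14)).
Proof.
move=> V0 Vd; have [r rE] : exists r, r = d / V by exists (d / V).
have dE : d = r * V by rewrite rE divfK // gt_eqF.
have : `|r| <= 20^-1 by rewrite rE normrM normfV (gtr0_norm V0) ler_pdivrMr // mulrC.
rewrite ler_norml => /andP[r1 r2].
have -> : d / (4 * V) = r / 4 by rewrite dE; field; rewrite gt_eqF.
rewrite -rE.
have b0 : 0 <= 1 + (r / 4 - r ^+ 2 / 14) by nra.
have Vd0 : 0 <= V + d by move: Vd; rewrite ler_norml; lra.
apply: qrt_le => //; first by rewrite mulr_ge0 ?qrt_ge0.
rewrite exprMn qrtK; last exact: ltW.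
rewrite dE.
have -> : V + r * V = V * (1 + r) by ring.
rewrite ler_pM2l // -subr_ge0.
have [y yE] : exists y, y = 1 / 4 - r / 14 by exists (1 / 4 - r / 14).
have -> : 1 + (r / 4 - r ^+ 2 / 14) = 1 + r * y by rewrite yE; field.
have -> : (1 + r * y) ^+ 4 - (1 + r) =
    r * (4 * y - 1) + r ^+ 2 * (6 * y ^+ 2 + 4 * (r * y) * y ^+ 2 + (r * y ^+ 2) ^+ 2) by ring.
have -> : r * (4 * y - 1) = r ^+ 2 * - (2 / 7) by rewrite yE; field.
rewrite -mulrDr mulr_ge0 ?sqr_ge0 //.
have y1 : 5^-1 <= y by lra.
have y2 : y <= 1 by lra.
have ry : -1 / 20 <= r * y by nra.
have y3 : 25^-1 <= y ^+ 2 by nra.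
have := sqr_ge0 (r * y ^+ 2).
have y4 : 6^-1 ^+ 2 <= y ^+ 2 by nra.
have : 29 / 5 * y ^+ 2 <= 6 * y ^+ 2 + 4 * (r * y) * y ^+ 2 by nra.
have : 6 / 25 <= y by lra.
by nra.
Qed.

Lemma qrt_avg (J : finType) (w d : J -> R) V : (forall j, 0 <= w j) -> \sum_j w j = 1 ->
  0 < V -> (forall j, `|d j| <= V / 20) ->
  \sum_j w j * qrt (V + d j) <=
    qrt V * (1 + ((\sum_j w j * d j) / (4 * V) - (\sum_j w j * d j ^+ 2) / (14 * V ^+ 2))).
Proof.
move=> w0 w1 V0 dV.
apply: (@le_trans _ _ (\sum_j w j * (qrt V * (1 + (d j / (4 * V) - (d j / V) ^+ 2 / 14))))).
  by apply: ler_sum => j _; apply: ler_wpM2l => //; exact: qrt_quadratic.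
rewrite le_eqVlt; apply/orP; left; apply/eqP.
transitivity (qrt V * (\sum_j w j) + (qrt V / (4 * V) * (\sum_j w j * d j) -
    qrt V / (14 * V ^+ 2) * (\sum_j w j * d j ^+ 2))).
  rewrite !mulr_sumr -sumrB -big_split; apply: eq_bigr => j _ /=.
  by field; rewrite gt_eqF.
by rewrite w1; field; rewrite gt_eqF.
Qed.

End FourthRoot.

(** * Drift of the fourth root for two copies *)

Section PairLyapunov.
Variables (R : realType) (m : nat) (p a : 'I_m -> R) (k : 'M[R]_m) (beta : R).
Hypothesis cm : critical_model p a k beta.

Let kpd := cm_pd cm.
Local Notation cK := (\sum_i \sum_j k i j).
Local Notation vf := (vform a k).

Section Size.
Variables (n : nat) (blk : 'I_n -> 'I_m).
Hypotheses (n_gt0 : (0 < n)%N) (bp : blocks p blk).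
Local Notation N := (n%:R : R).
Implicit Types (x y : state n).

Let N_gt0 : 0 < N. Proof. by rewrite ltr0n. Qed.

(* [cross] is the increment of [vform] minus its leading term [2 D u]. *)
Definition cross B x y j : R := 2 * B * kform k (mdiff R blk x y) (zeta R blk x y j)
  + vf B (zeta R blk x y j).

Lemma vform_upd B x y j : vf B (mdiff R blk (upd x j.1.1 j.1.2) (upd y j.2.1 j.2.2)) =
  vf B (mdiff R blk x y) + (2 * adot a (mdiff R blk x y) * adot a (zeta R blk x y j) + cross B x y j).
Proof. by rewrite mdiff_upd // (vformD cm). Qed.

Lemma vform_zeta_le B x y j : 0 <= B ->
  vf B (zeta R blk x y j) <= adot a (zeta R blk x y j) ^+ 2 + 16 * cK * B / N ^+ 2.
Proof.
move=> B0; rewrite lerD2l.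
have -> : 16 * cK * B / N ^+ 2 = B * (16 * cK / N ^+ 2) by ring.
by apply: ler_wpM2l => //; exact: (kform_zeta_le cm).
Qed.

Lemma adot_zeta_sqr_le x y j : adot a (zeta R blk x y j) ^+ 2 <= 16 / N ^+ 2.
Proof.
have h4 : 0 <= 4 / N by rewrite divr_ge0 // ltW.
have := adot_zeta_le cm blk n_gt0 x y j; rewrite -(ler_pXn2r (n := 2)) ?nnegrE //.
rewrite real_normK ?num_real // => h; apply: le_trans h _.
by rewrite le_eqVlt; apply/orP; left; apply/eqP; field; rewrite gt_eqF.
Qed.

Lemma adot_mdiff_sqr_le B x y : 0 <= B ->
  adot a (mdiff R blk x y) ^+ 2 <= vf B (mdiff R blk x y).
Proof. by move=> B0; rewrite lerDl mulr_ge0 // kform_ge0. Qed.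

(** Cauchy-Schwarz leaves a factor [B] next to [V / n^2], so for small [B] the cross term cannot
    cancel the variance of [2 D u], of order [D^2 / n^2]. *)
Lemma cross_sqr_le B x y j : 0 <= B -> B <= 1 ->
  cross B x y j ^+ 2 <=
   (128 * cK * B * vf B (mdiff R blk x y) + 2 * (16 + 16 * cK) ^+ 2 / N ^+ 2) / N ^+ 2.
Proof.
move=> B0 B1; set V := vf B (mdiff R blk x y).
set K1 := kform k (mdiff R blk x y) (zeta R blk x y j).
set Z := vf B (zeta R blk x y j).
have K0 := ltW (cK_gt0 cm).
have nu0 : 0 <= (N ^+ 2)^-1 by rewrite invr_ge0 exprn_ge0 // ltW.
have h1 : K1 ^+ 2 <= kform k (mdiff R blk x y) (mdiff R blk x y) * (16 * cK / N ^+ 2).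
  apply: le_trans (kform_CS kpd _ _) _; apply: ler_wpM2l; first exact: kform_ge0.
  exact: (kform_zeta_le cm).
have h2 : B * kform k (mdiff R blk x y) (mdiff R blk x y) <= V by rewrite lerDr sqr_ge0.
have h3 : (2 * B * K1) ^+ 2 <= 64 * cK * B * V / N ^+ 2.
  have c0 : 0 <= 64 * cK * B / N ^+ 2 by rewrite !mulr_ge0.
  have := ler_wpM2l c0 h2; have c1 : 0 <= 4 * B ^+ 2 by rewrite mulr_ge0 // sqr_ge0.
  by have := ler_wpM2l c1 h1; set KK := kform _ _ _; lra.
have Z0 : 0 <= Z by exact: (vform_ge0 cm).
have h4 : Z <= (16 + 16 * cK) / N ^+ 2.
  apply: le_trans (vform_zeta_le _ _ _ B0) _; have := adot_zeta_sqr_le x y j.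
  have c1 : 0 <= 16 * cK / N ^+ 2 by rewrite !mulr_ge0.
  by have := ler_wpM2l c1 B1; lra.
have h5 : Z ^+ 2 <= ((16 + 16 * cK) / N ^+ 2) ^+ 2.
  by apply: lerXn2r; rewrite ?nnegrE //; apply: le_trans h4.
rewrite /cross -/K1 -/Z.
have h6 : (2 * B * K1 + Z) ^+ 2 <= 2 * (2 * B * K1) ^+ 2 + 2 * Z ^+ 2.
  by have := sqr_ge0 (2 * B * K1 - Z); lra.
apply: le_trans h6 _; move: h3 h5; rewrite expr_div_n; set nu := (N ^+ 2)^-1 in nu0 *.
have -> : (16 + 16 * cK) ^+ 2 / (N ^+ 2) ^+ 2 = (16 + 16 * cK) ^+ 2 * nu ^+ 2 by rewrite exprVn.
by lra.
Qed.

End Size.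
End PairLyapunov.

(** Up to small errors the noise enters [Ed / 4] as [s / 4] and the second order term as
    [(2/7) (D2 / V) s], from [4/14 = 2/7]. Since [2/7 > 1/4], the latter wins when [D2] is nearly
    all of [V]. Otherwise [B rr] is at least [V / 100], and its contraction, at least [18 nu], beats
    [s <= 16 nu]. *)
Lemma good_numeric (R : realType) (V D2 s rr B gam c1 Ce K L A0 N nu smin Ed Ed2 : R) :
  0 < V -> 0 <= D2 -> 0 <= rr -> 0 < B -> 0 < gam -> 0 < N -> nu = (N ^+ 2)^-1 ->
  0 < smin -> smin <= 1 -> 0 <= K -> 0 <= L -> 0 < A0 -> A0 <= N * V ->
  B * c1 <= 100^-1 -> (Ce + 1936 * K) * B <= smin / 50 -> 30 * L <= A0 * (smin / 50) ->
  18 * 100 <= gam * A0 -> A0 * nu <= V ->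
  V = (1 + B * c1) * D2 + B * rr -> smin * nu <= s -> s <= 16 * nu ->
  Ed <= - (B * gam * rr / N) + Ce * B * nu + s + 16 * K * B * nu ->
  98 / 25 * D2 * s - 50 * (128 * K * B * V + 2 * L * nu) * nu <= Ed2 ->
  Ed / 4 - Ed2 / (14 * V) <= - (smin / 100 * nu).
Proof.
move=> V0 D20 rr0 B0 gam0 N0 nuE smin0 smin1 K0 L0 A00 AV Bc1 HB HL HA nuV VE s1 s2 HEd HEd2.
have nu0 : 0 < nu by rewrite nuE invr_gt0 exprn_gt0.
have s0 : 0 < s by apply: lt_le_trans s1; rewrite mulr_gt0.
have Vn0 : V != 0 by rewrite gt_eqF.
have [Y YE] : exists Y, Y = D2 / V by exists (D2 / V).
have Y0 : 0 <= Y by rewrite YE divr_ge0 // ltW.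
have i0 : 0 <= (14 * V)^-1 by rewrite invr_ge0 mulr_ge0 // ltW.
have h1 : 7 / 25 * Y * s - 50 / 14 * (128 * K * B + 2 * L * (nu / V)) * nu <= Ed2 / (14 * V).
  have := ler_wpM2r i0 HEd2; congr (_ <= _).
  by rewrite YE; field.
have h2 : L * (nu / V) <= smin / 1500.
  have : nu / V <= A0^-1 by rewrite ler_pdivrMr // mulrC ler_pdivlMr // mulrC.
  move=> h; apply: le_trans (ler_wpM2l L0 h) _.
  by rewrite ler_pdivrMr //; move: HL; clear; lra.
have h3 : L * (nu / V) * nu <= smin / 1500 * nu by rewrite ler_pM2r.
have h4 : (Ce + 1936 * K) * B * nu <= smin / 50 * nu by rewrite ler_pM2r.
have KB : 0 <= K * B * nu by rewrite !mulr_ge0 // ltW.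
have sn : 0 <= smin * nu by rewrite mulr_ge0 // ltW.
have h5 : Ed / 4 - Ed2 / (14 * V) <=
   (- (B * gam * rr / N) + s - 28 / 25 * Y * s + 4 / 100 * (smin * nu)) / 4.
  by move: HEd h1 h3 h4 KB sn; clear; lra.
apply: le_trans h5 _.
have rrN : 0 <= B * gam * rr / N by rewrite divr_ge0 ?mulr_ge0 // ltW.
have [D2V|D2V] := leP (98 / 100) Y.
  have : 98 / 100 * s <= Y * s by rewrite ler_pM2r.
  by move: rrN s1 sn; clear; lra.
have D2V' : D2 <= 98 / 100 * V by rewrite -ler_pdivrMr // -YE ltW.
have brr : V / 100 <= B * rr.
  have : B * c1 * D2 <= 100^-1 * D2 by rewrite ler_wpM2r.
  by rewrite {1}VE; move: VE D2V' D20; clear; lra.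
have : 18 * nu <= B * gam * rr / N.
  apply: (@le_trans _ _ (gam * (V / 100) / N)).
    have -> : gam * (V / 100) / N = gam * (N * V) / 100 * nu by rewrite nuE; field; rewrite gt_eqF.
    have : gam * A0 <= gam * (N * V) by rewrite ler_pM2l.
    by move=> h; rewrite ler_pM2r //; move: HA h; clear; lra.
  rewrite ler_pM2r ?invr_gt0 //.
  have -> : B * gam * rr = gam * (B * rr) by ring.
  by rewrite ler_pM2l.
have : 0 <= Y * s by rewrite mulr_ge0 // ltW.
have : smin * nu <= nu by rewrite -[leRHS]mul1r ler_pM2r.
by move: s2 nu0; clear; lra.
Qed.

Lemma pair_good (R : realType) (m : nat) (p a : 'I_m -> R) (k : 'M[R]_m) (beta : R) :
  critical_model p a k beta -> exists B c A0 del, [/\ [/\ 0 < B, B <= 1, 0 < c, c <= 1 & 1 <= A0], 0 < del &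
  forall (n : nat) (blk : 'I_n -> 'I_m), (0 < n)%N -> blocks p blk -> forall x y,
  energy k blk x <= del -> energy k blk y <= del ->
  let V := vform a k B (mdiff R blk x y) in A0 <= n%:R * V ->
  \sum_j pairwt k beta blk x y j * qrt (vform a k B (mdiff R blk (upd x j.1.1 j.1.2) (upd y j.2.1 j.2.2)))
    <= qrt V - c / (n%:R ^+ 2 * qrt V ^+ 3)].
Proof.
move=> cm; have a_gt0 := cm_a cm; pose r0 : R := (1 - tanhR (beta * (\sum_i \sum_j k i j))) / 2.
have [gam [Ce [c1 [gam0 Ce0 c10 Hdr]]]] := pair_drift cm.
have [q q0 qa] := finite_pos_lb a_gt0.
have r0_gt0 : 0 < r0 by rewrite divr_gt0 // subr_gt0 tanhR_lt1.
have [smin [smin0 smin1 sminle]] : exists smin, [/\ 0 < smin, smin <= 1 & smin <= 4 * r0 ^+ 2 * q ^+ 2].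
  exists (Num.min 1 (4 * r0 ^+ 2 * q ^+ 2)); split; rewrite ?ge_min ?lexx ?orbT //.
  rewrite lt_min ltr01 /=; apply: mulr_gt0; last exact: exprn_gt0.
  by apply: mulr_gt0 => //; exact: exprn_gt0.
have [K KE] : exists K, K = \sum_i \sum_j k i j by exists (\sum_i \sum_j k i j).
have K0 : 0 < K by rewrite KE; exact: (cK_gt0 cm).
have [L LE] : exists L, L = (16 + 16 * K) ^+ 2 by exists ((16 + 16 * K) ^+ 2).
have L0 : 0 <= L by rewrite LE sqr_ge0.
have [CK [CK0 CKE]] : exists CK, 0 < CK /\ CK = Ce + 1936 * K.
  exists (Ce + 1936 * K); split; last by [].
  exact: (addr_gt0 Ce0 (mulr_gt0 (ltr0Sn _ _) K0)).
have [E [E0 EE]] : exists E, 0 <= E /\ E = 128 + 256 * K + 4 * L.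
  exists (128 + 256 * K + 4 * L); split; last by [].
  have K1 := mulr_ge0 (ler0n R 256) (ltW K0).
  exact: (addr_ge0 (addr_ge0 (ler0n _ _) K1) (mulr_ge0 (ler0n _ _) L0)).
(* The errors linear in [B] have to be small against the variance bound [smin]. The constant [A0]
   below keeps each increment within [V / 20] and lets the contraction beat the noise. *)
have [B [B0 B1 Bc1 HB]] : exists B, [/\ 0 < B, B <= 1, B * c1 <= 100^-1 &
    CK * B <= smin / 50].
  exists (Num.min 1 (Num.min (100^-1 / c1) (smin / 50 / CK))); split.
  - by rewrite !lt_min ltr01 !divr_gt0.
  - by rewrite ge_min lexx.
  - by rewrite -ler_pdivlMr // !ge_min lexx orbT.
  - by rewrite mulrC -ler_pdivlMr // !ge_min lexx !orbT.
have [A0 [A01 HA HL HD]] : exists A0, [/\ 1 <= A0, 18 * 100 <= gam * A0, 30 * L <= A0 * (smin / 50) &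
    20 * (20 * E) <= A0].
  have [t1 [t10 t1E]] : exists t1, 0 <= t1 /\ gam * t1 = 18 * 100.
    exists (18 * 100 / gam); split; last by rewrite mulrC divfK // gt_eqF.
    by rewrite divr_ge0 ?mulr_ge0 // ltW.
  have [t2 [t20 t2E]] : exists t2, 0 <= t2 /\ t2 * (smin / 50) = 30 * L.
    have s50 : 0 < smin / 50 by rewrite divr_gt0.
    exists (30 * L / (smin / 50)); split; last by rewrite divfK // gt_eqF.
    by rewrite divr_ge0 ?mulr_ge0 // ltW.
  have [t3 [t30 t3E]] : exists t3, 0 <= t3 /\ t3 = 20 * (20 * E).
    by exists (20 * (20 * E)); split; [rewrite !mulr_ge0 | ].
  exists (1 + t1 + t2 + t3); split.
  - by move: t10 t20 t30; clear; lra.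
  - by rewrite -t1E ler_pM2l //; move: t10 t20 t30; clear; lra.
  - by rewrite -t2E ler_pM2r ?divr_gt0 //; move: t10 t20 t30; clear; lra.
  - by rewrite -t3E; move: t10 t20 t30; clear; lra.
have [del del0 Hd] := Hdr B B0.
exists B, (smin / 100), A0, del; split=> //.
  by split=> //; move: smin0 smin1; clear; lra.
move=> n blk n_gt0 bp x y Qx Qy V AV.
have N0 : 0 < n%:R :> R by rewrite ltr0n.
have N1 : 1 <= n%:R :> R by rewrite ler1n.
have A00 : 0 < A0 by apply: lt_le_trans A01.
have V0 : 0 < V by rewrite -(pmulr_rgt0 _ N0); apply: lt_le_trans AV.
have [nu nuE] : exists nu : R, nu = (n%:R ^+ 2)^-1 by exists (n%:R ^+ 2)^-1.
have nu0 : 0 < nu by rewrite nuE invr_gt0 exprn_gt0.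
have nuV : A0 * nu <= V.
  rewrite nuE ler_pdivrMr ?exprn_gt0 //; apply: le_trans AV _.
  by rewrite mulrC ler_pM2l // expr2 -{1}[n%:R]mulr1 ler_pM2l.
have nuV1 : nu <= V by apply: le_trans nuV; rewrite -{1}[nu]mul1r ler_pM2r.
have [rr [rr0 VE Hdrift]] := Hd n blk n_gt0 bp x y Qx Qy.
set d := mdiff R blk x y in VE Hdrift V AV V0 nuV nuV1 *.
pose u j := adot a (zeta R blk x y j).
pose e j := cross a k blk B x y j.
pose D := adot a d.
pose s := \sum_j pairwt k beta blk x y j * u j ^+ 2.
have w0 j : 0 <= pairwt k beta blk x y j by exact: pairwt_ge0.
have w1 := pairwt_sum1 k beta blk n_gt0 x y.
have DV : D ^+ 2 <= V by exact: (adot_mdiff_sqr_le cm blk x y (ltW B0)).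
have u2 j : u j ^+ 2 <= 16 * nu by rewrite nuE; exact: (adot_zeta_sqr_le cm).
have e2 j : e j ^+ 2 <= (128 * K * B * V + 2 * L * nu) * nu.
  by rewrite nuE LE KE; exact: (cross_sqr_le cm blk n_gt0 x y j (ltW B0) B1).
have dle j : `|2 * D * u j + e j| <= V / 20.
  rewrite -(ler_pXn2r (n := 2)) ?nnegrE ?divr_ge0 ?(ltW V0) // real_normK ?num_real //.
  have h1 : (2 * D * u j + e j) ^+ 2 <= 8 * (D ^+ 2 * u j ^+ 2) + 2 * e j ^+ 2.
    by have := sqr_ge0 (2 * D * u j - e j); clear; lra.
  have h2 : D ^+ 2 * u j ^+ 2 <= V * (16 * nu) by apply: ler_pM => //; exact: sqr_ge0.
  have h3 : K * B * (V * nu) <= K * (V * nu).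
    have -> : K * B * (V * nu) = B * (K * (V * nu)) by ring.
    rewrite -[leRHS]mul1r ler_pM2r // ?mulr_gt0 //.
  have h4 : L * (nu * nu) <= L * (V * nu) by rewrite ler_wpM2l // ler_pM2r.
  have h5 : 20 * (20 * (E * (nu * V))) <= V * V.
    apply: (@le_trans _ _ (A0 * nu * V)); last by rewrite ler_pM2r.
    by rewrite -(mulrA A0) !mulrA -(mulrA _ nu) -(mulrA A0) ler_pM2r ?mulr_gt0 // -mulrA.
  rewrite EE in h5.
  by have := e2 j; move: h1 h2 h3 h4 h5; clear; lra.
have := qrt_avg w0 w1 V0 dle.
under eq_bigr => j _ do rewrite -(vform_upd cm blk n_gt0 B x y j).
pose Ed := \sum_j pairwt k beta blk x y j * (2 * D * u j + e j).
pose Ed2 := \sum_j pairwt k beta blk x y j * (2 * D * u j + e j) ^+ 2.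
rewrite -/Ed -/Ed2 => H; apply: le_trans H _.
have HEd : Ed <= - (B * gam * rr / n%:R) + Ce * B * nu + s + 16 * K * B * nu.
  have -> : Ed = \sum_j pairwt k beta blk x y j * (2 * D * u j + 2 * B * kform k d (zeta R blk x y j))
     + \sum_j pairwt k beta blk x y j * vform a k B (zeta R blk x y j).
    by rewrite -big_split; apply: eq_bigr => j _ /=; rewrite /e /cross -/d; ring.
  have h : \sum_j pairwt k beta blk x y j * vform a k B (zeta R blk x y j) <= s + 16 * K * B * nu.
    rewrite -[16 * K * B * nu](pairwt_avg k beta blk n_gt0 x y) -big_split /=.
    apply: ler_sum => j _; rewrite -mulrDr; apply: ler_wpM2l => //.
    by rewrite KE nuE; exact: (vform_zeta_le cm blk n_gt0 x y j (ltW B0)).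
  by move: Hdrift h; rewrite -nuE -/D; clear; lra.
have HEd2 : 98 / 25 * D ^+ 2 * s - 50 * (128 * K * B * V + 2 * L * nu) * nu <= Ed2.
  rewrite -[50 * _ * nu](pairwt_avg k beta blk n_gt0 x y) /s mulr_sumr -sumrB.
  apply: ler_sum => j _.
  have := ler_wpM2l (w0 j) (e2 j).
  (* Young's inequality gives up a fiftieth of [(2 D u)^2], within the margin between [2/7] and
     [1/4]. *)
  have : 98 / 25 * D ^+ 2 * u j ^+ 2 - 50 * e j ^+ 2 <= (2 * D * u j + e j) ^+ 2.
    by have := sqr_ge0 (2 * D * u j + 50 * e j); have := sqr_ge0 (e j); clear; lra.
  by move=> h; have := ler_wpM2l (w0 j) h; clear; lra.
have s1 : smin * nu <= s.
  apply: le_trans (pair_variance cm blk n_gt0 x y (ltW q0) qa).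
  by rewrite -nuE ler_pM2r.
have s2 : s <= 16 * nu by apply: pairwt_avg_le.
rewrite CKE in HB.
have := good_numeric V0 (sqr_ge0 D) rr0 B0 gam0 N0 nuE smin0 smin1 (ltW K0) L0 A00 AV Bc1 HB HL HA
   nuV VE s1 s2 HEd HEd2.
move=> H.
have z0 := qrt_gt0 V0; have zK := qrtK (ltW V0).
set z := qrt V in z0 zK *.
have -> : z - smin / 100 / (n%:R ^+ 2 * z ^+ 3) = z * (1 + (- (smin / 100 * nu)) / V).
  by rewrite nuE -zK; field; rewrite !gt_eqF.
rewrite ler_pM2l // lerD2l ler_pdivlMr //.
by move: H; congr (_ <= _); field; rewrite gt_eqF.
Qed.

Lemma linear_le_cubic (R : realFieldType) (c C q : R) : 0 < c -> 0 < C -> 0 <= q ->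
  C * q <= c * q ^+ 3 + (C + C ^+ 2 / (4 * c)).
Proof.
move=> c0 C0 q0; have t0 : 0 <= C ^+ 2 / (4 * c) by rewrite divr_ge0 ?sqr_ge0 // mulr_ge0 // ltW.
have [q1|q1] := leP q 1.
  have : C * q <= C by rewrite -[leRHS]mulr1 ler_pM2l.
  have : 0 <= c * q ^+ 3 by rewrite mulr_ge0 ?exprn_ge0 // ltW.
  by lra.
have h1 : C * q <= c * q ^+ 2 + C ^+ 2 / (4 * c).
  rewrite -subr_ge0; have -> : c * q ^+ 2 + C ^+ 2 / (4 * c) - C * q = c * (q - C / (2 * c)) ^+ 2.
    by field; rewrite gt_eqF.
  by rewrite mulr_ge0 ?sqr_ge0 // ltW.
have h2 : c * q ^+ 2 <= c * q ^+ 3 by rewrite ler_pM2l // ler_eXn2l.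
by lra.
Qed.

(** * Energy penalty and growth at large energies *)

Section Penalty.
Variables (R : realType) (m : nat) (p a : 'I_m -> R) (k : 'M[R]_m) (beta : R).
Hypothesis cm : critical_model p a k beta.

Let kpd := cm_pd cm.
Local Notation cK := (\sum_i \sum_j k i j).
Local Notation vf := (vform a k).

(** Even with a weight [n^{1/4}] the error [n^{-5/2}] is below the gain of order [n^{-2}] of a good
    step, which the error [n^{-2}] in the recursion for the energy itself would not be. The mixed
    terms [Q / n^2] are absorbed by [linear_le_cubic] at the scale [n^{-1/2}] of [Q]. *)
Lemma step_energy_sqr_le : exists c C, [/\ 0 < c, 0 < C &
  forall (n : nat) (blk : 'I_n -> 'I_m), (0 < n)%N -> blocks p blk -> forall x,
  step k blk beta (fun y => energy k blk y ^+ 2) x <=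
    energy k blk x ^+ 2 - c * energy k blk x ^+ 3 / n%:R + C / Num.sqrt n%:R ^+ 5].
Proof.
have [c1 [C1 [c1_gt0 C1_gt0 HE]]] := step_energy_le cm.
have [c2 c2_gt0 HF] := energy_field4 cm.
have K_gt0 := cK_gt0 cm.
have [K KE] : exists K, K = cK by exists cK.
pose c := c1 * c2; have c_gt0 : 0 < c by rewrite mulr_gt0.
pose C2 := 2 * C1 + 32 * K.
have C2_gt0 : 0 < C2 by rewrite /C2 KE; lra.
exists c, (C2 + C2 ^+ 2 / (4 * c) + 32 * K ^+ 2); split=> //.
  have : 0 < C2 ^+ 2 / (4 * c) by rewrite divr_gt0 ?exprn_gt0 // mulr_gt0.
  by have := sqr_ge0 K; lra.
move=> n blk n_gt0 bp x; set Q := energy k blk.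
have N_gt0 : 0 < n%:R :> R by rewrite ltr0n.
have N_ge1 : 1 <= n%:R :> R by rewrite ler1n.
set s := Num.sqrt n%:R.
have s_gt0 : 0 < s by rewrite sqrtr_gt0.
have sN : n%:R = s ^+ 2 by rewrite sqr_sqrtr // ltW.
have s_ge1 : 1 <= s by rewrite -(ler_pXn2r (n := 2)) ?nnegrE ?(ltW s_gt0) // -sN expr1n.
have Q0 : 0 <= Q x by exact: (energy_ge0 cm).
pose dl c := Q (upd x c.1 c.2) - Q x.
have d2 c0 : dl c0 ^+ 2 <= 32 * K * Q x / n%:R ^+ 2 + 32 * K ^+ 2 / n%:R ^+ 4.
  rewrite /dl /Q (energy_upd cm) //.
  set k1 := kform k _ (incr _ _ _ _); set k2 := kform k (incr _ _ _ _) _.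
  have h1 : k1 ^+ 2 <= Q x * (4 * K / n%:R ^+ 2).
    apply: le_trans (kform_CS kpd _ _) _; apply: ler_wpM2l => //.
    by rewrite KE; exact: (kform_incr_le cm).
  have h0 : 0 <= k2 by exact: kform_ge0.
  have h2 : k2 <= 4 * K / n%:R ^+ 2 by rewrite KE; exact: (kform_incr_le cm).
  have h3 : k2 ^+ 2 <= (4 * K / n%:R ^+ 2) ^+ 2.
    by apply: lerXn2r; rewrite ?nnegrE //; apply: le_trans h2.
  have -> : 32 * K ^+ 2 / n%:R ^+ 4 = 2 * (4 * K / n%:R ^+ 2) ^+ 2 by field; rewrite gt_eqF.
  have -> : energy k blk x + 2 * k1 + k2 - energy k blk x = 2 * k1 + k2 by ring.
  rewrite -/Q; move: h1 h3; set Kn := 4 * K / _.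
  have -> : 32 * K * Q x / n%:R ^+ 2 = 8 * (Q x * Kn) by rewrite /Kn; ring.
  by have := sqr_ge0 (2 * k1 - k2); lra.
have -> : step k blk beta (fun y => Q y ^+ 2) x =
    \sum_c wt k blk beta x c * Q x ^+ 2 + (2 * Q x * (\sum_c wt k blk beta x c * Q (upd x c.1 c.2)
      - \sum_c wt k blk beta x c * Q x) + \sum_c wt k blk beta x c * dl c ^+ 2).
  rewrite -sumrB mulr_sumr -!big_split; apply: eq_bigr => c0 _ /=.
  by rewrite /dl; ring.
rewrite !wt_avg // -/(step k blk beta Q x).
have h1 : \sum_c wt k blk beta x c * dl c ^+ 2 <= 32 * K * Q x / n%:R ^+ 2 + 32 * K ^+ 2 / n%:R ^+ 4.
  exact: wt_avg_le.
have h2 : step k blk beta Q x - Q x <= - (c * Q x ^+ 2 / n%:R) + C1 / n%:R ^+ 2.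
  have := HE n blk n_gt0 bp x; have := HF n blk x.
  rewrite -(ler_pM2l c1_gt0) mulrA -/c -(ler_pM2r (_ : 0 < n%:R^-1)) ?invr_gt0 // -/Q.
  have -> : c1 / n%:R * field4 p k blk x = c1 * field4 p k blk x / n%:R by rewrite mulrAC.
  by lra.
have h3 := ler_wpM2l (mulr_ge0 (ler0n R 2) Q0) h2.
have h4 : C2 * (Q x * s) <= c * (Q x * s) ^+ 3 + (C2 + C2 ^+ 2 / (4 * c)).
  by apply: linear_le_cubic => //; rewrite mulr_ge0 // ltW.
have i5 : 0 < (s ^+ 5)^-1 by rewrite invr_gt0 exprn_gt0.
have {}h4 : C2 * Q x / n%:R ^+ 2 <= c * Q x ^+ 3 / n%:R + (C2 + C2 ^+ 2 / (4 * c)) / s ^+ 5.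
  have h5 := ler_wpM2r (ltW i5) h4; rewrite [leRHS]mulrDl in h5.
  by rewrite sN; move: h5; congr (_ <= _ + _); field; rewrite gt_eqF.
have h5 : 32 * K ^+ 2 / n%:R ^+ 4 <= 32 * K ^+ 2 / s ^+ 5.
  rewrite sN -exprM; apply: ler_wpM2l; first by rewrite mulr_ge0 // sqr_ge0.
  by rewrite lef_pV2 ?posrE ?exprn_gt0 // ler_weXn2l.
have e1 : 2 * Q x * (- (c * Q x ^+ 2 / n%:R) + C1 / n%:R ^+ 2) =
  - (2 * (c * Q x ^+ 3 / n%:R)) + 2 * C1 * Q x / n%:R ^+ 2 by ring.
have e2 : C2 * Q x / n%:R ^+ 2 = 2 * C1 * Q x / n%:R ^+ 2 + 32 * K * Q x / n%:R ^+ 2.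
  by rewrite /C2; ring.
rewrite e1 in h3; rewrite e2 in h4.
rewrite [(_ + _ + 32 * K ^+ 2) / s ^+ 5]mulrDl.
by move: h1 h3 h4 h5; lra.
Qed.

(** Without control of the energies only the size of the increments is used: [V] grows by at most a
    multiple of [sqrt V / n], which the tangent of the fourth root turns into [1 / (n V^{1/4})]. *)
Lemma pair_bad B : 0 < B -> B <= 1 -> exists2 C, 0 < C &
  forall (n : nat) (blk : 'I_n -> 'I_m), (0 < n)%N -> blocks p blk -> forall x y,
  let V := vf B (mdiff R blk x y) in 1 <= n%:R * V ->
  \sum_j pairwt k beta blk x y j * qrt (vf B (mdiff R blk (upd x j.1.1 j.1.2) (upd y j.2.1 j.2.2)))
    <= qrt V + C / (n%:R * qrt V).
Proof.
move=> B0 B1; have K0 := cK_gt0 cm.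
have [K KE] : exists K, K = cK by exists cK.
rewrite -KE in K0.
pose C := 32 + 24 * K; exists (C / 4); first by rewrite divr_gt0 // addr_gt0 // mulr_gt0.
move=> n blk n_gt0 bp x y V NV.
have N0 : 0 < n%:R :> R by rewrite ltr0n.
have N1 : 1 <= n%:R :> R by rewrite ler1n.
have V0 : 0 < V by rewrite -(pmulr_rgt0 _ N0); apply: lt_le_trans NV.
set d := mdiff R blk x y in V NV V0 *.
have z0 := qrt_gt0 V0; have zK := qrtK (ltW V0); set z := qrt V in z0 zK *.
apply: pairwt_avg_le => // j.
rewrite (vform_upd cm) // -/d -/V.
set u := adot a (zeta R blk x y j); set D := adot a d.
set t := 2 * D * u + _.
have z2V : V = (z ^+ 2) ^+ 2 by rewrite -exprM zK.
have abs2 (s e : R) : 0 <= e -> s ^+ 2 <= e ^+ 2 -> s <= e.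
  move=> e0 se; apply: le_trans (ler_norm _) _.
  by rewrite -(ler_pXn2r (n := 2)) ?nnegrE // real_normK ?num_real.
have zz : 0 <= z ^+ 2 / n%:R by rewrite divr_ge0 ?sqr_ge0 // ltW.
have nu : (n%:R ^+ 2)^-1 <= z ^+ 2 / n%:R.
  rewrite expr2 invfM ler_pM2r ?invr_gt0 //; apply: abs2; first exact: sqr_ge0.
  rewrite -z2V -[V]mul1r; apply: (@le_trans _ _ (n%:R^-1)).
    by rewrite expr2 ler_piMl ?invr_ge0 ?(ltW N0) // invf_le1.
  by rewrite mul1r -[leLHS]mul1r ler_pdivrMr // mulrC.
have h1 : D * u <= 4 * (z ^+ 2 / n%:R).
  apply: abs2; first by rewrite mulr_ge0.
  have -> : (4 * (z ^+ 2 / n%:R)) ^+ 2 = V * (16 / n%:R ^+ 2) by rewrite z2V; field; rewrite gt_eqF.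
  rewrite exprMn; apply: ler_pM; rewrite ?sqr_ge0 //.
    exact: (adot_mdiff_sqr_le cm _ _ _ (ltW B0)).
  exact: (adot_zeta_sqr_le cm).
have h2 : B * kform k d (zeta R blk x y j) <= (4 + 4 * K) * (z ^+ 2 / n%:R).
  apply: abs2; first by rewrite mulr_ge0 //; lra.
  apply: (@le_trans _ _ (V * (16 * K / n%:R ^+ 2))).
    apply: (@le_trans _ _ (B * (B * (kform k d d * kform k (zeta R blk x y j) (zeta R blk x y j))))).
      rewrite exprMn expr2 -mulrA ler_pM2l // ler_pM2l //; exact: kform_CS.
    apply: (@le_trans _ _ (B * (kform k d d * kform k (zeta R blk x y j) (zeta R blk x y j)))).
      rewrite -[leRHS]mul1r; apply: ler_wpM2r => //; apply: mulr_ge0; first exact: ltW.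
      by apply: mulr_ge0; exact: kform_ge0.
    rewrite (mulrA B); apply: ler_pM; last first.
    - by rewrite KE; exact: (kform_zeta_le cm).
    - by rewrite /V lerDr sqr_ge0.
    - exact: kform_ge0.
    - by rewrite pmulr_rge0 //; exact: kform_ge0.
  rewrite z2V -subr_ge0.
  have -> : ((4 + 4 * K) * (z ^+ 2 / n%:R)) ^+ 2 - (z ^+ 2) ^+ 2 * (16 * K / n%:R ^+ 2) =
     (z ^+ 2 / n%:R) ^+ 2 * (16 + 16 * K + 16 * K ^+ 2) by field; rewrite gt_eqF.
  by rewrite mulr_ge0 ?sqr_ge0 //; have := sqr_ge0 K; lra.
have h3 : vf B (zeta R blk x y j) <= (16 + 16 * K) * (z ^+ 2 / n%:R).
  apply: le_trans (vform_zeta_le cm blk n_gt0 x y j (ltW B0)) _; rewrite -KE.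
  apply: (@le_trans _ _ ((16 + 16 * K) * (n%:R ^+ 2)^-1)); last first.
    by apply: ler_wpM2l => //; lra.
  have := adot_zeta_sqr_le cm blk n_gt0 x y j.
  have : 16 * K * B / n%:R ^+ 2 <= 16 * K / n%:R ^+ 2.
    rewrite ler_wpM2r ?invr_ge0 ?exprn_ge0 ?(ltW N0) // -[leRHS]mulr1 ler_wpM2l //.
    by rewrite mulr_ge0 // ltW.
  by lra.
have tle : t <= C * (z ^+ 2 / n%:R).
  by rewrite /t /cross -/d -/u /C; move: h1 h2 h3; lra.
have V'0 : 0 <= V + t.
  by rewrite -(vform_upd cm blk n_gt0 B x y j); apply: (vform_ge0 cm) => //; exact: ltW.
apply: le_trans (qrt_tangent V0 V'0) _; rewrite -/z mulrDr mulr1 lerD2l.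
have -> : C / 4 / (n%:R * z) = z * (C * (z ^+ 2 / n%:R) / (4 * V)).
  by rewrite -zK; field; rewrite !gt_eqF.
by rewrite ler_pM2l // ler_pM2r // invr_gt0 mulr_gt0.
Qed.

End Penalty.

Section PairCoupling.
Variables (R : realType) (m : nat) (p a : 'I_m -> R) (k : 'M[R]_m) (beta : R).
Hypothesis cm : critical_model p a k beta.
Variables (n : nat) (blk : 'I_n -> 'I_m).
Hypotheses (n_gt0 : (0 < n)%N) (bp : blocks p blk).
Implicit Types (x y : state n) (g f : state n -> R).
Local Notation cK := (\sum_i \sum_j k i j).
Local Notation pw := (pairwt k beta blk).

Lemma step_pairwt g x y : step k blk beta g x - step k blk beta g y =
  \sum_j pw x y j * (g (upd x j.1.1 j.1.2) - g (upd y j.2.1 j.2.2)).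
Proof.
under eq_bigr => j _ do rewrite mulrBr.
rewrite sumrB (pairwt_fst k beta blk n_gt0 x y (fun c => g (upd x c.1 c.2))).
by rewrite (pairwt_snd k beta blk n_gt0 x y (fun c => g (upd y c.1 c.2))).
Qed.

Definition pairV B x y : R := vform a k B (mdiff R blk x y).

(** With [gw] of order [n^{1/4}] the penalty outweighs a growth of order [n^{-3/4}] when an energy
    is large, yet is only of order [n^{-3/4}] when the energies are of order [n^{-1/2}]. *)
Definition pairF B gw x y : R :=
  qrt (pairV B x y) + gw * (energy k blk x ^+ 2 + energy k blk y ^+ 2).

Lemma pairV_ge0 B x y : 0 <= B -> 0 <= pairV B x y.
Proof. exact: (vform_ge0 cm). Qed.

Lemma pairV_le B x y : 0 <= B -> B <= 1 -> pairV B x y <= 4 + 4 * cK.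
Proof.
move=> B0 B1; have K0 := cK_gt0 cm; apply: lerD.
  have h : `|adot a (mdiff R blk x y)| <= 2.
    apply: (adot_le cm) => i; apply: le_trans (ler_normB _ _) _.
    have := magn_le1 cm n_gt0 bp x i; have := magn_le1 cm n_gt0 bp y i.
    by lra.
  rewrite -real_normK ?num_real //; have : 0 <= `|adot a (mdiff R blk x y)| by [].
  by nra.
have h1 := kform_mdiff_le cm blk x y; have h2 := energy_le cm n_gt0 bp x.
have h3 := energy_le cm n_gt0 bp y.
have h4 := kform_ge0 (cm_pd cm) (mdiff R blk x y).
have : B * kform k (mdiff R blk x y) (mdiff R blk x y) <= 1 * kform k (mdiff R blk x y) (mdiff R blk x y).
  by rewrite ler_wpM2r.
by lra.
Qed.

Lemma pairF_step B gw g x y c alpha : 0 <= alpha ->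
  (forall x' y', g x' - g y' <= c + alpha * pairF B gw x' y') ->
  step k blk beta g x - step k blk beta g y <= c + alpha *
   (\sum_j pw x y j * qrt (pairV B (upd x j.1.1 j.1.2) (upd y j.2.1 j.2.2)) +
     gw * (step k blk beta (fun z => energy k blk z ^+ 2) x +
           step k blk beta (fun z => energy k blk z ^+ 2) y)).
Proof.
move=> al0 Hg; rewrite step_pairwt.
apply: (@le_trans _ _ (\sum_j pw x y j * (c + alpha * pairF B gw (upd x j.1.1 j.1.2) (upd y j.2.1 j.2.2)))).
  by apply: ler_sum => j _; apply: ler_wpM2l; [exact: pairwt_ge0 | exact: Hg].
rewrite le_eqVlt; apply/orP; left; apply/eqP.
rewrite -[X in _ = X + _](pairwt_avg k beta blk n_gt0 x y).
have -> : step k blk beta (fun z => energy k blk z ^+ 2) x =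
    \sum_j pw x y j * energy k blk (upd x j.1.1 j.1.2) ^+ 2.
  by rewrite (pairwt_fst k beta blk n_gt0 x y (fun c => energy k blk (upd x c.1 c.2) ^+ 2)).
have -> : step k blk beta (fun z => energy k blk z ^+ 2) y =
    \sum_j pw x y j * energy k blk (upd y j.2.1 j.2.2) ^+ 2.
  by rewrite (pairwt_snd k beta blk n_gt0 x y (fun c => energy k blk (upd y c.1 c.2) ^+ 2)).
rewrite -[in RHS]big_split [in RHS]mulr_sumr -[in RHS]big_split [in RHS]mulr_sumr -big_split.
by apply: eq_bigr => j _ /=; rewrite /pairF; ring.
Qed.

End PairCoupling.

Lemma close_pair (R : realType) (m : nat) (p a : 'I_m -> R) (k : 'M[R]_m) (beta : R) :
  critical_model p a k beta -> exists B A g c, [/\ 0 < B, 0 < A, 0 < g, 0 < c &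
  forall (n : nat) (blk : 'I_n -> 'I_m), (0 < n)%N -> blocks p blk ->
  forall T0 T delta kappa, 0 <= delta -> 0 < kappa -> n%:R ^+ 2 * kappa ^+ 4 <= c * T%:R ->
  (forall x y, n%:R * pairV a k blk B x y <= A -> close k blk beta T0 delta x y) ->
  forall x y, close k blk beta (T0 + T)
    (delta + 3 / (2 * kappa) * pairF a k blk B (g * qrt n%:R) x y) x y].
Proof.
move=> cm.
have [B [c [A0 [del [[B0 B1 c0 c_le1 A01] del0 Hgood]]]]] := pair_good cm.
have [Cb Cb0 Hbad] := pair_bad cm B0 B1.
have [cp [Cp [cp0 Cp0 Hpen]]] := step_energy_sqr_le cm.
have K0 := cK_gt0 cm.
pose Z : R := 4 + 4 * \sum_i \sum_j k i j.
have Z1 : 1 <= Z by rewrite /Z; move: K0; set K := \sum_i _; clear; lra.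
have Z0 : 0 < Z by apply: lt_le_trans Z1.
have d3 : 0 < cp * del ^+ 3 by rewrite mulr_gt0 // exprn_gt0.
(* At large energies the penalty pays for the growth [Cb], its own error and the required decrease;
   in units of [w^-3] each of the last two is at most 1. *)
have [g [g0 gE]] : exists g, 0 < g /\ g * (cp * del ^+ 3) = Cb + 2.
  exists ((Cb + 2) / (cp * del ^+ 3)); split; last by rewrite divfK // gt_eqF.
  by rewrite divr_gt0 // addr_gt0.
have [Om [Om1 Om2 Om3]] : exists Om, [/\ 1 <= Om, 2 * g * Cp <= Om & 4 * g * Cp * Z ^+ 3 <= c * Om].
  have t1 : 0 <= 2 * g * Cp by rewrite !mulr_ge0 // ltW.
  have t2 : 0 <= 4 * g * Cp * Z ^+ 3 / c by rewrite divr_ge0 ?mulr_ge0 ?exprn_ge0 // ltW.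
  exists (1 + 2 * g * Cp + 4 * g * Cp * Z ^+ 3 / c); split.
  - by move: t1 t2; clear; lra.
  - by move: t1 t2; clear; lra.
  - rewrite -[leLHS](divfK (lt0r_neq0 c0)) mulrC ler_pM2l //.
    by move: t1 t2; clear; lra.
(* As [V <= Z], the condition [n V > A] forces [n > Om^4]; for small [n] every pair is already in
   the target set. *)
pose A := A0 + Z * Om ^+ 4.
have A_gt0 : 0 < A.
  apply: addr_gt0; first by apply: lt_le_trans A01.
  by apply: mulr_gt0 => //; apply: exprn_gt0; apply: lt_le_trans Om1.
exists B, A, g, (3 / 2 * c); split=> //; first by rewrite mulr_gt0.
move=> n blk n_gt0 bp T0 T delta kappa delta0 kap0 HT HG.
have N0 : 0 < n%:R :> R by rewrite ltr0n.
pose w : R := qrt n%:R.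
have w0 : 0 < w by exact: qrt_gt0.
have wN : n%:R = w ^+ 4 :> R by rewrite qrtK // ltW.
have ws : Num.sqrt n%:R = w ^+ 2 by rewrite sqr_sqrtr // sqrtr_ge0.
(* The line [(1 + b) F - d] is the tangent at [kappa] of the concave function
   [F - c / (2 n^2 F^3)]. *)
pose b := 3 / 2 * c / (n%:R ^+ 2 * kappa ^+ 4).
pose d := 2 * c / (n%:R ^+ 2 * kappa ^+ 3).
have b0 : 0 < b by rewrite divr_gt0 // mulr_gt0 // exprn_gt0.
have d0 : 0 < d by rewrite divr_gt0 // mulr_gt0 // exprn_gt0.
have bT : 1 <= b * T%:R.
  by rewrite mulrAC ler_pdivlMr ?mul1r // mulr_gt0 // exprn_gt0.
have -> : 3 / (2 * kappa) = 2 * (b / d).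
  by rewrite /b /d; field; rewrite !gt_eqF.
apply: (hitting_close n_gt0 (G := fun x y => n%:R * pairV a k blk B x y <= A)) => //.
  move=> x y; rewrite addr_ge0 ?qrt_ge0 // mulr_ge0 ?addr_ge0 ?sqr_ge0 // mulr_ge0 ?qrt_ge0 //.
  exact: ltW.
move=> x y nG f c' alpha al0 Hf.
apply: le_trans (pairF_step beta n_gt0 x y al0 Hf) _.
rewrite lerD2l; apply: ler_wpM2l => //.
have {}nG : A < n%:R * pairV a k blk B x y by rewrite ltNge; exact/negP.
set V := pairV a k blk B x y in nG *.
have VZ : V <= Z by exact: (pairV_le cm n_gt0 bp x y (ltW B0) B1).
have A0V : A0 <= n%:R * V.
  apply: ltW; apply: le_lt_trans nG; rewrite lerDl mulr_ge0 ?exprn_ge0 // ltW //.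
  by apply: lt_le_trans Om1.
have NV1 : 1 <= n%:R * V by apply: le_trans A0V.
have V0 : 0 < V by rewrite -(pmulr_rgt0 _ N0); apply: lt_le_trans NV1.
have Om0 : 0 < Om by apply: lt_le_trans Om1.
have wOm : Om <= w.
  rewrite -(ler_pXn2r (n := 4)) ?nnegrE ?(ltW w0) ?(ltW Om0) // -wN.
  rewrite -(ler_pM2l Z0) [leRHS]mulrC; apply: (@le_trans _ _ A).
    by rewrite lerDr; apply: le_trans A01.
  by apply: ltW; apply: lt_le_trans nG _; rewrite ler_pM2l.
have z0 := qrt_gt0 V0; have zK := qrtK (ltW V0).
set z := qrt V in z0 zK *.
have zZ : z <= Z.
  apply: qrt_le; [exact: ltW | exact: ltW | apply: le_trans VZ _].
  by rewrite -{1}[Z]expr1 ler_weXn2l.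
have w1 : 1 <= w by apply: le_trans wOm.
have zw : 1 <= z * w.
  by rewrite -(ler_pXn2r (n := 4)) ?nnegrE ?mulr_ge0 ?(ltW w0) ?(ltW z0) // exprMn zK -wN expr1n mulrC.
have px := Hpen n blk n_gt0 bp x; have py := Hpen n blk n_gt0 bp y.
rewrite ws -exprM in px py.
set Ez := \sum_j _.
set Sx := step _ _ _ _ x in px *; set Sy := step _ _ _ _ y in py *.
set Qx := energy k blk x in px *; set Qy := energy k blk y in py *.
have Qx0 : 0 <= Qx by exact: (energy_ge0 cm).
have Qy0 : 0 <= Qy by exact: (energy_ge0 cm).
have pen : g * w * (Sx + Sy) <= g * w * (Qx ^+ 2 + Qy ^+ 2)
    - g * (cp * (Qx ^+ 3 + Qy ^+ 3)) / w ^+ 3 + 2 * g * Cp / w ^+ 9.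
  have gw : 0 <= g * w by rewrite mulr_ge0 // ltW.
  apply: le_trans (ler_wpM2l gw (lerD px py)) _.
  rewrite wN le_eqVlt; apply/orP; left; apply/eqP.
  by field; rewrite gt_eqF.
have main : Ez + g * w * (Sx + Sy) <= z + g * w * (Qx ^+ 2 + Qy ^+ 2) - c / 2 / (n%:R ^+ 2 * z ^+ 3).
  have Qx3 : 0 <= Qx ^+ 3 by rewrite exprn_ge0.
  have Qy3 : 0 <= Qy ^+ 3 by rewrite exprn_ge0.
  have i9 : 0 < (w ^+ 9)^-1 by rewrite invr_gt0 exprn_gt0.
  have i3 : 0 < (w ^+ 3)^-1 by rewrite invr_gt0 exprn_gt0.
  have [/andP[hx hy]|bad] := boolP ((Qx <= del) && (Qy <= del)).
    have H : Ez <= z - c / (n%:R ^+ 2 * z ^+ 3) by exact: (Hgood n blk n_gt0 bp x y hx hy A0V).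
    have h1 : 0 <= g * (cp * (Qx ^+ 3 + Qy ^+ 3)) / w ^+ 3.
      by rewrite divr_ge0 ?exprn_ge0 ?(ltW w0) // !mulr_ge0 ?addr_ge0 // ltW.
    have h2 : 2 * g * Cp / w ^+ 9 <= c / 2 / (n%:R ^+ 2 * z ^+ 3).
      have -> : 2 * g * Cp / w ^+ 9 = (4 * g * Cp * z ^+ 3) * (2 * w ^+ 9 * z ^+ 3)^-1.
        by field; rewrite !gt_eqF.
      have -> : c / 2 / (n%:R ^+ 2 * z ^+ 3) = (c * w) * (2 * w ^+ 9 * z ^+ 3)^-1.
        by rewrite wN; field; rewrite !gt_eqF.
      rewrite ler_pM2r; last by rewrite invr_gt0 !mulr_gt0 // exprn_gt0.
      apply: (@le_trans _ _ (c * Om)); last by rewrite ler_pM2l.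
      apply: le_trans Om3; apply: ler_wpM2l; first by rewrite !mulr_ge0 // ltW.
      by apply: lerXn2r; rewrite ?nnegrE ?(ltW z0) // ltW.
    have h3 : c / (n%:R ^+ 2 * z ^+ 3) = 2 * (c / 2 / (n%:R ^+ 2 * z ^+ 3)).
      by field; rewrite !gt_eqF.
    by move: pen H h1 h2 h3; clear; lra.
  have H : Ez <= z + Cb / w ^+ 3.
    apply: le_trans (Hbad n blk n_gt0 bp x y NV1) _; rewrite lerD2l -/V -/z ler_pM2l //.
    rewrite lef_pV2 ?posrE ?mulr_gt0 ?exprn_gt0 // wN.
    have -> : w ^+ 4 * z = w ^+ 3 * (z * w) by ring.
    by rewrite -[leLHS]mulr1 ler_pM2l // exprn_gt0.
  have Q3 : del ^+ 3 <= Qx ^+ 3 + Qy ^+ 3.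
    move: bad; rewrite negb_and -!ltNge => /orP[h|h].
      have : del ^+ 3 <= Qx ^+ 3 by apply: lerXn2r; rewrite ?nnegrE // ltW.
      by move: Qy3; clear; lra.
    have : del ^+ 3 <= Qy ^+ 3 by apply: lerXn2r; rewrite ?nnegrE // ltW.
    by move: Qx3; clear; lra.
  have h1 : (Cb + 2) / w ^+ 3 <= g * (cp * (Qx ^+ 3 + Qy ^+ 3)) / w ^+ 3.
    by rewrite ler_pM2r // -gE ler_pM2l // ler_pM2l.
  have h2 : 2 * g * Cp / w ^+ 9 <= 1 / w ^+ 3.
    have -> : 1 / w ^+ 3 = w ^+ 6 / w ^+ 9 by field; rewrite gt_eqF.
    rewrite ler_pM2r //; apply: le_trans Om2 (le_trans wOm _).
    by rewrite -{1}[w]expr1 ler_weXn2l.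
  have h3 : c / 2 / (n%:R ^+ 2 * z ^+ 3) <= 1 / w ^+ 3.
    have -> : c / 2 / (n%:R ^+ 2 * z ^+ 3) = c / 2 / (w ^+ 2 * (z * w) ^+ 3) / w ^+ 3.
      by rewrite wN; field; rewrite !gt_eqF.
    rewrite ler_pM2r // ler_pdivrMr; last by rewrite mulr_gt0 // exprn_gt0 // mulr_gt0.
    have e1 : 1 <= w ^+ 2 * (z * w) ^+ 3.
      by rewrite mulr_ege1 // exprn_ege1.
    by rewrite mul1r; apply: le_trans e1; move: c_le1; clear; lra.
  by move: pen H h1 h2 h3; rewrite mulrDl; clear; lra.
apply: le_trans main _; rewrite /pairF -/V -/z -/w -/Qx -/Qy.
set F := z + g * w * (Qx ^+ 2 + Qy ^+ 2).
have F0 : z <= F.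
  by rewrite lerDl mulr_ge0 ?addr_ge0 ?sqr_ge0 // mulr_ge0 // ltW.
have F_gt0 : 0 < F by apply: lt_le_trans F0.
have h1 : c / 2 / (n%:R ^+ 2 * F ^+ 3) <= c / 2 / (n%:R ^+ 2 * z ^+ 3).
  rewrite ler_pM2l ?divr_gt0 // lef_pV2 ?posrE ?mulr_gt0 ?exprn_gt0 //.
  rewrite ler_pM2l ?exprn_gt0 //; apply: lerXn2r; rewrite ?nnegrE //; exact: ltW.
have h2 : F - c / 2 / (n%:R ^+ 2 * F ^+ 3) <= (1 + b) * F - d.
  rewrite -subr_ge0.
  have -> : (1 + b) * F - d - (F - c / 2 / (n%:R ^+ 2 * F ^+ 3)) =
    c / 2 * (F - kappa) ^+ 2 * (kappa ^+ 2 + 2 * kappa * F + 3 * F ^+ 2) /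
      (n%:R ^+ 2 * F ^+ 3 * kappa ^+ 4).
    by rewrite /b /d; field; rewrite !gt_eqF.
  apply: divr_ge0; last by rewrite ltW // !mulr_gt0 // exprn_gt0.
  have e1 : 0 <= 2 * kappa * F by rewrite ltW // mulr_gt0 // mulr_gt0.
  have e2 := mulr_ge0 (ler0n R 3) (sqr_ge0 F).
  have c2 : 0 <= c / 2 by rewrite divr_ge0 // ltW.
  exact: mulr_ge0 (mulr_ge0 c2 (sqr_ge0 _)) (addr_ge0 (addr_ge0 (sqr_ge0 _) e1) e2).
by move: h1 h2; clear; lra.
Qed.

(** * The upper bound *)

Lemma natr_approx (R : realType) (x : R) : 0 <= x -> exists T : nat, x <= T%:R <= x + 1.
Proof.
move=> x0; exists (Num.truncn x).+1; have /andP[h1 h2] := truncn_itv x0.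
by rewrite (ltW h2) -natr1 lerD2r.
Qed.

(** From [(1 - u)^t <= exp (- u t)] and [x^2 <= 2 exp x]. Quadratic decay is enough for the
    transpositions, where [u t] is a large multiple of [sqrt n] and an error below a multiple of
    [1/n] is wanted. *)
Lemma expr_sub1_le (R : realType) (u : R) (t : nat) : 0 <= u -> u <= 1 ->
  (1 - u) ^+ t * (u * t%:R) ^+ 2 <= 2.
Proof.
move=> u0 u1; have ut : 0 <= u * t%:R by rewrite mulr_ge0.
have h1 : (1 - u) ^+ t <= expR (- (u * t%:R)).
  rewrite -mulNr expRM_natr; apply: lerXn2r; rewrite ?nnegrE ?expR_ge0 ?subr_ge0 //.
  exact: expR_ge1Dx.
have h2 : (u * t%:R) ^+ 2 <= 2 * expR (u * t%:R).
  have := expR_ge1Dxn 1 ut; rewrite (_ : 2`!%:R = 2 :> R) //.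
  by move=> h; lra.
apply: le_trans (ler_pM (exprn_ge0 _ _) (sqr_ge0 _) h1 h2) _; first by rewrite subr_ge0.
by rewrite mulrCA -expRD addNr expR0 mulr1.
Qed.

Section MeanBound.
Variables (R : realType) (m n : nat) (k : 'M[R]_m) (blk : 'I_n -> 'I_m) (beta : R).
Hypothesis n_gt0 : (0 < n)%N.

(** The copies need not be run jointly: the hypothesis is averaged over [u] with [u'] fixed, then
    over [u']. *)
Lemma iter_step_diff_le t (h q : state n -> R) e :
  (forall u u', h u - h u' <= e + q u + q u') -> forall x y,
  iter t (step k blk beta) h x - iter t (step k blk beta) h y <=
    e + iter t (step k blk beta) q x + iter t (step k blk beta) q y.
Proof.
move=> H x y.
have h1 u' : iter t (step k blk beta) h x <= e + q u' + h u' + iter t (step k blk beta) q x.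
  rewrite -[iter t _ q x]mul1r -iter_step_affine //; apply: iter_step_le => // u.
  by have := H u u'; lra.
set E := iter t (step k blk beta) h x in h1 *; set Eq := iter t (step k blk beta) q x in h1 *.
have : iter t (step k blk beta) (fun u => (E - e - Eq) + (-1) * q u) y <= iter t (step k blk beta) h y.
  by apply: iter_step_le => // u; have := h1 u; lra.
by rewrite iter_step_affine //; lra.
Qed.

End MeanBound.

Section UpperBound.
Variables (R : realType) (m : nat) (p a : 'I_m -> R) (k : 'M[R]_m) (beta : R).
Hypothesis cm : critical_model p a k beta.
Local Notation cK := (\sum_i \sum_j k i j).
Local Notation r0 := ((1 - tanhR (beta * cK)) / 2).

Let r0_gt0 : 0 < r0.
Proof. by rewrite divr_gt0 // subr_gt0 tanhR_lt1. Qed.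

Let r0_le1 : r0 <= 1.
Proof.
have h : 0 <= beta * cK by rewrite mulr_ge0 // ltW ?(cm_beta cm) ?(cK_gt0 cm).
by have := tanhR_ge0 h; lra.
Qed.

Local Ltac only_section := clear - R m p a k beta cm r0_gt0 r0_le1.

(** The comparison of [x] with the rearranged [y'] and that of [y'] with [y] run over the same [T]
    steps, so rearranging costs no extra time. In [L] the first term serves the vertexwise coupling
    and the second makes the error of [n] transpositions at most [delta / 2]. *)
Lemma close_near_diagonal B A delta : 0 < B -> 0 < A -> 0 < delta -> exists2 L, 0 < L &
  forall (n : nat) (blk : 'I_n -> 'I_m), (0 < n)%N -> blocks p blk ->
  forall T, L * Num.sqrt (n%:R : R) ^+ 3 <= T%:R -> forall x y,
  n%:R * pairV a k blk B x y <= A -> close k blk beta T delta x y.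
Proof.
move=> B0 A0 delta0.
have [c c0 Hham] := close_hamming cm.
have [Ck Ck0 Hco] := kform_coercive (cm_pd cm).
pose D1 := Ck * A / B + 1.
have D10 : 0 < D1 by rewrite addr_gt0 // divr_gt0 // mulr_gt0.
pose K3 := 2 * D1 / delta.
have K30 : 0 < K3 by rewrite divr_gt0 // mulr_gt0.
pose L := K3 ^+ 2 / c + (1 + 8 / delta) / r0.
have d8 : 0 < 8 / delta by rewrite divr_gt0.
have L1 : K3 ^+ 2 / c <= L by rewrite lerDl divr_ge0 ?(ltW r0_gt0) // ltW // addr_gt0.
have L2 : (1 + 8 / delta) / r0 <= L by rewrite lerDr divr_ge0 ?exprn_ge0 // ltW.
have L0 : 0 < L by apply: lt_le_trans L2; rewrite divr_gt0 // addr_gt0.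
exists L => // n blk n_gt0 bp T HT x y HV.
have N0 : 0 < n%:R :> R by rewrite ltr0n.
set s := Num.sqrt n%:R in HT *.
have s0 : 0 < s by rewrite sqrtr_gt0.
have sN : n%:R = s ^+ 2 by rewrite sqr_sqrtr // ltW.
pose w := Num.sqrt s.
have w0 : 0 < w by rewrite sqrtr_gt0.
have ws : s = w ^+ 2 by rewrite sqr_sqrtr // ltW.
have s3 : 0 < s ^+ 3 by rewrite exprn_gt0.
pose e := (1 - r0 / n%:R) ^+ T.
have e0 : 0 <= e.
  rewrite exprn_ge0 // subr_ge0 ler_pdivrMr // mul1r; apply: le_trans r0_le1 _.
  by rewrite ler1n.
have He v u z : blk v = blk u -> close k blk beta T e z (swap v u z).
  by move=> vu; apply: close_swap => //; [exact: ltW (cm_beta cm) | exact: (cm_k cm)].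
have eN : e * n%:R <= delta / 2.
  have u0 : 0 <= r0 / n%:R by rewrite divr_ge0 // ltW.
  have u1 : r0 / n%:R <= 1.
    by rewrite ler_pdivrMr // mul1r; apply: le_trans r0_le1 _; rewrite ler1n.
  have := expr_sub1_le T u0 u1; rewrite -/e => h.
  have h2 : (1 + 8 / delta) * s <= r0 / n%:R * T%:R.
    have : (1 + 8 / delta) / r0 * s ^+ 3 <= T%:R by apply: le_trans HT; rewrite ler_pM2r.
    have rn : 0 < r0 / n%:R by rewrite divr_gt0.
    rewrite -(ler_pM2l rn); apply: le_trans; rewrite le_eqVlt; apply/orP; left; apply/eqP.
    by rewrite sN; move: r0_gt0; set r := r0 => r_gt0; field; rewrite !gt_eqF.
  have h3 : 4 / delta * n%:R <= (r0 / n%:R * T%:R) ^+ 2.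
    apply: (@le_trans _ _ (((1 + 8 / delta) * s) ^+ 2)).
      rewrite exprMn -sN ler_pM2r //.
      have -> : 4 / delta = 8 / delta / 2 by field; rewrite gt_eqF.
      by move: d8; set z := 8 / delta; only_section => z0; nra.
    have a1 : 0 <= (1 + 8 / delta) * s by rewrite ltW // mulr_gt0 // addr_gt0.
    by apply: lerXn2r; rewrite ?nnegrE //; exact: le_trans a1 h2.
  have := ler_wpM2l e0 h3 => h4.
  have h5 : e * (4 / delta * n%:R) <= 2 by apply: le_trans h4 h.
  have := ler_wpM2l (ltW delta0) h5.
  have -> : delta * (e * (4 / delta * n%:R)) = 4 * (e * n%:R) by field; rewrite gt_eqF.
  by only_section; lra.
have [y' [My al c1 c2]] := close_matching e0 He x y.
have hamle : hamming a blk x y' <= D1 * s.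
  have Dle i : `|magn R blk x i - magn R blk y' i| <= D1 / s.
    rewrite My -(ler_pXn2r (n := 2)) ?nnegrE ?divr_ge0 ?(ltW D10) ?(ltW s0) //.
    rewrite real_normK ?num_real // expr_div_n -sN ler_pdivlMr //.
    have h1 : (magn R blk x i - magn R blk y i) ^+ 2 <= Ck * kform k (mdiff R blk x y) (mdiff R blk x y).
      apply: le_trans (Hco _); rewrite /mdiff.
      exact: (ler_sum_term (f := fun i => (magn R blk x i - magn R blk y i) ^+ 2) i (fun i => sqr_ge0 _)).
    have h2 : B * kform k (mdiff R blk x y) (mdiff R blk x y) <= pairV a k blk B x y.
      by rewrite /pairV /vform lerDr sqr_ge0.
    have h3 : Ck * (B * kform k (mdiff R blk x y) (mdiff R blk x y)) * n%:R <= Ck * A.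
      by rewrite -mulrA ler_pM2l // mulrC; apply: le_trans HV; rewrite ler_pM2l.
    apply: (@le_trans _ _ (Ck * A / B)).
      rewrite ler_pdivlMr //; apply: le_trans h3.
      have -> : Ck * (B * kform k (mdiff R blk x y) (mdiff R blk x y)) * n%:R =
        Ck * kform k (mdiff R blk x y) (mdiff R blk x y) * n%:R * B by ring.
      by rewrite ler_pM2r // ler_pM2r.
    rewrite /D1; set z := Ck * A / B; have : 0 <= z by rewrite divr_ge0 ?mulr_ge0 // ltW.
    by only_section; nra.
  rewrite /hamming (partition_big blk xpredT) //=.
  apply: (@le_trans _ _ (\sum_i a i * (D1 * s))); last first.
    by rewrite -mulr_suml (cm_a1 cm) mul1r.
  apply: ler_sum => i _.
  have -> : \sum_(v | blk v == i) a (blk v) * (x v != y' v)%:R =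
     a i * \sum_(v | blk v == i) (x v != y' v)%:R.
    by rewrite mulr_sumr; apply: eq_bigr => v /eqP ->.
  apply: ler_wpM2l; first exact: ltW (cm_a cm i).
  apply: le_trans (aligned_disagreements R n_gt0 i al) _.
  apply: (@le_trans _ _ (n%:R / 2 * (D1 / s))).
    by apply: ler_wpM2l; [rewrite divr_ge0 // ltW | exact: Dle].
  have -> : n%:R / 2 * (D1 / s) = D1 * s / 2 by rewrite sN; field; rewrite gt_eqF.
  by rewrite ler_pdivrMr // ler_peMr ?mulr_ge0 ?(ltW D10) ?(ltW s0) // ler1n.
have kap0 : 0 < K3 * w by rewrite mulr_gt0.
have Hkap : n%:R * (K3 * w) ^+ 2 <= c * T%:R.
  have -> : n%:R * (K3 * w) ^+ 2 = c * (K3 ^+ 2 / c * s ^+ 3).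
    by rewrite sN ws; field; rewrite gt_eqF.
  by rewrite ler_pM2l //; apply: le_trans HT; rewrite ler_pM2r.
have c3 := Hham n blk n_gt0 bp (K3 * w) T x y' kap0 Hkap.
have c3' : Num.sqrt (hamming a blk x y') / (K3 * w) <= delta / 2.
  rewrite ler_pdivrMr //.
  have -> : delta / 2 * (K3 * w) = D1 * w by rewrite /K3; field; rewrite gt_eqF.
  have D11 : 1 <= D1 by rewrite lerDr divr_ge0 ?mulr_ge0 // ltW.
  rewrite -[D1 * w]ger0_norm ?mulr_ge0 ?(ltW D10) ?(ltW w0) // -sqrtr_sqr ler_wsqrtr //.
  apply: le_trans hamle _; rewrite exprMn -ws ler_pM2r // expr2 ler_peMl //.
  exact: ltW.
apply: close_weaken (close_trans (close_weaken c3' c3) (close_weaken eN c1)).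
by only_section; lra.
Qed.

Lemma adot_sqr_le : exists2 C, 0 < C & forall d, adot a d ^+ 2 <= C * kform k d d.
Proof.
have [C C0 Hco] := kform_coercive (cm_pd cm); exists C => // d.
apply: le_trans (Hco d); have S0 : 0 <= \sum_i d i ^+ 2 by apply: sumr_ge0 => i _; exact: sqr_ge0.
have : `|adot a d| <= Num.sqrt (\sum_i d i ^+ 2).
  apply: (adot_le cm) => i; rewrite -sqrtr_sqr ler_wsqrtr //.
  exact: (ler_sum_term (f := fun i => d i ^+ 2) i (fun i => sqr_ge0 _)).
rewrite -(ler_pXn2r (n := 2)) ?nnegrE ?sqrtr_ge0 // real_normK ?num_real //.
by rewrite sqr_sqrtr.
Qed.

Lemma pairV_energy B : 0 < B -> exists2 C, 0 < C &
  forall (n : nat) (blk : 'I_n -> 'I_m) x y,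
  pairV a k blk B x y <= C * (energy k blk x + energy k blk y).
Proof.
move=> B0; have [C C0 HC] := adot_sqr_le.
exists (2 * (C + B)); first by rewrite mulr_gt0 // addr_gt0.
move=> n blk x y; set d := mdiff R blk x y.
have h1 := HC d.
have h3 : kform k d d <= 2 * energy k blk x + 2 * energy k blk y by exact: (kform_mdiff_le cm).
have h4 := ler_wpM2l (ltW C0) h3; have h5 := ler_wpM2l (ltW B0) h3.
by rewrite /pairV /vform -/d; move: h1 h4 h5; only_section; lra.
Qed.

Lemma upper_bound : exists2 C, 0 < C & forall (n : nat) (blk : 'I_n -> 'I_m),
  (0 < n)%N -> blocks p blk ->
  exists2 t, t%:R <= C * Num.sqrt (n%:R : R) ^+ 3 & dist_mix k blk beta t <= 4^-1.
Proof.
have [B [A [g [c [B0 A0 g0 c0 Hpair]]]]] := close_pair cm.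
have [Ae Ae0 Hdecay] := iter_energy_decay cm.
have d16 : 0 < 16^-1 :> R by rewrite invr_gt0.
have [L L0 Hnear] := close_near_diagonal B0 A0 d16.
have [Cv Cv0 HV] := pairV_energy B0.
(* With mean energies at most [2 Ae / s], each weighted energy contributes [1/32] on average;
   together with [1/8] from the coupling this stays below [1/4]. *)
pose A1 := 64 * Ae; have A10 : 0 < A1 by rewrite mulr_gt0.
pose CF := 2 * Cv * A1 + 1 + 2 * g * A1 ^+ 2.
have CF0 : 0 < CF by rewrite !addr_gt0 // !mulr_gt0 ?exprn_gt0.
(* For [kappa = 24 CF / n^{1/8}] the time [n^2 kappa^4] is [G4 n^{3/2}], and the coupling error
   [3 F / (2 kappa)] is at most [1/16] when [F <= CF / n^{1/8}]. *)
have [G4 [G40 G4E]] : exists G4, 0 < G4 /\ G4 = (24 * CF) ^+ 4.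
  by exists ((24 * CF) ^+ 4); split; rewrite // exprn_gt0 // mulr_gt0.
have Gc : 0 < G4 / c by rewrite divr_gt0.
exists (3 + L + G4 / c); first by rewrite !addr_gt0.
move=> n blk n_gt0 bp.
have N0 : 0 < n%:R :> R by rewrite ltr0n.
have N1 : 1 <= n%:R :> R by rewrite ler1n.
set s : R := Num.sqrt n%:R; pose w := Num.sqrt s; pose o := Num.sqrt w.
have s0 : 0 < s by rewrite sqrtr_gt0.
have w0 : 0 < w by rewrite sqrtr_gt0.
have o0 : 0 < o by rewrite sqrtr_gt0.
have sN : n%:R = s ^+ 2 by rewrite sqr_sqrtr // ltW.
have ws : s = w ^+ 2 by rewrite sqr_sqrtr // ltW.
have ow : w = o ^+ 2 by rewrite sqr_sqrtr // ltW.
have s1 : 1 <= s by rewrite -(ler_pXn2r (n := 2)) ?nnegrE ?(ltW s0) // -sN expr1n.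
have o1 : 1 <= o.
  by rewrite -(ler_pXn2r (n := 4)) ?nnegrE ?(ltW o0) // expr1n (exprM _ 2 2) -ow -ws.
have s31 : 1 <= s ^+ 3 by rewrite exprn_ege1.
have s30 : 0 < s ^+ 3 by rewrite exprn_gt0.
have [T0 /andP[T01 T02]] := natr_approx (mulr_ge0 (ltW L0) (ltW s30)).
have [T2 /andP[T21 T22]] := natr_approx (mulr_ge0 (ltW Gc) (ltW s30)).
have /andP[T11 T12] := truncn_itv (ltW s30).
(* Rounding down keeps [T1^2 <= n^3], as [iter_energy_decay] requires at time [T1 - 1]. *)
set T1 := Num.truncn (s ^+ 3) in T11 T12.
have T1_gt0 : (0 < T1)%N by rewrite lt0n; apply/eqP => e; move: T12; rewrite e ltNge s31.
pose t1 := T1.-1; have t1E : t1.+1 = T1 by rewrite prednK.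
have T1half : s ^+ 3 / 2 <= T1%:R.
  have : 1 <= T1%:R :> R by rewrite ler1n.
  by move: T12; rewrite -natr1; only_section; lra.
exists (t1 + (T0 + T2))%N.
  have h1 : t1%:R <= s ^+ 3 by apply: le_trans T11; rewrite ler_nat -t1E.
  by rewrite !natrD; move: h1 T02 T22 s31; only_section; lra.
apply: dist_mix_le => //; first exact: (posdef_sym (cm_pd cm)).
move=> x y f f01.
rewrite !(iterD t1); set h := iter (T0 + T2) _ f.
have h01 u : 0 <= h u <= 1 by exact: iter_step01.
have decay z : iter t1 (step k blk beta) (energy k blk) z <= 2 * Ae / s.
  apply: le_trans (Hdecay n blk n_gt0 bp t1 z _) _.
    rewrite t1E -(ler_nat R) !natrX sN -exprM -[leRHS]/(s ^+ (3 * 2)) exprM.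
    by apply: lerXn2r; rewrite ?nnegrE // ltW.
  have T1p : 0 < T1%:R :> R by rewrite ltr0n.
  rewrite t1E ler_pdivrMr //.
  apply: (@le_trans _ _ (2 * Ae / s * (s ^+ 3 / 2))).
    by rewrite sN le_eqVlt; apply/orP; left; apply/eqP; field; rewrite gt_eqF.
  by rewrite ler_pM2l // divr_gt0 // mulr_gt0.
(* Markov's inequality without events: if an energy exceeds [A1 / s] the right-hand side exceeds 1,
   and otherwise the coupling of pairs applies. *)
have Hdiff u u' : h u - h u' <= 8^-1 + (0 + s / A1 * energy k blk u) + (0 + s / A1 * energy k blk u').
  have sA : 0 < s / A1 by rewrite divr_gt0.
  have Qu : 0 <= s / A1 * energy k blk u by rewrite mulr_ge0 ?(ltW sA) // (energy_ge0 cm).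
  have Qu' : 0 <= s / A1 * energy k blk u' by rewrite mulr_ge0 ?(ltW sA) // (energy_ge0 cm).
  have /andP[hu0 hu1] := h01 u; have /andP[hu'0 hu'1] := h01 u'.
  have [b1|b1] := ltP 1 (s / A1 * energy k blk u); first by move: hu1 hu'0 b1 Qu'; only_section; lra.
  have [b2|b2] := ltP 1 (s / A1 * energy k blk u'); first by move: hu1 hu'0 b2 Qu; only_section; lra.
  have kap0 : 0 < 24 * CF / o by rewrite divr_gt0 // mulr_gt0.
  have Hk : n%:R ^+ 2 * (24 * CF / o) ^+ 4 <= c * T2%:R.
    have -> : n%:R ^+ 2 * (24 * CF / o) ^+ 4 = c * (G4 / c * s ^+ 3).
      by rewrite sN ws ow G4E; field; rewrite !gt_eqF.
    by rewrite ler_pM2l.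
  have T0s := Hnear n blk n_gt0 bp T0 T01.
  have := Hpair n blk n_gt0 bp T0 T2 _ _ (ltW d16) kap0 Hk T0s u u' _ f01.
  rewrite -/h => H.
  have q1 : energy k blk u <= A1 / s.
    by rewrite ler_pdivlMr // -[leRHS]mul1r mulrC -ler_pdivrMr // mulrAC.
  have q2 : energy k blk u' <= A1 / s.
    by rewrite ler_pdivlMr // -[leRHS]mul1r mulrC -ler_pdivrMr // mulrAC.
  have V1 : pairV a k blk B u u' <= 2 * Cv * A1 / s.
    apply: le_trans (HV n blk u u') _.
    have -> : 2 * Cv * A1 / s = Cv * (A1 / s + A1 / s) by ring.
    by rewrite ler_pM2l // lerD.
  have CvA : 0 < 2 * Cv * A1 by rewrite !mulr_gt0.
  have z1 : qrt (pairV a k blk B u u') <= (2 * Cv * A1 + 1) / o.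
    apply: qrt_le; first by rewrite divr_ge0 ?(ltW o0) // addr_ge0 // ltW.
      by apply: (pairV_ge0 cm); exact: ltW.
    apply: le_trans V1 _; rewrite expr_div_n (exprM o 2 2) -ow -ws ler_pM2r ?invr_gt0 //.
    apply: (@le_trans _ _ (2 * Cv * A1 + 1)); first by rewrite lerDl.
    by rewrite -{1}[2 * Cv * A1 + 1]expr1 ler_weXn2l // lerDr ltW.
  have z2 : g * qrt n%:R * (energy k blk u ^+ 2 + energy k blk u' ^+ 2) <= 2 * g * A1 ^+ 2 / o.
    have e1 v : energy k blk v <= A1 / s -> energy k blk v ^+ 2 <= (A1 / s) ^+ 2.
      by move=> ev; apply: lerXn2r; rewrite ?nnegrE ?(energy_ge0 cm) // divr_ge0 // ltW.
    apply: (@le_trans _ _ (g * w * ((A1 / s) ^+ 2 + (A1 / s) ^+ 2))).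
      by rewrite ler_pM2l ?mulr_gt0 //; apply: lerD; exact: e1.
    have -> : g * w * ((A1 / s) ^+ 2 + (A1 / s) ^+ 2) = 2 * g * A1 ^+ 2 / o ^+ 6.
      by rewrite ws ow; field; rewrite gt_eqF.
    rewrite ler_pM2l; last by rewrite !mulr_gt0 // exprn_gt0.
    rewrite lef_pV2 ?posrE ?exprn_gt0 //.
    by rewrite -[leLHS]expr1 ler_weXn2l.
  have F1 : 3 / (2 * (24 * CF / o)) * pairF a k blk B (g * qrt n%:R) u u' <= 16^-1.
    have F0 : pairF a k blk B (g * qrt n%:R) u u' <= CF / o.
      by rewrite /pairF /CF [leRHS]mulrDl; exact: lerD.
    have k2 : 0 < 3 / (2 * (24 * CF / o)) by rewrite divr_gt0 // mulr_gt0.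
    apply: le_trans (ler_wpM2l (ltW k2) F0) _.
    by rewrite le_eqVlt; apply/orP; left; apply/eqP; field; rewrite !gt_eqF.
  by move: H F1 Qu Qu'; only_section; lra.
apply: le_trans (iter_step_diff_le k blk beta n_gt0 t1 (q := fun u => 0 + s / A1 * energy k blk u) Hdiff x y) _.
rewrite !iter_step_affine //.
have small z : s / A1 * iter t1 (step k blk beta) (energy k blk) z <= 32^-1.
  have sA : 0 < s / A1 by rewrite divr_gt0.
  apply: le_trans (ler_wpM2l (ltW sA) (decay z)) _.
  by rewrite le_eqVlt /A1; apply/orP; left; apply/eqP; field; rewrite !gt_eqF.
by have := small x; have := small y; only_section; lra.
Qed.

End UpperBound.

(** * The lower bound *)

Section Huber.
Variable R : realType.
Implicit Types e x u : R.

(** The pseudo-Huber function, convex and within [e] of [|x|], with its curvature concentrated where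
    [|x|] is of order [e]. *)
Definition huber e x : R := Num.sqrt (x ^+ 2 + e ^+ 2).

Lemma huber_sqr e x : huber e x ^+ 2 = x ^+ 2 + e ^+ 2.
Proof. by rewrite sqr_sqrtr // addr_ge0 ?sqr_ge0. Qed.

Lemma huber_gt0 e x : 0 < e -> 0 < huber e x.
Proof. by move=> e0; rewrite sqrtr_gt0 ltr_wpDl ?sqr_ge0 ?exprn_gt0. Qed.

Lemma normr_le_huber e x : `|x| <= huber e x.
Proof. by rewrite -sqrtr_sqr ler_wsqrtr // lerDl sqr_ge0. Qed.

Lemma huber_le e x : 0 <= e -> huber e x <= `|x| + e.
Proof.
move=> e0; rewrite -[leRHS]ger0_norm ?addr_ge0 // -sqrtr_sqr ler_wsqrtr //.
by rewrite sqrrD real_normK ?num_real // lerD2r lerDl mulrn_wge0 // mulr_ge0.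
Qed.

(* With [P = huber x * huber (x + u)] and [S = e^2 + x (x + u)] one has [P^2 - S^2 = e^2 u^2],
   and the claim is [(P - S)^2 >= 0]. *)
Lemma huber_convex e x u : 0 < e ->
  x / huber e x * u + e ^+ 2 * u ^+ 2 / (2 * huber e x ^+ 2 * huber e (x + u)) <=
  huber e (x + u) - huber e x.
Proof.
move=> e0; have p0 := huber_gt0 x e0; have q0 := huber_gt0 (x + u) e0.
have ps := huber_sqr e x; have qs := huber_sqr e (x + u).
move: p0 q0 ps qs; set P := huber e x; set q := huber e (x + u) => p0 q0 ps qs.
rewrite -subr_ge0.
have -> : q - P - (x / P * u + e ^+ 2 * u ^+ 2 / (2 * P ^+ 2 * q)) =
   (2 * P ^+ 2 * q ^+ 2 - 2 * P * q * (P ^+ 2 + x * u) - e ^+ 2 * u ^+ 2) / (2 * P ^+ 2 * q).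
  by field; rewrite !gt_eqF.
apply: divr_ge0; last by rewrite ltW // !mulr_gt0 // exprn_gt0.
have -> : 2 * P ^+ 2 * q ^+ 2 - 2 * P * q * (P ^+ 2 + x * u) - e ^+ 2 * u ^+ 2 =
   (P * q - (P ^+ 2 + x * u)) ^+ 2.
  have -> : 2 * P ^+ 2 * q ^+ 2 - 2 * P * q * (P ^+ 2 + x * u) - e ^+ 2 * u ^+ 2 =
    (P * q - (P ^+ 2 + x * u)) ^+ 2 + (P ^+ 2 * q ^+ 2 - (P ^+ 2 + x * u) ^+ 2 - e ^+ 2 * u ^+ 2) by ring.
  by rewrite ps qs; ring.
exact: sqr_ge0.
Qed.

(** Inside the window [huber e x] is of order [e]; the endpoint may leave the window by one jump,
    which costs [e + d] instead of [e]. *)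
Lemma huber_convex_near e x u d : 0 < e -> 0 < d -> `|x| <= e -> `|u| <= 2 * d ->
  x / huber e x * u + u ^+ 2 / (8 * (e + d)) <= huber e (x + u) - huber e x.
Proof.
move=> e0 d0 xe ud; apply: le_trans (huber_convex x u e0); rewrite lerD2l.
have p0 := huber_gt0 x e0; have q0 := huber_gt0 (x + u) e0.
have p2 : huber e x ^+ 2 <= 2 * e ^+ 2.
  rewrite huber_sqr -[x ^+ 2]real_normK ?num_real //.
  by have : 0 <= `|x| by []; nra.
have q2 : huber e (x + u) <= 2 * (e + d).
  by apply: le_trans (huber_le _ (ltW e0)) _; have := ler_normD x u; lra.
have e2 : 0 < e ^+ 2 by rewrite exprn_gt0.
have ed : 0 < 8 * (e + d) by rewrite mulr_gt0 // addr_gt0.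
have -> : u ^+ 2 / (8 * (e + d)) = e ^+ 2 * u ^+ 2 / (2 * (2 * e ^+ 2) * (2 * (e + d))).
  by field; rewrite !gt_eqF // addr_gt0.
apply: ler_wpM2l; first by rewrite mulr_ge0 ?sqr_ge0.
have p20 : 0 < huber e x ^+ 2 by rewrite exprn_gt0.
rewrite lef_pV2 ?posrE; [|by rewrite !mulr_gt0 // addr_gt0|by rewrite !mulr_gt0].
apply: ler_pM; [by rewrite mulr_ge0 // ltW | exact: ltW | by rewrite ler_pM2l | by []].
Qed.

End Huber.

Section LowerBound.
Variables (R : realType) (m : nat) (p a : 'I_m -> R) (k : 'M[R]_m) (beta : R).
Hypothesis cm : critical_model p a k beta.
Local Notation cK := (\sum_i \sum_j k i j).

Let k_gt0 := cm_k cm.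
Let kpd := cm_pd cm.
Let ksym := posdef_sym kpd.
Let a_gt0 := cm_a cm.
Let p_gt0 := cm_p cm.
Let beta_gt0 := cm_beta cm.

(** Two distinct states cannot both have Gibbs mass above [1/2]. This settles the small [n] in the
    lower bound. *)
Lemma dist_mix0 (n : nat) (blk : 'I_n -> 'I_m) : (0 < n)%N -> 2^-1 <= dist_mix k blk beta 0.
Proof.
move=> n_gt0; pose x : state n := [ffun=> true]; pose y : state n := [ffun=> false].
have xy : y != x by apply/eqP => /ffunP /(_ (Ordinal n_gt0)); rewrite !ffunE.
have dist z : 1 - gibbs k blk beta z <= dist_mix k blk beta 0.
  have := dist_mix_ge k blk beta n_gt0 0 (f := fun u => 1 - (u == z)%:R) z.
  rewrite /= eqxx subrr subr0 => H; apply: le_trans (H _); last first.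
    by move=> u; case: eqP => _; rewrite ?subrr ?subr0 lexx ler01.
  under eq_bigr => u _ do rewrite mulrBr mulr1.
  rewrite sumrB gibbs_sum1 (bigD1 z) //= eqxx mulr1 big1 ?addr0 // => u /negbTE ->.
  by rewrite mulr0.
have := gibbs_sum1 k blk beta; rewrite (bigD1 x) //= (bigD1 y) //= => H.
have rest : 0 <= \sum_(u | (u != x) && (u != y)) gibbs k blk beta u.
  by apply: sumr_ge0 => u _; exact: gibbs_ge0.
by have := dist x; have := dist y; move: H rest; lra.
Qed.

Section Size.
Variables (n : nat) (blk : 'I_n -> 'I_m).
Hypotheses (n_gt0 : (0 < n)%N) (bp : blocks p blk).
Local Notation N := (n%:R : R).
Local Notation Q := (energy k blk).
Implicit Types (x y : state n).

Let N_gt0 : 0 < N. Proof. by rewrite ltr0n. Qed.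

Definition crit x : R := adot a (magn R blk x).

Lemma crit_upd x c : crit (upd x c.1 c.2) = crit x + adot a (incr R blk x c).
Proof. by rewrite /crit magn_upd // adotD. Qed.

(* A spin flip moves the energy by [- 4 s_v h_v / n + O(1/n^2)]; summing over [v]
   shows that a state of minimal energy has energy [O(1/n)]. *)
Lemma low_energy_state : exists x, Q x <= cK / N.
Proof.
pose x0 : state n := [ffun=> true].
have [x _ Hx] : exists2 x, true & forall y, Q x <= Q y.
  case: (@arg_minP _ _ _ x0 xpredT Q erefl) => x _ H; exists x => // y; exact: H.
exists x; pose c v := (v, ~~ x v).
have h v : 0 <= - (4 / N) * (spin (x v) * kfield k (magn R blk x) (blk v)) + 4 * cK / N ^+ 2.
  have := Hx (upd x v (~~ x v)); rewrite (energy_upd cm blk n_gt0 x (c v)) -addrA lerDl => H.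
  apply: le_trans H _; apply: lerD; last exact: (kform_incr_le cm).
  rewrite (kformC ksym) kformE (bigD1 (blk v)) //= big1 ?addr0.
    rewrite /incr /= eqxx le_eqVlt; apply/orP; left; apply/eqP.
    by case: (x v); rewrite /spin /=; field; rewrite gt_eqF.
  by move=> i; rewrite /incr /= eq_sym => /negbTE ->; rewrite mul0r.
have : 0 <= \sum_v (- (4 / N) * (spin (x v) * kfield k (magn R blk x) (blk v)) + 4 * cK / N ^+ 2).
  by apply: sumr_ge0 => v _; exact: h.
rewrite big_split /= -mulr_sumr sumr_const card_ord -[(4 * cK / N ^+ 2) *+ n]mulr_natr.
have -> : \sum_v spin (x v) * kfield k (magn R blk x) (blk v) = N * Q x.
  rewrite /energy kformE mulr_sumr (partition_big blk xpredT) //=; apply: eq_bigr => i _.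
  rewrite /magn mulrA mulrA mulfV ?gt_eqF // mul1r mulr_suml.
  by apply: eq_bigr => v /eqP ->.
have -> : - (4 / N) * (N * Q x) + 4 * cK / N ^+ 2 * N = 4 * (cK / N - Q x).
  by field; rewrite gt_eqF.
by rewrite pmulr_rge0 // subr_ge0.
Qed.

(** By [perron_field] the linear terms cancel exactly; the cubic defect of [tanhR] and the
    self-interaction remain. *)
Lemma crit_drift x : `|\sum_c wt k blk beta x c * adot a (incr R blk x c)| <=
  N^-1 * (\sum_i p i * `|beta * kfield k (magn R blk x) i| ^+ 3 + beta * cK / N).
Proof.
have [err [He Hd]] := drift_magn n_gt0 (ltW beta_gt0) k_gt0 bp x.
rewrite -adot_sumr /adot; under eq_bigr => i _ do rewrite Hd.
set h := kfield k (magn R blk x).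
have -> : \sum_i a i * (N^-1 * (- magn R blk x i + p i * tanhR (beta * h i) + err i)) =
    N^-1 * \sum_i (a i * p i * (tanhR (beta * h i) - beta * h i) + a i * err i).
  have E : \sum_i a i * magn R blk x i = \sum_i beta * (p i * a i * h i).
    rewrite -mulr_sumr (perron_field kpd (cm_eig cm)) mulrA mulfV ?mul1r //.
    by rewrite gt_eqF.
  transitivity (N^-1 * (\sum_i (a i * p i * tanhR (beta * h i) + a i * err i) -
      \sum_i a i * magn R blk x i)).
    by rewrite -sumrB mulr_sumr; apply: eq_bigr => i _; ring.
  by rewrite E -sumrB; congr (_ * _); apply: eq_bigr => i _; ring.
rewrite normrM gtr0_norm ?invr_gt0 // ler_pM2l ?invr_gt0 //.
apply: le_trans (ler_norm_sum _ _ _) _.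
have -> : beta * cK / N = \sum_i beta * cK / N * p i by rewrite -mulr_sumr (cm_p1 cm) mulr1.
rewrite -big_split; apply: ler_sum => i _ /=; apply: le_trans (ler_normD _ _) _.
have ai1 := a_le1 cm i; have ai0 := a_gt0 i.
apply: lerD.
  rewrite -mulrA normrM (gtr0_norm ai0) normrM (gtr0_norm (p_gt0 i)).
  rewrite -[leRHS]mul1r; apply: ler_pM => //; [exact: ltW | by rewrite mulr_ge0 // ltW | ].
  by apply: ler_wpM2l; [exact: ltW | rewrite distrC sub_tanhR_cubic].
rewrite normrM (gtr0_norm ai0).
apply: le_trans (ler_wpM2l (ltW ai0) (He i)) _.
have -> : beta * cK / N * p i = 1 * (beta * cK * p i / N) by ring.
apply: ler_wpM2r => //; rewrite divr_ge0 ?(ltW N_gt0) // mulr_ge0 ?(ltW (p_gt0 _)) //.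
by rewrite mulr_ge0 ?(ltW beta_gt0) // ltW // (cK_gt0 cm).
Qed.

Lemma iter_energy_le (C : R) : (forall y, step k blk beta Q y <= Q y + C) ->
  forall t x, iter t (step k blk beta) Q x <= Q x + C * t%:R.
Proof.
move=> H; elim=> [|t IH] x; first by rewrite mulr0 addr0.
rewrite iterSr; apply: le_trans (iter_step_le (g := fun y => C + 1 * Q y) k blk beta n_gt0 t x _) _.
  by move=> y; rewrite mul1r addrC.
by rewrite iter_step_affine // -natr1; have := IH x; lra.
Qed.

Lemma gibbs_step_sub f : \sum_s gibbs k blk beta s * (step k blk beta f s - f s) = 0.
Proof.
under eq_bigr => s _ do rewrite mulrBr.
by rewrite sumrB gibbs_step // subrr.
Qed.

End Size.
End LowerBound.

(** * Spread of the critical magnetization under the Gibbs measure *)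

Section GibbsSpread.
Variables (R : realType) (m : nat) (p a : 'I_m -> R) (k : 'M[R]_m) (beta : R).
Hypothesis cm : critical_model p a k beta.
Local Notation cK := (\sum_i \sum_j k i j).
Local Notation r0 := ((1 - tanhR (beta * cK)) / 2).

Let beta_gt0 := cm_beta cm.
Local Ltac only_section := clear - R m p a k beta cm beta_gt0.

(** The energy has mean increment zero under the Gibbs measure, so its quartic loss is balanced by
    the [C / n^2] of [step_energy_le]. *)
Lemma gibbs_field4 : exists2 C, 0 < C & forall (n : nat) (blk : 'I_n -> 'I_m),
  (0 < n)%N -> blocks p blk ->
  \sum_s gibbs k blk beta s * field4 p k blk s <= C / n%:R.
Proof.
have [c [C [c0 C0 H]]] := step_energy_le cm.
exists (C / c); first by rewrite divr_gt0.
move=> n blk n_gt0 bp; have N0 : 0 < n%:R :> R by rewrite ltr0n.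
have : 0 <= \sum_s gibbs k blk beta s * (C / n%:R ^+ 2 - c / n%:R * field4 p k blk s).
  rewrite -[leLHS](gibbs_step_sub cm blk n_gt0 (energy k blk)); apply: ler_sum => s _.
  apply: ler_wpM2l; first exact: gibbs_ge0.
  by have := H n blk n_gt0 bp s; only_section; lra.
under eq_bigr => s _ do rewrite mulrBr (mulrCA _ (c / n%:R)).
rewrite sumrB -mulr_suml gibbs_sum1 mul1r -mulr_sumr subr_ge0.
set S := \sum_s _ => h.
have cn : 0 < c / n%:R by rewrite divr_gt0.
rewrite -(ler_pM2l cn); apply: le_trans h _.
by rewrite le_eqVlt; apply/orP; left; apply/eqP; field; rewrite !gt_eqF.
Qed.

(** With [w = n^{1/4}] the cube is bounded by [y^3 <= w y^4 + w^-3]. Fourth moments being of order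
    [1/n], both terms are of order [n^{-3/4}], and the drift carries a further [1/n]. *)
Lemma gibbs_crit_drift : exists2 C, 0 < C & forall (n : nat) (blk : 'I_n -> 'I_m),
  (0 < n)%N -> blocks p blk ->
  \sum_s gibbs k blk beta s * `|\sum_c wt k blk beta s c * adot a (incr R blk s c)| <=
    C / qrt n%:R ^+ 7.
Proof.
have [C4 C40 H4] := gibbs_field4.
have K0 := cK_gt0 cm.
have bK : 0 < beta * cK by rewrite mulr_gt0.
have b3 : 0 < beta ^+ 3 by rewrite exprn_gt0.
exists (beta ^+ 3 * (C4 + 1) + beta * cK); first by rewrite addr_gt0 // mulr_gt0 // addr_gt0.
move=> n blk n_gt0 bp; have N0 : 0 < n%:R :> R by rewrite ltr0n.
have N1 : 1 <= n%:R :> R by rewrite ler1n.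
set w : R := qrt n%:R.
have w0 : 0 < w by exact: qrt_gt0.
have wN : n%:R = w ^+ 4 :> R by rewrite qrtK // ltW.
have w1 : 1 <= w by rewrite -(ler_pXn2r (n := 4)) ?nnegrE ?(ltW w0) // -wN expr1n.
have cube s : \sum_i p i * `|beta * kfield k (magn R blk s) i| ^+ 3 <=
    beta ^+ 3 * (w * field4 p k blk s + w ^- 3).
  have -> : beta ^+ 3 * (w * field4 p k blk s + w ^- 3) =
     \sum_i p i * (beta ^+ 3 * (w * kfield k (magn R blk s) i ^+ 4 + w ^- 3)).
    have -> : \sum_i p i * (beta ^+ 3 * (w * kfield k (magn R blk s) i ^+ 4 + w ^- 3)) =
       beta ^+ 3 * w * field4 p k blk s + beta ^+ 3 * w ^- 3 * \sum_i p i.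
      by rewrite /field4 !mulr_sumr -big_split; apply: eq_bigr => i _ /=; ring.
    by rewrite (cm_p1 cm); ring.
  apply: ler_sum => i _; apply: ler_wpM2l; first exact: ltW (cm_p cm i).
  rewrite normrM (gtr0_norm beta_gt0) exprMn ler_pM2l //.
  set h := kfield _ _ _; have -> : h ^+ 4 = `|h| ^+ 4.
    by rewrite !(exprM _ 2 2) real_normK ?num_real.
  move: (normr_ge0 h); set y := `|h| => y0.
  have w3 : 0 < w ^- 3 by rewrite invr_gt0 exprn_gt0.
  have -> : w * y ^+ 4 + w ^- 3 = ((w * y) ^+ 4 + 1) * w ^- 3 by field; rewrite gt_eqF.
  have -> : y ^+ 3 = (w * y) ^+ 3 * w ^- 3 by field; rewrite gt_eqF.
  rewrite ler_pM2r //; have [h1|h1] := leP 1 (w * y).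
    have : (w * y) ^+ 3 <= (w * y) ^+ 4 by rewrite ler_weXn2l.
    by only_section; lra.
  have : (w * y) ^+ 3 <= 1 by rewrite exprn_ile1 ?mulr_ge0 // ltW.
  have : 0 <= (w * y) ^+ 4 by rewrite exprn_ge0 // mulr_ge0 // ltW.
  by only_section; lra.
apply: (@le_trans _ _ (\sum_s gibbs k blk beta s *
    (n%:R^-1 * (beta ^+ 3 * (w * field4 p k blk s + w ^- 3) + beta * cK / n%:R)))).
  apply: ler_sum => s _; apply: ler_wpM2l; first exact: gibbs_ge0.
  apply: le_trans (crit_drift cm n_gt0 bp s) _.
  by rewrite ler_pM2l ?invr_gt0 // lerD2r.
have -> : \sum_s gibbs k blk beta s *
    (n%:R^-1 * (beta ^+ 3 * (w * field4 p k blk s + w ^- 3) + beta * cK / n%:R)) =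
  n%:R^-1 * beta ^+ 3 * w * (\sum_s gibbs k blk beta s * field4 p k blk s) +
  n%:R^-1 * (beta ^+ 3 * w ^- 3 + beta * cK / n%:R) * (\sum_s gibbs k blk beta s).
  by rewrite !mulr_sumr -big_split; apply: eq_bigr => s _ /=; ring.
rewrite gibbs_sum1 mulr1.
have f0 : 0 <= n%:R^-1 * beta ^+ 3 * w by rewrite ltW // !mulr_gt0 // invr_gt0.
apply: le_trans (lerD (ler_wpM2l f0 (H4 n blk n_gt0 bp)) (lexx _)) _.
rewrite [leRHS]mulrDl.
have -> : n%:R^-1 * beta ^+ 3 * w * (C4 / n%:R) +
     n%:R^-1 * (beta ^+ 3 * w ^- 3 + beta * cK / n%:R) =
  beta ^+ 3 * (C4 + 1) / w ^+ 7 + beta * cK / w ^+ 8 by rewrite wN; field; rewrite gt_eqF.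
by rewrite lerD2l ler_pM2l // lef_pV2 ?posrE ?exprn_gt0 // ler_weXn2l.
Qed.

(** On [|X| <= e] convexity gains at least a multiple of [n^{-2} / (e + 1/n)]. Stationarity forces
    the drift, of mean order [n^{-7/4}], to pay for it, and the quotient of the two is the bound.
    The summand [1/n] reflects the jump size. *)
Lemma gibbs_crit_small : exists2 C, 0 < C & forall (n : nat) (blk : 'I_n -> 'I_m),
  (0 < n)%N -> blocks p blk -> forall e : R, 0 < e ->
  \sum_s gibbs k blk beta s * (`|crit a blk s| <= e)%R%:R <= C * qrt (n%:R : R) * (e + n%:R^-1).
Proof.
have [Cd Cd0 Hd] := gibbs_crit_drift.
have [q q0 qa] := finite_pos_lb (cm_a cm).
have r0_gt0 : 0 < r0 by rewrite divr_gt0 // subr_gt0 tanhR_lt1.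
have [v0 [v00 v0E]] : exists v0, 0 < v0 /\ v0 = 4 * r0 * q ^+ 2.
  exists (4 * r0 * q ^+ 2); split; last by [].
  exact: (mulr_gt0 (mulr_gt0 (ltr0Sn _ _) r0_gt0) (exprn_gt0 _ q0)).
exists (8 * Cd / v0); first by rewrite divr_gt0 // mulr_gt0.
move=> n blk n_gt0 bp e e0; have N0 : 0 < n%:R :> R by rewrite ltr0n.
set w : R := qrt n%:R.
have w0 : 0 < w by exact: qrt_gt0.
have wN : n%:R = w ^+ 4 :> R by rewrite qrtK // ltW.
have d0 : 0 < n%:R^-1 :> R by rewrite invr_gt0.
pose phi s := huber e (crit a blk s).
pose V := v0 / n%:R ^+ 2 / (8 * (e + n%:R^-1)).
have V0 : 0 < V by rewrite divr_gt0 ?divr_gt0 ?exprn_gt0 // mulr_gt0 // addr_gt0.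
pose dr s := \sum_c wt k blk beta s c * adot a (incr R blk s c).
have key s : V * (`|crit a blk s| <= e)%R%:R - `|dr s| <= step k blk beta phi s - phi s.
  have H0 := huber_gt0 (crit a blk s) e0.
  set r := crit a blk s / phi s.
  have r1 : `|r| <= 1.
    by rewrite normrM normfV (gtr0_norm H0) ler_pdivrMr // mul1r normr_le_huber.
  have rd : - `|dr s| <= r * dr s.
    have : `|r * dr s| <= `|dr s| by rewrite normrM ler_piMl.
    by rewrite ler_norml => /andP[].
  have -> : step k blk beta phi s - phi s =
     \sum_c wt k blk beta s c * (huber e (crit a blk s + adot a (incr R blk s c)) - phi s).
    under [RHS]eq_bigr => c _ do rewrite mulrBr.
    rewrite sumrB wt_avg //; congr (_ - _); apply: eq_bigr => c _.
    by rewrite /phi (crit_upd a blk n_gt0).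
  have rdE : r * dr s = \sum_c wt k blk beta s c * (r * adot a (incr R blk s c)).
    by rewrite /dr mulr_sumr; apply: eq_bigr => c _; ring.
  have [small|big] := leP `|crit a blk s| e; last first.
    rewrite mulr0 sub0r; apply: le_trans rd _; rewrite rdE; apply: ler_sum => c _.
    apply: ler_wpM2l; first exact: wt_ge0.
    apply: le_trans (huber_convex _ _ e0); rewrite lerDl divr_ge0 //.
      by rewrite mulr_ge0 ?sqr_ge0.
    by rewrite ltW // !mulr_gt0 ?exprn_gt0 // huber_gt0.
  rewrite mulr1.
  have var : V <= \sum_c wt k blk beta s c * (adot a (incr R blk s c) ^+ 2 / (8 * (e + n%:R^-1))).
    have := adot_incr_sqr_ge cm blk n_gt0 s (ltW q0) qa; rewrite -v0E.
    have i0 : 0 <= (8 * (e + n%:R^-1))^-1 by rewrite ltW // invr_gt0 mulr_gt0 // addr_gt0.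
    move=> h; apply: le_trans (ler_wpM2r i0 h) _; rewrite mulr_suml.
    by apply: ler_sum => c _; rewrite mulrA.
  apply: (@le_trans _ _ (r * dr s + \sum_c wt k blk beta s c *
     (adot a (incr R blk s c) ^+ 2 / (8 * (e + n%:R^-1))))); first by move: rd var; only_section; lra.
  rewrite rdE -big_split; apply: ler_sum => c _ /=; rewrite -mulrDr.
  apply: ler_wpM2l; first exact: wt_ge0.
  apply: huber_convex_near => //; apply: (adot_le cm) => i; exact: incr_le.
have : \sum_s gibbs k blk beta s * (V * (`|crit a blk s| <= e)%R%:R - `|dr s|) <= 0.
  rewrite -[leRHS](gibbs_step_sub cm blk n_gt0 phi); apply: ler_sum => s _.
  by apply: ler_wpM2l; [exact: gibbs_ge0 | exact: key].
under eq_bigr => s _ do rewrite mulrBr (mulrCA _ V).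
rewrite sumrB -mulr_sumr subr_le0 => h.
rewrite -(ler_pM2l V0); apply: le_trans h _; apply: le_trans (Hd n blk n_gt0 bp) _.
rewrite -/w /V le_eqVlt; apply/orP; left; apply/eqP.
have en : e + n%:R^-1 != 0 by rewrite gt_eqF // addr_gt0.
move: en; set z := e + n%:R^-1 => z0.
by rewrite wN; field; rewrite z0 !gt_eqF.
Qed.

Lemma lower_bound : exists2 c, 0 < c & forall (n : nat) (blk : 'I_n -> 'I_m),
  (0 < n)%N -> blocks p blk -> forall t : nat,
  t%:R <= c * Num.sqrt (n%:R : R) ^+ 3 -> 4^-1 < dist_mix k blk beta t.
Proof.
have [C1 C10 Hsmall] := gibbs_crit_small.
have [Cx Cx0 Hx] := adot_sqr_le cm.
have [cE [CE [cE0 CE0 HE]]] := step_energy_le cm.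
have K0 := cK_gt0 cm.
(* For [e = eta / n^{1/4}] the Gibbs mass of [|X| <= e] is at most [1/8] from [eta] plus
   [C1 / n^{3/4}], also at most [1/8] once [n^{1/4} >= W0]. *)
pose eta := (8 * C1)^-1.
have eta0 : 0 < eta by rewrite invr_gt0 mulr_gt0.
pose W0 := 1 + 8 * C1 + 8 * cK * Cx / eta ^+ 2.
have t1 : 0 <= 8 * C1 by rewrite mulr_ge0 // ltW.
have t2 : 0 <= 8 * cK * Cx / eta ^+ 2.
  by rewrite divr_ge0 ?sqr_ge0 // ltW // !mulr_gt0.
have W01 : 1 <= W0 by rewrite /W0; move: t1 t2; only_section; lra.
have W00 : 0 < W0 by apply: lt_le_trans W01.
(* The growth [CE / n^2] of the energy over [c1 n^{3/2}] steps then contributes exactly [1/8] to the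
   Markov bound. *)
pose c1 := eta ^+ 2 / (8 * CE * Cx).
have c10 : 0 < c1 by rewrite divr_gt0 ?exprn_gt0 // !mulr_gt0.
pose c := Num.min c1 (W0 ^+ 6 * 2)^-1.
have c0 : 0 < c by rewrite lt_min c10 /= invr_gt0 mulr_gt0 // exprn_gt0.
have cc1 : c <= c1 by rewrite ge_min lexx.
have cW : c * W0 ^+ 6 <= 2^-1.
  have h : c <= (W0 ^+ 6 * 2)^-1 by rewrite ge_min lexx orbT.
  have W60 : 0 < W0 ^+ 6 by rewrite exprn_gt0.
  apply: le_trans (ler_wpM2r (ltW W60) h) _.
  by rewrite le_eqVlt; apply/orP; left; apply/eqP; field; rewrite gt_eqF.
exists c => // n blk n_gt0 bp t Ht.
have N0 : 0 < n%:R :> R by rewrite ltr0n.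
have N1 : 1 <= n%:R :> R by rewrite ler1n.
pose w : R := qrt n%:R.
have w0 : 0 < w by exact: qrt_gt0.
have wN : n%:R = w ^+ 4 :> R by rewrite qrtK // ltW.
have ws : Num.sqrt n%:R = w ^+ 2 by rewrite sqr_sqrtr // sqrtr_ge0.
rewrite ws -exprM in Ht.
(* Below the threshold the choice of [c] leaves only [t = 0]. *)
have [wW|wW] := ltP w W0.
  have : t%:R < 1 :> R.
    have : c * w ^+ 6 <= c * W0 ^+ 6.
      by rewrite ler_pM2l //; apply: lerXn2r; rewrite ?nnegrE ltW.
    by move: Ht cW; only_section; lra.
  move=> h; have -> : t = 0%N by apply/eqP; rewrite -leqn0 -ltnS -(ltr_nat R).
  apply: (@lt_le_trans _ _ 2^-1); last exact: dist_mix0.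
  by rewrite ltf_pV2 ?posrE // ltr_nat.
have w1 : 1 <= w by apply: le_trans wW.
pose e := eta / w; have e0 : 0 < e by rewrite divr_gt0.
pose f s : R := (e < `|crit a blk s|)%R%:R.
have f01 s : 0 <= f s <= 1 by rewrite /f; case: ltP => _; rewrite ?lexx ler01.
have [x Qx] := low_energy_state cm blk n_gt0.
apply: lt_le_trans (dist_mix_ge k blk beta n_gt0 t x f01).
have mu : 3 / 4 <= \sum_u gibbs k blk beta u * f u.
  have -> : \sum_u gibbs k blk beta u * f u =
      1 - \sum_u gibbs k blk beta u * (`|crit a blk u| <= e)%R%:R.
    rewrite -[X in _ = X - _](gibbs_sum1 k blk beta) -sumrB; apply: eq_bigr => u _.
    by rewrite /f ltNge; case: leP => _; rewrite /= ?mulr0 ?mulr1 ?subrr ?subr0.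
  have := Hsmall n blk n_gt0 bp e e0; rewrite -/w => h.
  have : C1 * w * (e + n%:R^-1) <= 4^-1.
    have -> : C1 * w * (e + n%:R^-1) = C1 * eta + C1 / w ^+ 3.
      by rewrite /e wN; field; rewrite gt_eqF.
    have -> : C1 * eta = 8^-1 by rewrite /eta; field; rewrite gt_eqF.
    have : C1 / w ^+ 3 <= 8^-1.
      rewrite ler_pdivrMr ?exprn_gt0 // mulrC ler_pdivlMr // mulrC.
      apply: (@le_trans _ _ w); first by apply: le_trans wW; rewrite /W0; move: t2; only_section; lra.
      by rewrite -[leLHS]expr1 ler_weXn2l.
    by only_section; lra.
  by move: h; only_section; lra.
have law : iter t (step k blk beta) f x <= 4^-1.
  have fX u : f u <= 0 + Cx / e ^+ 2 * energy k blk u.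
    rewrite add0r; have Q0 := energy_ge0 cm blk u.
    rewrite /f; case: ltP => hu; last by rewrite mulr_ge0 // divr_ge0 ?sqr_ge0 // ltW.
    rewrite mulrAC ler_pdivlMr ?exprn_gt0 // mul1r; apply: le_trans (Hx _).
    rewrite -/(crit a blk u) -[leRHS]real_normK ?num_real //.
    by apply: lerXn2r; rewrite ?nnegrE ?(ltW e0) // ltW.
  apply: le_trans (iter_step_le k blk beta n_gt0 t x fX) _.
  rewrite iter_step_affine // add0r.
  have step1 y : step k blk beta (energy k blk) y <= energy k blk y + CE / n%:R ^+ 2.
    apply: le_trans (HE n blk n_gt0 bp y) _; rewrite lerD2r gerBl.
    rewrite mulr_ge0 ?divr_ge0 ?(ltW cE0) ?(ltW N0) // sumr_ge0 // => i _.
    by rewrite mulr_ge0 ?exprn_even_ge0 // ltW // (cm_p cm).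
  have Et := iter_energy_le n_gt0 step1 t x.
  have Ce : 0 < Cx / e ^+ 2 by rewrite divr_gt0 // exprn_gt0.
  have h1 : Cx / e ^+ 2 * (cK / n%:R) <= 8^-1.
    have -> : Cx / e ^+ 2 * (cK / n%:R) = cK * Cx / eta ^+ 2 / w ^+ 2.
      by rewrite /e wN; move: K0; set K := cK => K0; field; rewrite !gt_eqF.
    rewrite ler_pdivrMr ?exprn_gt0 // [leRHS]mulrC ler_pdivlMr // [leLHS]mulrC.
    have -> : 8 * (cK * Cx / eta ^+ 2) = 8 * cK * Cx / eta ^+ 2 by rewrite !mulrA.
    apply: (@le_trans _ _ w); first by apply: le_trans wW; rewrite /W0; move: t1; only_section; lra.
    by rewrite -[leLHS]expr1 ler_weXn2l.
  have h2 : Cx / e ^+ 2 * (CE / n%:R ^+ 2 * t%:R) <= 8^-1.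
    have tc : t%:R <= c1 * w ^+ 6.
      by apply: le_trans Ht _; rewrite ler_pM2r ?exprn_gt0.
    have CN : 0 < CE / n%:R ^+ 2 by rewrite divr_gt0 // exprn_gt0.
    apply: (@le_trans _ _ (Cx / e ^+ 2 * (CE / n%:R ^+ 2 * (c1 * w ^+ 6)))).
      by rewrite ler_pM2l // ler_pM2l.
    by rewrite /c1 /e wN le_eqVlt; apply/orP; left; apply/eqP; field; rewrite !gt_eqF.
  have := ler_wpM2l (ltW Ce) Et; have := ler_wpM2l (ltW Ce) Qx.
  by move: h1 h2; only_section; lra.
by move: mu law; only_section; lra.
Qed.

End GibbsSpread.

Lemma powR_three_halves (R : realType) (x : R) : 0 <= x -> x `^ (3 / 2) = Num.sqrt x ^+ 3.
Proof.
move=> x0; have -> : 3 / 2 = 2^-1 * 3%:R :> R by rewrite mulrC.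
by rewrite powRrM powR12_sqrt // powR_mulrn ?sqrtr_ge0.
Qed.

(** Summing the eigenvector equation over all components, with [a] of total mass one, identifies the
    eigenvalue with the double sum that defines [beta]. *)
Lemma critical_model_perron (R : realType) (m : nat) (p : 'I_m -> R) (k : 'M[R]_m)
  (a : 'I_m -> R) (beta : R) :
  (forall i, 0 < p i) -> \sum_i p i = 1 -> (forall i j, 0 < k i j) -> posdef k ->
  left_perron_vector (\matrix_(i, j) (p i * k i j)) a ->
  beta = (\sum_i \sum_j a i * p i * k i j)^-1 ->
  critical_model p a k beta.
Proof.
move=> p0 p1 k0 kpd [a0 [a1 [lam eig]]] betaE.
have eig' j : \sum_i a i * p i * k i j = lam * a j.
  by rewrite -eig; apply: eq_bigr => i _; rewrite mxE mulrA.
have lamE : \sum_i \sum_j a i * p i * k i j = lam.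
  rewrite exchange_big /=; under eq_bigr => j _ do rewrite eig'.
  by rewrite -mulr_sumr a1 mulr1.
have lam0 : 0 < lam.
  have [i0 _] : exists i0 : 'I_m, true.
    case: (pickP (fun i : 'I_m => true)) => [i _|e]; first by exists i.
    by move: p1; rewrite big_pred0 // => /eqP; rewrite eq_sym oner_eq0.
  rewrite -lamE (bigD1 i0) //= (bigD1 i0) //= -addrA ltr_pwDl ?mulr_gt0 //.
  rewrite addr_ge0 // sumr_ge0 // => i _; rewrite ?sumr_ge0 // => *;
    by rewrite !mulr_ge0 // ltW.
rewrite lamE in betaE.
split=> //; first by rewrite betaE invr_gt0.
move=> i; rewrite betaE invrK -eig'; apply: eq_bigr => j _.
by rewrite (posdef_sym kpd i j); ring.
Qed.

Theorem theorem3p2 (R : realType) (m : nat) (p : 'I_m -> R) (k : 'M[R]_m)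
  (a : 'I_m -> R) (beta : R) :
  (forall i, 0 < p i) -> \sum_i p i = 1 ->
  k^T = k -> (forall i j, 0 < k i j) -> posdef k ->
  left_perron_vector (\matrix_(i, j) (p i * k i j)) a ->
  beta = (\sum_i \sum_j a i * p i * k i j)^-1 ->
  exists C1 C2 : R, 0 < C1 /\ 0 < C2 /\
    forall (n : nat) (blk : 'I_n -> 'I_m),
      (0 < n)%N ->
      (forall i, (#|[set v | blk v == i]|)%:R = n%:R * p i) ->
      C1 * (n%:R `^ (3 / 2)) <= (tmix k blk beta)%:R <= C2 * (n%:R `^ (3 / 2)).
Proof.
move=> p0 p1 _ k0 kpd ap betaE.
have cm := critical_model_perron p0 p1 k0 kpd ap betaE.
have [C2 C20 Hup] := upper_bound cm.
have [C1 C10 Hlow] := lower_bound cm.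
exists C1, C2; split=> //; split=> // n blk n_gt0 bp.
rewrite powR_three_halves //.
have [t0 t0le dt0] := Hup n blk n_gt0 bp.
(* The upper bound also excludes the default value 0 of [tmix]. *)
rewrite /tmix; case: pselect => [ex|[]]; last by exists t0.
case: ex_minnP => t dt tmin; apply/andP; split; last first.
  by apply: le_trans t0le; rewrite ler_nat; exact: tmin.
rewrite leNgt; apply/negP => /ltW tlt.
by have := Hlow n blk n_gt0 bp t tlt; rewrite ltNge dt.
Qed.
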